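(* Let $(W,S)$ be an irreducible Coxeter system of arbitrary (possibly infinite) rank. The only nontrivial direct product decompositions of $W$ (as an abstract group) are the following. If $W=G_1\times G_2$ with $G_1,G_2$ nontrivial subgroups of $W$, then one of $G_1,G_2$ is the center $Z(W)$, which is then nontrivial and isomorphic to $W(A_1)$, and $W$ is isomorphic to $W(\mathcal{T})$ for some $\mathcal{T}\in\{B_{2k+1}, I_2(4k+2)\ (k\geq 1),\ E_7,\ H_3\}$. Conversely, in each of these cases $Z(W)$ is a proper direct factor of $W$, where $$W(B_{2k+1})\simeq W(A_1)\times W(D_{2k+1}),\qquad W(I_2(4k+2))\simeq W(A_1)\times W(I_2(2k+1)),$$ and $W=Z(W)\times W^+$ if $W=W(E_7)$ or $W=W(H_3)$. In particular, $W$ is directly indecomposable if and only if $W\not\simeq W(\mathcal{T})$ for all of $\mathcal{T}=B_{2k+1}$, $I_2(4k+2)$ ($k\geq 1$), $E_7$, $H_3$.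
   Context: A Coxeter system $(W,S)$ consists of a group $W$ with presentation $\langle S\mid (st)^{m(s,t)}=1 \text{ for } s,t\in S,\ m(s,t)<\infty\rangle$, where $m:S\times S\to\{1,2,\dots\}\cup\{\infty\}$ is symmetric and $m(s,t)=1$ iff $s=t$. $S$ may have arbitrary cardinality (the rank). The Coxeter graph has vertex set $S$ and an edge labelled $m(s,t)$ between $s,t$ whenever $m(s,t)\geq 3$ (label $3$ is usually omitted). $(W,S)$ (and $W$) is irreducible if the Coxeter graph is connected. $W^+$ is the subgroup of elements of even length with respect to $S$. $W(\mathcal{T})$ is the Coxeter group with Coxeter graph $\Gamma(\mathcal{T})$; its vertices are $s_1,s_2,\dots$, and edges are labelled $3$ unless specified. $A_n$: path $s_1-s_2-\cdots-s_n$. $B_n$: path $s_1-\cdots-s_n$ with edge $s_1s_2$ labelled $4$. $D_n$: edges $s_1s_3$, $s_2s_3$, and $s_is_{i+1}$ for $3\leq i<n$ (so $\Gamma(D_3)\simeq\Gamma(A_3)$). $E_7$: edges $s_1s_3,s_3s_4,s_4s_5,s_5s_6,s_6s_7,s_2s_4$. $H_3$: path $s_1-s_2-s_3$ with $s_1s_2$ labelled $5$. $I_2(m)$: two vertices joined by an edge labelled $m$ (so $I_2(3)=A_2$). A group is directly indecomposable if it is not the direct product of two nontrivial subgroups. *)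

(* Defs.v *)
From HB Require Import structures.
From mathcomp Require Import all_boot all_classical.

Set Implicit Arguments.
Unset Strict Implicit.
Unset Printing Implicit Defensive.

Local Open Scope classical_set_scope.
Local Open Scope quotient_scope.
Local Open Scope group_scope.

(* The group presented by generators I and relators R, as a quotient of the   *)
(* words over I x bool; the letter (i, false) stands for the generator i and  *)
(* (i, true) for its inverse.                                                 *)
Section Presentation.
Variables (I : choiceType) (R : set (seq (I * bool))).
Implicit Types u v w : seq (I * bool).

Inductive word_eqv : seq (I * bool) -> seq (I * bool) -> Prop :=
| word_eqv_refl u : word_eqv u u
| word_eqv_sym u v : word_eqv u v -> word_eqv v u
| word_eqv_trans u v w : word_eqv u v -> word_eqv v w -> word_eqv u w
| word_eqv_cat u u' v v' :
    word_eqv u u' -> word_eqv v v' -> word_eqv (u ++ v) (u' ++ v')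
| word_eqv_cancel i b : word_eqv [:: (i, b); (i, ~~ b)] [::]
| word_eqv_relator r : R r -> word_eqv r [::].

Definition word_eqvb u v : bool := `[< word_eqv u v >].

Lemma word_eqvb_equiv : equiv_class_of word_eqvb.
Proof.
split=> [u | u v | v u w]; first exact/asboolP/word_eqv_refl.
  by apply/asboolP/asboolP => /word_eqv_sym.
by move=> /asboolP uv /asboolP vw; apply/asboolP/(word_eqv_trans uv vw).
Qed.

Canonical word_eqvb_equiv_rel := EquivRelPack word_eqvb_equiv.

Definition presented_group : Type := {eq_quot word_eqvb}.
HB.instance Definition _ := Choice.on presented_group.

Definition word_class w : presented_group := \pi_({eq_quot word_eqvb}) w.
Definition class_word (x : presented_group) : seq (I * bool) :=
  repr (x : {eq_quot word_eqvb}).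

Lemma class_wordK : cancel class_word word_class.
Proof. by move=> x; rewrite /word_class /class_word reprK. Qed.

Lemma word_classP u v : word_class u = word_class v <-> word_eqv u v.
Proof.
by split=> [/eqquotP /asboolP // | uv]; apply/eqquotP/asboolP.
Qed.

Lemma class_word_eqv w : word_eqv (class_word (word_class w)) w.
Proof. by apply/word_classP; rewrite class_wordK. Qed.

Definition inv_word w := rev [seq (a.1, ~~ a.2) | a <- w].

Lemma mul_inv_word w : word_eqv (w ++ inv_word w) [::].
Proof.
elim: w => [|[i b] w IHw]; first exact: word_eqv_refl.
have -> : ((i, b) :: w) ++ inv_word ((i, b) :: w)
    = [:: (i, b)] ++ ((w ++ inv_word w) ++ [:: (i, ~~ b)]).
  by rewrite /inv_word /= rev_cons -cats1 -!catA.
apply: word_eqv_trans (word_eqv_cancel i b).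
rewrite -[[:: (i, b); _]]/([:: (i, b)] ++ ([::] ++ [:: (i, ~~ b)])).
apply: word_eqv_cat; first exact: word_eqv_refl.
by apply: word_eqv_cat; last exact: word_eqv_refl.
Qed.

Lemma inv_wordK : involutive inv_word.
Proof.
move=> w; rewrite /inv_word map_rev revK -map_comp -[RHS]map_id.
by apply: eq_map => -[i b] /=; rewrite negbK.
Qed.

Lemma inv_word_mul w : word_eqv (inv_word w ++ w) [::].
Proof. by have := mul_inv_word (inv_word w); rewrite inv_wordK. Qed.

Definition pmul (x y : presented_group) :=
  word_class (class_word x ++ class_word y).
Definition pone : presented_group := word_class [::].
Definition pinv (x : presented_group) := word_class (inv_word (class_word x)).

Lemma pmulE u v : pmul (word_class u) (word_class v) = word_class (u ++ v).
Proof. by apply/word_classP/word_eqv_cat; apply: class_word_eqv. Qed.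

Lemma pmulA : associative pmul.
Proof.
move=> x y z; rewrite -[x]class_wordK -[y]class_wordK -[z]class_wordK.
by rewrite !pmulE catA.
Qed.

Lemma pmul1g : left_id pone pmul.
Proof. by move=> x; rewrite -[x]class_wordK pmulE. Qed.

Lemma pmulg1 : right_id pone pmul.
Proof. by move=> x; rewrite -[x]class_wordK pmulE cats0. Qed.

Lemma pmulVg : left_inverse pone pinv pmul.
Proof.
by move=> x; rewrite -{2}[x]class_wordK pmulE; apply/word_classP/inv_word_mul.
Qed.

Lemma pmulgV : right_inverse pone pinv pmul.
Proof.
by move=> x; rewrite -{1}[x]class_wordK pmulE; apply/word_classP/mul_inv_word.
Qed.

HB.instance Definition _ :=
  isGroup.Build presented_group pmulA pmul1g pmulg1 pmulVg pmulgV.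

End Presentation.

(* Coxeter matrices take values in nat, the value 0 standing for infinity.    *)
Section CoxeterMatrix.
Variables (I : choiceType) (m : I -> I -> nat).

Definition coxeter_matrix : Prop :=
  (forall s t, m s t = m t s) /\ (forall s t, m s t = 1%N <-> s = t).

Definition coxeter_relators : set (seq (I * bool)) :=
  [set r | exists s t, m s t <> 0%N /\
     r = flatten (nseq (m s t) [:: (s, false); (t, false)])].

Definition coxeter_group : groupType := presented_group coxeter_relators.

Definition coxeter_gen (s : I) : coxeter_group :=
  word_class coxeter_relators [:: (s, false)].

Definition coxeter_edge : rel I :=
  [rel s t | (m s t == 0%N) || (3 <= m s t)%N].

Definition irreducible_coxeter : Prop :=
  forall s t, exists2 p : seq I, path coxeter_edge s p & t = last s p.

End CoxeterMatrix.

Definition coxeter_system (W : groupType) (S : set W) (m : S -> S -> nat) :=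
  coxeter_matrix m /\
  exists f : {multiplicative coxeter_group m -> W},
    bijective f /\ forall s : S, f (coxeter_gen m s) = val s.

Definition group_isomorphic (G H : groupType) : Prop :=
  exists f : {multiplicative G -> H}, bijective f.

Section Subgroups.
Variable G : groupType.
Implicit Types A B : set G.

Definition subgroup A : Prop := group_closed (mem A).

Definition subgroup_isomorphic A (H : groupType) : Prop :=
  exists f : {multiplicative H -> G}, injective f /\ range f = A.

Definition center : set G := [set z | forall x : G, commute z x].

(* G is the internal direct product of its subgroups A and B. *)
Definition direct_product A B : Prop :=
  [/\ subgroup A, subgroup B,
      forall a b, A a -> B b -> commute a b,
      A `&` B = [set 1]
    & forall x : G, exists a b, [/\ A a, B b & x = a * b]].

Definition proper_direct_factor A : Prop :=
  [/\ A <> [set 1], A <> setT & exists B, direct_product A B].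

Definition directly_indecomposable : Prop :=
  ~ exists A B, [/\ A <> [set 1], B <> [set 1] & direct_product A B].

(* Words in S suffice to define the length, without inverses, since the       *)
(* elements of S are involutions in a Coxeter system.                         *)
Definition has_word (S : set G) (w : G) (n : nat) : Prop :=
  exists u : seq G,
    [/\ size u = n, forall s, s \in u -> S s & \prod_(s <- u) s = w].

Definition is_length (S : set G) (w : G) (n : nat) : Prop :=
  has_word S w n /\ forall k, has_word S w k -> (n <= k)%N.

Definition even_elements (S : set G) : set G :=
  [set w | exists n, is_length S w n /\ ~~ odd n].

End Subgroups.

Arguments center : clear implicits.
Arguments directly_indecomposable : clear implicits.

Inductive coxeter_type :=
| A_ of nat | B_ of nat | D_ of nat | E7 | H3 | I2 of nat.

Definition rank (T : coxeter_type) : nat :=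
  match T with A_ n | B_ n | D_ n => n | E7 => 7 | H3 => 3 | I2 _ => 2 end.

(* The label of {s_i, s_j} for 1 <= i < j, with label 2 for non-edges. *)
Definition edge_label (T : coxeter_type) (i j : nat) : nat :=
  match T with
  | A_ _ => if j == i.+1 then 3 else 2
  | B_ _ => if j == i.+1 then (if i == 1 then 4 else 3) else 2
  | D_ _ => if ((i, j) \in [:: (1, 3); (2, 3)]) || ((3 <= i) && (j == i.+1))
            then 3 else 2
  | E7 => if (i, j) \in [:: (1, 3); (3, 4); (4, 5); (5, 6); (6, 7); (2, 4)]
          then 3 else 2
  | H3 => if (i, j) == (1, 2) then 5 else if (i, j) == (2, 3) then 3 else 2
  | I2 m => m
  end%N.

(* The ordinal i : 'I_(rank T) is the vertex s_(i+1) of the Coxeter graph. *)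
Definition type_matrix (T : coxeter_type) (i j : 'I_(rank T)) : nat :=
  if i == j then 1%N else edge_label T (minn i j).+1 (maxn i j).+1.

Definition coxeter_group_of (T : coxeter_type) : groupType :=
  coxeter_group (@type_matrix T).

Definition coxeter_gens_of (T : coxeter_type) : set (coxeter_group_of T) :=
  range (coxeter_gen (@type_matrix T)).

Arguments coxeter_gens_of : clear implicits.

Inductive exceptional_type : coxeter_type -> Prop :=
| exceptional_B k : (1 <= k)%N -> exceptional_type (B_ (2 * k + 1))
| exceptional_I2 k : (1 <= k)%N -> exceptional_type (I2 (4 * k + 2))
| exceptional_E7 : exceptional_type E7
| exceptional_H3 : exceptional_type H3.

(* Main.v *)
(* In the geometric representation, let s = a b with a in G1 and b in G2 be a  *)
(* simple reflection with root al. As G1 and G2 commute, b is a scalar on the  *)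
(* span of G1 al, and a on the span of G2 al; expanding s (g h al) for g in G1 *)
(* and h in G2 shows that g h al is a combination of g al, h al and al, which  *)
(* forces one of the factors to preserve the line of al. By irreducibility it  *)
(* acts by scalars, hence it is {1, -1}, the center of W.                      *)
(* It remains to find the W containing -1 with a character chi such that       *)
(* chi(-1) = -1. Then S is finite, and there is no nonzero v >= 0 with         *)
(* (v, a_s) <= 0 for all s, since -v would be dominant and -1 would map it     *)
(* above itself. Hence no subdiagram is affine, and the classification of      *)
(* diagrams follows by inspection of a longest path. The types which are not   *)
(* exceptional are excluded by the determinant of -1, by writing -1 as a power *)
(* of a Coxeter element, by the permutation of the weights (type A) or by the  *)
(* embedding of D_n in B_n (n odd). In types B and I2, a reflection subgroup   *)
(* of index 2 is a complement of the center.                                   *)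

(* The group W acts on the real space V with basis the simple roots, preserving the form [cform],
   and in any rank the action is faithful by the sign theorem for roots ([act_root_ge0],
   [act_faithful]). Irreducibility enters through [orbit_span]: the orbit of one simple root spans
   V.

   Let W be the direct product of A and B, and write a simple reflection s with root al as s = a b.
   Then a and b commute with s, so they preserve the line of al, with eigenvalues of product -1.
   Computing s (g h al) in two ways for g in A and h in B gives [act_perp], and [splits_scalar]
   concludes that one whole factor preserves the line of al. That factor acts by scalars on V, hence
   is {1, -1}, which is the center ([direct_product_neg_one], [center_neg_one]). The other factor is
   the kernel of a character to Z/2 that is nontrivial at -1, and conversely such a character yields
   a complement ([center_char_product]). The question becomes which irreducible W contain -1 and
   have a character nontrivial on it.

   If W contains -1, then S is finite, because a word for -1 uses every generator. Moreover no
   nonzero v >= 0 has (v, a_s) <= 0 for all s ([no_subaffine]): by [act_dominant] applied to -v and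
   -1, the vector -2v would be nonnegative. Affine subdiagrams carry such a v, so excluding them
   around a longest path of the graph leaves the short list [classified].

   On this list the characters are settled by knowing -1 explicitly. When all edge labels are odd,
   the sign is the only nontrivial character and its value at -1 is given by the determinant
   ([parity_neg_one]). In types B, I2, E7, H3 and F4, -1 is a power of a Coxeter element. In type A
   of rank at least 2 there is no -1, since W permutes the weights; for n odd, D_n embeds into B_n
   inside the kernel of a character that is nontrivial at -1. This embedding and its analogue for I2
   ([fold_hom]) also give the two product decompositions ([fold_product]). *)
From HB Require Import structures.
Require Import Defs.
From mathcomp Require Import all_boot all_classical.
From mathcomp Require Import all_order all_algebra ring lra zify.
From mathcomp Require Import reals trigo Rstruct.
From mathcomp.multinomials Require Import freeg.

Set Implicit Arguments.
Unset Strict Implicit.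
Unset Printing Implicit Defensive.
Import Order.TTheory GRing.Theory Num.Theory.
Local Open Scope classical_set_scope.
Local Open Scope ring_scope.

(** * The numbers 2 cos (pi / n) *)

Section Kappa.
Variable R : realType.

(* The label 0 encodes infinity, whence the value 2 = 2 cos 0. *)
Definition kappa (n : nat) : R :=
  if n is 0%N then 2 else 2 * cos (pi / n%:R).

(* Chebyshev polynomials of the second kind, shifted by one:                  *)
(* [chebU (2 cos t) n = sin (n t) / sin t].                                   *)
Fixpoint chebU (c : R) (n : nat) : R :=
  match n with
  | 0%N => 0
  | n1.+1 => if n1 is n2.+1 then c * chebU c n1 - chebU c n2 else 1
  end.

Lemma chebUSS c n : chebU c n.+2 = c * chebU c n.+1 - chebU c n.
Proof. by []. Qed.

Lemma chebU_sin (t : R) n : sin t * chebU (2 * cos t) n = sin (t *+ n).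
Proof.
elim/ltn_ind: n => -[|[|n]] IH.
- by rewrite mulr0 mulr0n sin0.
- by rewrite mulr1 mulr1n.
rewrite chebUSS mulrBr mulrCA !IH //.
have -> : t *+ n.+2 = t *+ n.+1 + t by rewrite mulrSr.
have -> : t *+ n = t *+ n.+1 - t by rewrite mulrSr addrK.
rewrite sinB trigo.sinD; ring.
Qed.

Lemma chebU2 n : chebU 2 n = n%:R.
Proof.
elim/ltn_ind: n => -[|[|n]] IH //.
by rewrite chebUSS !IH // -!natr1; ring.
Qed.

Let angle_bounds n : (1 < n)%N -> 0 < (pi : R) / n%:R <= pi / 2.
Proof.
move=> n1; have n0 : 0 < (n%:R : R) by rewrite ltr0n; lia.
have pi0 := pi_gt0 R; have n2 : (2 : R) <= n%:R by rewrite (ler_nat _ 2).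
rewrite divr_gt0 //= ler_pdivrMr // mulrAC ler_pdivlMr //.
by rewrite ler_pM2l.
Qed.

Let angle_gtN n : (1 < n)%N -> - ((pi : R) / 2) < pi / n%:R.
Proof.
move=> /angle_bounds/andP[]; move: (pi / n%:R) => x x0 _.
by have := pi_gt0 R; lra.
Qed.

Let angle_ltpi n : (1 < n)%N -> (pi : R) / n%:R < pi.
Proof.
move=> /angle_bounds/andP[]; move: (pi / n%:R) => x x0.
by have := pi_gt0 R; lra.
Qed.

Lemma kappa1 : kappa 1 = -2.
Proof. by rewrite /kappa divr1 cospi; ring. Qed.

Lemma kappa2 : kappa 2 = 0.
Proof. by rewrite /kappa cos_pihalf mulr0. Qed.

Lemma kappa_ge0 n : n <> 1%N -> 0 <= kappa n.
Proof.
case: n => [|[|n]] // _; rewrite /kappa mulr_ge0 //.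
have /andP[a0 a1] := angle_bounds (isT : (1 < n.+2)%N).
by apply: cos_ge0_pihalf; rewrite a1 ltW ?angle_gtN.
Qed.

Lemma kappa_lt2 n : (0 < n)%N -> kappa n < 2.
Proof.
case: n => [|[|n]] // _; first by rewrite kappa1; lra.
have /andP[a0 a1] := angle_bounds (isT : (1 < n.+2)%N).
rewrite /kappa -[ltRHS]mulr1 ltr_pM2l // -[ltRHS]cos0.
have p0 := pi_ge0 R.
by rewrite ltr_cos // in_itv /= ?lexx ?p0 // (ltW a0) (ltW (angle_ltpi _)).
Qed.

Lemma kappa_le n p : (0 < n)%N -> (n <= p)%N \/ p = 0%N -> kappa n <= kappa p.
Proof.
move=> n0 [np|->]; last exact/ltW/kappa_lt2.
have p0 : (0 < p)%N by lia.
rewrite /kappa; case: n p => [//|n] [//|p] in n0 np p0 *.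
rewrite ler_pM2l // le_eqVlt; have [<-|nNp] := eqVneq n p; first by rewrite eqxx.
have pi0 := pi_gt0 R.
have bnd k : 0 <= (pi : R) / k.+1%:R <= pi.
  rewrite divr_ge0 ?pi_ge0 //= ler_pdivrMr ?ltr0n //.
  by rewrite ler_peMr ?ler1n ?pi_ge0.
rewrite ltr_cos ?in_itv /= ?bnd // orbC ltr_pM2l // ltf_pV2 ?posrE ?ltr0n //.
by rewrite ltr_nat; apply/orP; left; lia.
Qed.

(** Half-angle formula. It yields [kappa4] and [kappa6], and later makes the form on the folded
    roots match the halved label. *)
Lemma kappa_double n : (0 < n)%N -> kappa (2 * n) ^+ 2 = kappa n + 2.
Proof.
case: n => // n _; set t : R := pi / (2 * n.+1)%:R.
have -> : kappa (2 * n.+1) = 2 * cos t by [].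
have -> : kappa n.+1 = 2 * cos (t *+ 2).
  have x0 : (n.+1%:R : R) != 0 by rewrite pnatr_eq0.
  rewrite /kappa /t natrM; move: (n.+1%:R) x0 => x x0; congr (2 * cos _).
  by rewrite -mulr_natr; field.
by rewrite cos_mulr2n; ring.
Qed.

Lemma kappa_pos n : n <> 1%N -> n <> 2%N -> 0 < kappa n.
Proof.
move=> n1 n2; have [->|n0] := eqVneq n 0%N; first by rewrite /kappa.
have n3 : (2 < n)%N by lia.
have /andP[a0 a1] := angle_bounds (ltnW n3).
have -> : kappa n = 2 * cos (pi / n%:R) by rewrite /kappa; case: (n) n0.
rewrite mulr_gt0 //; apply: cos_gt0_pihalf; apply/andP; split.
  by rewrite angle_gtN // ltnW.
rewrite ltr_pM2l ?pi_gt0 // ltf_pV2 ?posrE ?ltr0n //; last by lia.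
by rewrite (ltr_nat _ 2).
Qed.

Lemma kappa3 : kappa 3 = 1.
Proof.
set t : R := pi / 3%:R; have -> : kappa 3 = 2 * cos t by [].
have k0 : 0 < 2 * cos t := @kappa_pos 3 (fun e => ltac:(discriminate e))
  (fun e => ltac:(discriminate e)).
have : cos (t *+ 2 + t) = -1.
  by rewrite -cospi; congr cos; rewrite /t; field.
rewrite trigo.cosD sin_mulr2n cos_mulr2n => E.
have S : sin t ^+ 2 = 1 - cos t ^+ 2 by rewrite -(cos2Dsin2 t); ring.
(* With c = 2 cos t, the equation cos 3t = -1 is c^3 - 3c + 2 = 0, that is (c + 2)(c - 1)^2 = 0;
   positivity of c excludes -2. *)
have : (2 * cos t + 2) * (2 * cos t - 1) ^+ 2 = 0.
  have -> : (2 * cos t + 2) * (2 * cos t - 1) ^+ 2 =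
    2 * ((cos t ^+ 2 *+ 2 - 1) * cos t - (cos t * (1 - cos t ^+ 2)) *+ 2) + 2.
    ring.
  rewrite -S; move: E; rewrite expr2.
  have -> : (cos t * sin t *+ 2) * sin t = (cos t * (sin t * sin t)) *+ 2 by ring.
  by move=> ->; ring.
move/eqP; rewrite mulf_eq0 sqrf_eq0 => /orP[/eqP|/eqP]; lra.
Qed.

Lemma kappa4 : kappa 4 ^+ 2 = 2.
Proof. by rewrite (@kappa_double 2) // kappa2 add0r. Qed.

Lemma kappa6 : kappa 6 ^+ 2 = 3.
Proof. by rewrite (@kappa_double 3) // kappa3; ring. Qed.

Lemma kappa5 : kappa 5 ^+ 2 = kappa 5 + 1.
Proof.
set t : R := pi / 5%:R; have E5 : kappa 5 = 2 * cos t by [].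
have k0 : 0 < kappa 5 by apply: kappa_pos.
(* Since 5t = pi. In c = 2 cos t this becomes (c + 2)(c^2 - c - 1) = 0. *)
have : cos (t *+ 2 + t) = - cos (t *+ 2).
  have -> : t *+ 2 + t = pi - t *+ 2 by rewrite /t; field.
  by rewrite cosB cospi sinpi; ring.
rewrite trigo.cosD sin_mulr2n cos_mulr2n => E.
have S : sin t ^+ 2 = 1 - cos t ^+ 2 by rewrite -(cos2Dsin2 t); ring.
have : (kappa 5 + 2) * (kappa 5 ^+ 2 - kappa 5 - 1) = 0.
  rewrite E5; have -> : (2 * cos t + 2) * ((2 * cos t) ^+ 2 - 2 * cos t - 1) =
    2 * ((cos t ^+ 2 *+ 2 - 1) * cos t - (cos t * (1 - cos t ^+ 2)) *+ 2) +
    2 * (cos t ^+ 2 *+ 2 - 1).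
    ring.
  rewrite -S; move: E; rewrite expr2.
  have -> : (cos t * sin t *+ 2) * sin t = (cos t * (sin t * sin t)) *+ 2 by ring.
  by move=> ->; ring.
move/eqP; rewrite mulf_eq0 => /orP[/eqP|/eqP]; lra.
Qed.

Section ChebAtKappa.
Variable n : nat.
Hypothesis n1 : (1 < n)%N.
Let t : R := pi / n%:R.
Let kE : kappa n = 2 * cos t.
Proof. by rewrite /kappa /t; case: (n) n1. Qed.
Let tn : t *+ n = pi.
Proof. by rewrite -mulr_natr /t divfK // pnatr_eq0; lia. Qed.
Let sin_t : 0 < sin t.
Proof.
have /andP[a0 a1] := angle_bounds n1; apply: sin_gt0_pi.
by rewrite a0 angle_ltpi.
Qed.

Lemma chebU_kappa_ge0_fin k : (k <= n)%N -> 0 <= chebU (kappa n) k.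
Proof.
move=> kn; rewrite -(pmulr_rge0 _ sin_t) kE chebU_sin; apply: sin_ge0_pi.
have /andP[a0 _] := angle_bounds n1.
rewrite -tn; move: (t) (a0 : 0 < t) => x x0.
rewrite mulrn_wge0 /=; last exact: ltW.
exact: ler_wpMn2l (ltW x0) _ _ kn.
Qed.

Let chebU_eq k (x : R) : sin (t *+ k) = sin t * x -> chebU (kappa n) k = x.
Proof. by move=> E; apply: (mulfI (lt0r_neq0 sin_t)); rewrite kE chebU_sin. Qed.

Lemma chebU_kappa_n : chebU (kappa n) n = 0.
Proof. by apply: chebU_eq; rewrite tn sinpi mulr0. Qed.

Lemma chebU_kappa_Sn : chebU (kappa n) n.+1 = -1.
Proof.
by apply: chebU_eq; rewrite mulrS tn trigo.sinD sinpi cospi mulr0 addr0 mulrN1.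
Qed.

Lemma chebU_kappa_2n : chebU (kappa n) (n + n) = 0.
Proof. by apply: chebU_eq; rewrite mulrnDr tn -mulr2n sin2pi mulr0. Qed.

Lemma chebU_kappa_S2n : chebU (kappa n) (n + n).+1 = 1.
Proof.
by apply: chebU_eq; rewrite mulrS mulrnDr tn -mulr2n sinD2pi mulr1.
Qed.

End ChebAtKappa.

(** The values are sin (k pi / n) / sin (pi / n), or k for an infinite label; the signs of roots
    rest on this. *)
Lemma chebU_kappa_ge0 n k :
  n <> 1%N -> (k <= n)%N \/ n = 0%N -> 0 <= chebU (kappa n) k.
Proof.
move=> n1 [kn|->]; last by rewrite chebU2 ler0n.
have [n0|n0] := eqVneq n 0%N; last by apply: chebU_kappa_ge0_fin => //; lia.
by move: kn; rewrite n0 leqn0 => /eqP ->.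
Qed.

End Kappa.

Arguments chebU : simpl never.
Arguments kappa : simpl never.

(** * Words and length in Coxeter groups *)

Section CoxeterWords.
Local Open Scope group_scope.
Variables (I : choiceType) (m : I -> I -> nat).
Local Notation G := (coxeter_group m).
Local Notation gen := (coxeter_gen m).
Local Notation class := (word_class (coxeter_relators m)).

Lemma word_class_cat u v : class (u ++ v) = (class u : G) * (class v : G).
Proof. by rewrite -pmulE. Qed.

Lemma coxeter_gen_rel s t : m s t <> 0%N -> (gen s * gen t) ^+ m s t = 1.
Proof.
move=> st; have -> : (gen s * gen t) ^+ m s t
    = class (flatten (nseq (m s t) [:: (s, false); (t, false)])).
  elim: (m s t) => [|n IHn]; first by rewrite expg0.
  rewrite expgS IHn.
  have -> : flatten (nseq n.+1 [:: (s, false); (t, false)]) =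
      ([:: (s, false)] ++ [:: (t, false)])
        ++ flatten (nseq n [:: (s, false); (t, false)]) by [].
  by rewrite !word_class_cat.
by apply/word_classP/word_eqv_relator; exists s, t.
Qed.

Hypothesis hm : coxeter_matrix m.
Let m_diag s : m s s = 1%N. Proof. by apply/(proj2 hm). Qed.

Lemma coxeter_gen_sq s : gen s * gen s = 1.
Proof. by have := @coxeter_gen_rel s s; rewrite m_diag expg1; apply. Qed.

Lemma coxeter_genV s : (gen s)^-1 = gen s.
Proof. by apply/mulg1_eq/coxeter_gen_sq. Qed.

Lemma coxeter_genK s (x : G) : gen s * (gen s * x) = x.
Proof. by rewrite mulgA coxeter_gen_sq mul1g. Qed.

Lemma coxeter_mulgenK s (x : G) : x * gen s * gen s = x.
Proof. by rewrite -mulgA coxeter_gen_sq mulg1. Qed.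

Lemma word_class_letter s b : class [:: (s, b)] = gen s.
Proof.
case: b => //; rewrite -[RHS]coxeter_genV; apply/esym/mulg1_eq.
have <- := word_class_cat [:: (s, false)] [:: (s, true)].
exact/word_classP/word_eqv_cancel.
Qed.

Definition gen_prod (u : seq I) : G := foldr (fun s (x : G) => gen s * x) 1 u.

Lemma gen_prod_cat u v : gen_prod (u ++ v) = gen_prod u * gen_prod v.
Proof. by elim: u => [|s u IHu] /=; rewrite ?mul1g // IHu mulgA. Qed.

Lemma gen_prod_rcons u s : gen_prod (rcons u s) = gen_prod u * gen s.
Proof. by rewrite -cats1 gen_prod_cat /= mulg1. Qed.

Lemma gen_prod_surj (x : G) : exists u, x = gen_prod u.
Proof.
rewrite -[x]class_wordK; elim: (class_word x) => [|[s b] w [u IHu]].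
  by exists [::].
exists (s :: u); have := word_class_cat [:: (s, b)] w.
by rewrite word_class_letter IHu.
Qed.

Lemma coxeter_ind (P : G -> Prop) :
  P 1 -> (forall s x, P x -> P (gen s * x)) -> forall x, P x.
Proof.
move=> P1 Ps x; have [u ->] := gen_prod_surj x.
by elim: u => //= s u IHu; apply: Ps.
Qed.

Section Action.
Variables (T : Type) (f : I -> T -> T).

(** The sign of a letter is dropped: the relation of label 1 makes each [f s] an involution. *)
Definition coxeter_act (x : G) (t : T) : T :=
  foldr (fun a => f a.1) t (class_word x).

Hypothesis f_rel : forall s t, m s t <> 0%N ->
  forall x, iter (m s t) (fun y => f s (f t y)) x = x.

Let fK s t : f s (f s t) = t.
Proof. by have := @f_rel s s; rewrite m_diag => f_ss; apply: (f_ss _ t). Qed.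

Let word_act w t := foldr (fun a : I * bool => f a.1) t w.

Let word_act_eqv u v :
  word_eqv (coxeter_relators m) u v -> word_act u =1 word_act v.
Proof.
rewrite /word_act; elim=> {u v} //.
- by move=> u v _ IH t; rewrite IH.
- by move=> u v w _ IH1 _ IH2 t; rewrite IH1.
- by move=> u u' v v' _ IH1 _ IH2 t; rewrite !foldr_cat IH2 IH1.
- by move=> s b t /=; rewrite fK.
- move=> _ [s [t [st ->]]] x /=; rewrite -[RHS](f_rel st).
  by elim: (m s t) => //= n ->.
Qed.

Let coxeter_act_class w : coxeter_act (class w) =1 word_act w.
Proof. exact/word_act_eqv/class_word_eqv. Qed.

Lemma coxeter_act1 t : coxeter_act 1 t = t.
Proof. exact: coxeter_act_class. Qed.

Lemma coxeter_actM x y t :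
  coxeter_act (x * y) t = coxeter_act x (coxeter_act y t).
Proof.
have -> : x * y = class (class_word x ++ class_word y).
  by rewrite word_class_cat !class_wordK.
by rewrite coxeter_act_class /word_act foldr_cat.
Qed.

Lemma coxeter_act_gen s t : coxeter_act (gen s) t = f s t.
Proof. exact: coxeter_act_class. Qed.

End Action.

(** Let the generators act on H by left multiplication by the [f s]; the orbit map of 1 is the
    morphism. *)
Lemma coxeter_hom (H : groupType) (f : I -> H) :
  (forall s t, m s t <> 0%N -> (f s * f t) ^+ m s t = 1) ->
  exists phi : {multiplicative G -> H}, forall s, phi (gen s) = f s.
Proof.
move=> f_rel; set F := fun s (h : H) => f s * h.
have F_rel s t : m s t <> 0%N ->
    forall x, iter (m s t) (fun y => F s (F t y)) x = x.
  move=> st x; rewrite (@eq_iter _ _ ( *%g (f s * f t))) => [|y].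
    by rewrite iter_mulg f_rel // mul1g.
  by rewrite /F mulgA.
pose phi (x : G) : H := coxeter_act F x 1.
have actE x h : coxeter_act F x h = phi x * h.
  elim/coxeter_ind: x => [|s x IHx]; rewrite /phi.
    by rewrite !coxeter_act1 // mul1g.
  by rewrite !coxeter_actM // IHx !coxeter_act_gen // /F mulgA.
have phiM : {morph phi : x y / x * y}.
  by move=> x y; rewrite [LHS]coxeter_actM // actE.
pose phim := isMultiplicative.Build G H phi phiM.
pose phi_mult : {multiplicative G -> H} := HB.pack phi phim.
exists phi_mult => s /=.
by rewrite /phi coxeter_act_gen // /F mulg1.
Qed.

(** Characters take values in Z/2, with xor as addition. In a relator each of s and t occurs [m s t]
    times, so only odd labels impose a condition. *)
Lemma coxeter_char (c : I -> bool) :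
  (forall s t, odd (m s t) -> c s = c t) ->
  exists chi : G -> bool, (forall x y, chi (x * y) = chi x (+) chi y) /\
    (forall s, chi (gen s) = c s).
Proof.
move=> c_odd; pose F s b := c s (+) b.
have F_rel s t : m s t <> 0%N ->
    forall x, iter (m s t) (fun y => F s (F t y)) x = x.
  move=> st x; have -> n : iter n (fun y => F s (F t y)) x
      = (odd n && (c s (+) c t)) (+) x.
    elim: n => //= n ->; rewrite /F.
    by case: (c s) (c t) (odd n) x => [] [] [] [].
  case: (boolP (odd _)) => //= /c_odd ->.
  by rewrite addbb.
pose chi x := coxeter_act F x false.
have actE x b : coxeter_act F x b = chi x (+) b.
  elim/coxeter_ind: x => [|s x IHx]; rewrite /chi; first by rewrite !coxeter_act1.
  by rewrite !coxeter_actM // IHx !coxeter_act_gen // /F addbA.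
exists chi; split=> [x y|s]; first by rewrite [LHS]coxeter_actM // actE.
by rewrite /chi coxeter_act_gen // /F addbF.
Qed.

Definition parity_spec (chi : G -> bool) :=
  (forall x y, chi (x * y) = chi x (+) chi y) /\ (forall s, chi (gen s)).

Lemma coxeter_parity : exists chi, parity_spec chi.
Proof. by have [//|chi [chiM chi1]] := @coxeter_char xpredT; exists chi. Qed.

Let len_ex (x : G) : exists n, `[< exists u, size u = n /\ x = gen_prod u >].
Proof. by have [u ->] := gen_prod_surj x; exists (size u); apply/asboolP; exists u. Qed.

Definition len (x : G) : nat := ex_minn (len_ex x).

Lemma len_word x : exists u, size u = len x /\ x = gen_prod u.
Proof. by rewrite /len; case: ex_minnP => n /asboolP. Qed.

Lemma len_prod u : (len (gen_prod u) <= size u)%N.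
Proof.
by rewrite /len; case: ex_minnP => n _; apply; apply/asboolP; exists u.
Qed.

Lemma lenM x y : (len (x * y) <= len x + len y)%N.
Proof.
have [u [<- {1}->]] := len_word x; have [v [<- {1}->]] := len_word y.
by rewrite -gen_prod_cat -size_cat len_prod.
Qed.

Lemma len_gen s : (len (gen s) <= 1)%N.
Proof. by have := len_prod [:: s]; rewrite /= mulg1. Qed.

Lemma parity_prod chi u : parity_spec chi -> chi (gen_prod u) = odd (size u).
Proof.
case=> chiM chi1; elim: u => [|s u IHu] /=.
  by have := chiM 1 1; rewrite mulg1; case: (chi 1).
by rewrite chiM IHu chi1.
Qed.

Lemma parity_len chi x : parity_spec chi -> chi x = odd (len x).
Proof. by have [u [<- ->]] := len_word x; apply: parity_prod. Qed.

(** The two lengths differ by at most 1, and the sign character rules out equality. *)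
Lemma len_mulgen x s : len (x * gen s) = (len x).+1 \/ len x = (len (x * gen s)).+1.
Proof.
have [chi chiP] := coxeter_parity.
have : odd (len (x * gen s)) = ~~ odd (len x).
  by rewrite -!(parity_len _ chiP) (proj1 chiP) (proj2 chiP) addbT.
have := lenM x (gen s); have := lenM (x * gen s) (gen s).
rewrite coxeter_mulgenK; have := len_gen s.
move: (len x) (len (x * gen s)) (len (gen s)) => a b c c1 ac bc ab.
have : b <> a by move=> ba; move: ab; rewrite ba; case: odd.
lia.
Qed.

Lemma len_descent x : x <> 1 -> exists s, len x = (len (x * gen s)).+1.
Proof.
move=> x1; have [u [su xE]] := len_word x.
case: (lastP u) su xE => [_ /x1 //|v s]; rewrite size_rcons gen_prod_rcons => sv xE.
have : (len (x * gen s) <= size v)%N by rewrite xE coxeter_mulgenK len_prod.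
move=> le; exists s; case: (len_mulgen x s) => // E.
by move: le; rewrite E -sv ltnNge leqnSn.
Qed.

End CoxeterWords.

(** * The geometric representation *)

Section FreeModule.
Variables (R : realType) (I : choiceType).
Local Notation V := {freeg I / R}.

Lemma freegUZ (c : R) (s : I) : << c *g s >> = c *: << s >> :> V.
Proof.
by apply/eqP/freeg_eqP => i; rewrite coeffZ !coeffU mul1r.
Qed.

Lemma freeg_ind_lin (P : V -> Prop) : P 0 ->
  (forall u v, P u -> P v -> P (u + v)) -> (forall c s, P (c *: << s >>)) ->
  forall v, P v.
Proof.
move=> P0 PD PZ v; rewrite -(freeg_sumE v).
by elim/big_ind: _ => // s _; rewrite freegUZ.
Qed.

Variable M : lmodType R.
Implicit Types (f : I -> M).

Lemma fgliftD f u v : fglift f (u + v) = fglift f u + fglift f v.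
Proof.
have := lift_is_additive f u (- v); rewrite opprK => ->.
have := lift_is_additive f 0 v; have := lift_is_additive f 0 0.
by rewrite subrr sub0r => -> ->; rewrite subrr sub0r opprK.
Qed.

Lemma fglift0 f : fglift f 0 = 0.
Proof. by have := lift_is_additive f 0 0; rewrite !subrr. Qed.

Lemma fgliftU f s : fglift f << s >> = f s.
Proof. by rewrite liftU scale1r. Qed.

Lemma fgliftZ f c v : fglift f (c *: v) = c *: fglift f v.
Proof.
elim/freeg_ind_lin: v => [|u v IHu IHv|d s].
- by rewrite scaler0 fglift0 scaler0.
- by rewrite scalerDr !fgliftD IHu IHv scalerDr.
- by rewrite scalerA -!freegUZ !liftU scalerA.
Qed.

End FreeModule.

Ltac by_coeff := apply/eqP/freeg_eqP => ?;
  rewrite ?(coeffD, coeffB, coeffN, coeffZ, coeff0); ring.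

Section Geometric.
Variables (R : realType) (I : choiceType) (m : I -> I -> nat).
Local Notation V := {freeg I / R}.
Local Notation G := (coxeter_group m).
Local Notation gen := (coxeter_gen m).

Definition simple_root (s : I) : V := << s >>.
Local Notation root := simple_root.

(* Twice the usual form, so that simple roots have norm 2. *)
Definition cform (u v : V) : R :=
  fglift (fun s => fglift (fun t => - kappa R (m s t) : R^o) v : R^o) u.

(* Locked, so that rewriting with linearity does not unfold nested reflections. *)
Fact refl_key : unit. Proof. exact: tt. Qed.
Definition refl (s : I) (v : V) : V :=
  locked_with refl_key (v - cform v (root s) *: root s).

Lemma reflE s v : refl s v = v - cform v (root s) *: root s.
Proof. by rewrite /refl unlock. Qed.

Lemma cformDl u v w : cform (u + v) w = cform u w + cform v w.
Proof. by rewrite /cform (@fgliftD R I R^o). Qed.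

Lemma cformZl c v w : cform (c *: v) w = c * cform v w.
Proof. by rewrite /cform (@fgliftZ R I R^o). Qed.

Lemma cform0l w : cform 0 w = 0.
Proof. by rewrite /cform (@fglift0 R I R^o). Qed.

Lemma cformDr u v w : cform w (u + v) = cform w u + cform w v.
Proof.
elim/freeg_ind_lin: w => [|w1 w2 IH1 IH2|c s].
- by rewrite !cform0l addr0.
- by rewrite !cformDl IH1 IH2; ring.
- rewrite !cformZl -mulrDr; congr (_ * _).
  by rewrite /cform !(@fgliftU R I R^o) (@fgliftD R I R^o).
Qed.

Lemma cformZr c v w : cform w (c *: v) = c * cform w v.
Proof.
elim/freeg_ind_lin: w => [|w1 w2 IH1 IH2|d s].
- by rewrite !cform0l mulr0.
- by rewrite !cformDl IH1 IH2; ring.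
- rewrite !cformZl mulrCA; congr (_ * _).
  by rewrite /cform !(@fgliftU R I R^o) (@fgliftZ R I R^o).
Qed.

Lemma cformNl v w : cform (- v) w = - cform v w.
Proof. by rewrite -scaleN1r cformZl mulN1r. Qed.

Lemma cformNr v w : cform w (- v) = - cform w v.
Proof. by rewrite -scaleN1r cformZr mulN1r. Qed.

Definition cformE := (cformDl, cformDr, cformZl, cformZr, cformNl, cformNr).

Lemma cform_root s t : cform (root s) (root t) = - kappa R (m s t).
Proof. by rewrite /cform /simple_root !fgliftU. Qed.

Lemma reflD s u v : refl s (u + v) = refl s u + refl s v.
Proof. by rewrite !reflE cformDl; by_coeff. Qed.

Lemma reflZ s c v : refl s (c *: v) = c *: refl s v.
Proof. by rewrite !reflE cformZl; by_coeff. Qed.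

Lemma refl_perp s v : cform v (root s) = 0 -> refl s v = v.
Proof. by rewrite reflE => ->; rewrite scale0r subr0. Qed.

Definition nonneg (v : V) := forall i, 0 <= coeff i v.

Lemma nonneg_root s : nonneg (root s).
Proof. by move=> i; rewrite coeffU mul1r ler0n. Qed.

Lemma nonnegD u v : nonneg u -> nonneg v -> nonneg (u + v).
Proof. by move=> u0 v0 i; rewrite coeffD addr_ge0. Qed.

Lemma nonnegZ c v : 0 <= c -> nonneg v -> nonneg (c *: v).
Proof. by move=> c0 v0 i; rewrite coeffZ mulr_ge0. Qed.

Hypothesis hm : coxeter_matrix m.
Let m_diag s : m s s = 1%N. Proof. by apply/(proj2 hm). Qed.
Let m_sym s t : m s t = m t s. Proof. by apply/(proj1 hm). Qed.
Let m_neq s t : s != t -> m s t <> 1%N.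
Proof. by move=> st /(proj2 hm)/eqP; rewrite (negPf st). Qed.

Lemma cformC u v : cform u v = cform v u.
Proof.
elim/freeg_ind_lin: u => [|u1 u2 IH1 IH2|c s].
- by rewrite -(scale0r 0) !cformE !mul0r.
- by rewrite !cformE IH1 IH2.
- rewrite !cformE; congr (_ * _).
  elim/freeg_ind_lin: v => [|v1 v2 IH1 IH2|d t].
  + by rewrite -(scale0r 0) !cformE !mul0r.
  + by rewrite !cformE IH1 IH2.
  + by rewrite !cformE !cform_root m_sym.
Qed.

Lemma cform_root_diag s : cform (root s) (root s) = 2.
Proof. by rewrite cform_root m_diag kappa1; ring. Qed.

Lemma refl_root s : refl s (root s) = - root s.
Proof. by rewrite !reflE cform_root_diag; by_coeff. Qed.

Lemma reflK s v : refl s (refl s v) = v.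
Proof.
rewrite !reflE cformDl cformNl cformZl cform_root_diag; by_coeff.
Qed.

Lemma cform_refl s u v : cform (refl s u) (refl s v) = cform u v.
Proof.
by rewrite !reflE !cformE cform_root_diag (cformC (root s) v); ring.
Qed.

(** The last letter, which acts first, is t whatever the parity of k. *)
Fixpoint alt_word (s t : I) (k : nat) : seq I :=
  if k is k1.+1 then (if odd k1 then s else t) :: alt_word s t k1 else [::].

Local Notation rho := (foldr refl).

(** In the plane of the two roots, each further reflection is one step of the Chebyshev
    recurrence. *)
Lemma alt_word_root s t k : s != t ->
  rho (root s) (alt_word s t k) =
    chebU (kappa R (m s t)) (if odd k then k else k.+1) *: root s
    + chebU (kappa R (m s t)) (if odd k then k.+1 else k) *: root t.
Proof.
move=> st; elim: k => [|k IHk]; first by rewrite /= /chebU scale1r scale0r addr0.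
rewrite [alt_word _ _ _]/= [rho _ _]/= {}IHk [odd k.+1]/=.
case: (odd k); rewrite !reflE !cformE cform_root_diag !cform_root ?(m_sym t s);
  rewrite chebUSS; by_coeff.
Qed.

Lemma rho_alt_word s t n v :
  iter n (fun y => refl s (refl t y)) v = rho v (alt_word s t (n + n)).
Proof.
by elim: n => //= n ->; rewrite addnS /= addnn odd_double.
Qed.

Lemma iter_refl2_linear s t n c u v :
  iter n (fun y => refl s (refl t y)) (c *: u + v) =
  c *: iter n (fun y => refl s (refl t y)) u
  + iter n (fun y => refl s (refl t y)) v.
Proof. by elim: n => //= n ->; rewrite !(reflD, reflZ). Qed.

(** The power of the product fixes both roots by the values of [chebU] at 2m and 2m + 1, and it
    fixes every vector orthogonal to them. For a finite label these span V, the form being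
    nondegenerate on the plane. *)
Lemma refl_rel s t : m s t <> 0%N ->
  forall v, iter (m s t) (fun y => refl s (refl t y)) v = v.
Proof.
move=> mst0 v; have [<-|st] := eqVneq s t; first by rewrite m_diag /= reflK.
have m1 := m_neq st; have m2 : (1 < m s t)%N by lia.
have fix_s a b : a != b -> m a b = m s t ->
    iter (m s t) (fun y => refl a (refl b y)) (root a) = root a.
  move=> ab mab; rewrite rho_alt_word alt_word_root // mab addnn odd_double /=.
  by rewrite -addnn chebU_kappa_2n // chebU_kappa_S2n // scale1r scale0r addr0.
have fix_t : iter (m s t) (fun y => refl s (refl t y)) (root t) = root t.
  rewrite -{1}(@fix_s t s _ (m_sym t s)); last by rewrite eq_sym.
  elim: (m s t) (root t) => // n IHn u.
  by rewrite iterSr /= reflK reflK IHn.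
set c := kappa R (m s t); set p := cform v (root s); set q := cform v (root t).
have c0 : 0 <= c by apply: kappa_ge0.
have c2 : c < 2 by apply: kappa_lt2; lia.
have d0 : 4 - c ^+ 2 != 0 by apply: lt0r_neq0; nra.
(* The solution of the 2 x 2 Gram system of the two roots, so that w is orthogonal to both. *)
pose x := (2 * p + c * q) / (4 - c ^+ 2); pose y := (c * p + 2 * q) / (4 - c ^+ 2).
pose w := v - x *: root s - y *: root t.
have vE : v = x *: root s + (y *: root t + w) by rewrite /w; by_coeff.
have ws : cform w (root s) = 0.
  rewrite /w !cformE cform_root_diag cform_root (m_sym t s) -/p -/c /x /y.
  by field.
have wt : cform w (root t) = 0.
  by rewrite /w !cformE cform_root_diag cform_root -/q -/c /x /y; field.
rewrite {1}vE !iter_refl2_linear fix_s // fix_t [RHS]vE; congr (_ + (_ + _)).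
by elim: (m s t) => //= n ->; rewrite !refl_perp.
Qed.

Definition act (x : G) (v : V) : V := coxeter_act refl x v.

Lemma act1 v : act 1%g v = v.
Proof. exact: (coxeter_act1 hm refl_rel). Qed.

Lemma actM x y v : act (x * y)%g v = act x (act y v).
Proof. exact: (coxeter_actM hm refl_rel). Qed.

Lemma act_gen s v : act (gen s) v = refl s v.
Proof. exact: (coxeter_act_gen hm refl_rel). Qed.

Lemma actK x v : act x^-1%g (act x v) = v.
Proof. by rewrite -actM mulVg act1. Qed.

Lemma actVK x v : act x (act x^-1%g v) = v.
Proof. by rewrite -actM mulgV act1. Qed.

Lemma actD x u v : act x (u + v) = act x u + act x v.
Proof.
elim/(coxeter_ind hm): x => [|s x IHx]; first by rewrite !act1.
by rewrite !actM IHx !act_gen reflD.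
Qed.

Lemma actZ x c v : act x (c *: v) = c *: act x v.
Proof.
elim/(coxeter_ind hm): x => [|s x IHx]; first by rewrite !act1.
by rewrite !actM IHx !act_gen reflZ.
Qed.

Lemma actN x v : act x (- v) = - act x v.
Proof. by rewrite -scaleN1r actZ scaleN1r. Qed.

Definition actE := (actD, actN, actZ).

Lemma act_form x u v : cform (act x u) (act x v) = cform u v.
Proof.
elim/(coxeter_ind hm): x => [|s x IHx]; first by rewrite !act1.
by rewrite !actM !act_gen cform_refl IHx.
Qed.

Lemma act_formV x u v : cform (act x u) v = cform u (act x^-1%g v).
Proof. by rewrite -[v in LHS](actVK x) act_form. Qed.

Lemma act_prod u v : act (gen_prod m u) v = rho v u.
Proof. by elim: u => [|s u IHu] /=; rewrite ?act1 // actM act_gen IHu. Qed.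

End Geometric.

(** * Signs of roots and faithfulness *)

Section AltWords.
Variables (I : choiceType) (m : I -> I -> nat).
Local Notation G := (coxeter_group m).
Local Notation gen := (coxeter_gen m).

Lemma alt_word_rcons (s t : I) k :
  alt_word s t k.+1 = rcons (alt_word t s k) t.
Proof.
elim: k => // k IHk; rewrite [LHS]/= -[_ :: alt_word s t k]/(alt_word s t k.+1).
by rewrite IHk /=; case: (odd k).
Qed.

Lemma alt_word_split (s t : I) j k :
  exists2 w, size w = j & alt_word s t (j + k) = w ++ alt_word s t k.
Proof.
elim: j => [|j [w sw wE]]; first by exists [::].
by rewrite addSn /= wE -cat_cons; eexists; last by []; rewrite /= sw.
Qed.

Lemma alt_prod (s t : I) k : gen_prod m (alt_word s t k) =
  ((if odd k then gen t else 1) * (gen s * gen t) ^+ k./2)%g.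
Proof.
elim: k => [|k IHk]; first by rewrite /= mul1g expg0.
rewrite /= IHk uphalf_half; case: (odd k) => /=; last by rewrite add0n mul1g.
by rewrite mul1g add1n expgS mulgA.
Qed.

Hypothesis hm : coxeter_matrix m.

Lemma alt_braid s t :
  m s t <> 0%N -> gen_prod m (alt_word s t (m s t)) = gen_prod m (alt_word t s (m s t)).
Proof.
move=> st0; rewrite !alt_prod; have := coxeter_gen_rel st0.
have invst : ((gen s * gen t)^-1 = gen t * gen s)%g.
  by rewrite invgM !coxeter_genV.
set n := m s t; rewrite -invst expVgn -{1}(odd_double_half n) -addnn.
case: (odd n); rewrite ?add1n ?add0n ?expgS ?expgnDr ?mul1g.
  move=> E; apply: (mulgI (gen s)).
  rewrite coxeter_genK // mulgA; apply/esym/mulg1_eq.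
  set p := ((gen s * gen t) ^+ n./2)%g in E *.
  have pc : commute p (gen s * gen t)%g by exact/commute_sym/commuteX.
  by rewrite [LHS]mulgA pc -[LHS]mulgA.
by move=> /mulg1_eq.
Qed.

End AltWords.

Section Tits.
Variables (R : realType) (I : choiceType) (m : I -> I -> nat).
Local Notation V := {freeg I / R}.
Local Notation G := (coxeter_group m).
Local Notation gen := (coxeter_gen m).
Hypothesis hm : coxeter_matrix m.
Local Notation len := (len hm).
Local Notation root := (simple_root R).
Local Notation act := (@act R I m).

(* Let [t] be a descent of [x] and split off a longest alternating word in    *)
(* [s] and [t] at the end of a reduced word of [x]; the induction hypothesis   *)
(* applies to the rest, and the alternating word is short enough for the       *)
(* Chebyshev coefficients of its action on [root s] to be nonnegative.         *)
Lemma act_root_ge0 x s : len (x * gen s)%g = (len x).+1 -> nonneg (act x (root s)).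
Proof.
have [n] := ubnP (len x); elim: n => // n IHn in x s * => xn xs.
have [->|/eqP x1] := eqVneq x 1%g; first by rewrite act1 //; apply: nonneg_root.
have [t xt] := len_descent hm x1.
have st : s != t by apply/eqP => st; move: xt; rewrite -st xs; lia.
pose Q k := `[< exists v, x = (v * gen_prod m (alt_word s t k))%g /\ len x = (len v + k)%N >].
have Q1 : exists k, Q k.
  exists 1%N; apply/asboolP; exists (x * gen t)%g.
  by rewrite /= mulg1 coxeter_mulgenK // addn1.
have Qle k : Q k -> (k <= len x)%N by move=> /asboolP[v [_ ->]]; rewrite leq_addl.
case: (ex_maxnP Q1 Qle) => k /asboolP[v [xE lx]] kmax.
have k0 : (0 < k)%N.
  apply: kmax; apply/asboolP; exists (x * gen t)%g.
  by rewrite /= mulg1 coxeter_mulgenK // addn1.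
have lv : (len v < len x)%N by rewrite lx -addn1 leq_add2l.
(* Otherwise one more letter could be moved from v to the alternating word, against the maximality
   of k. *)
have asc_next : len (v * gen (if odd k then s else t))%g = (len v).+1.
  case: (len_mulgen hm v (if odd k then s else t)) => // E.
  suff : (k.+1 <= k)%N by rewrite ltnn.
  apply: kmax; apply/asboolP; exists (v * gen (if odd k then s else t))%g.
  split; last by rewrite lx E addnS.
  by rewrite /= mulgA coxeter_mulgenK.
(* Otherwise this letter cancels the first letter of the alternating word, and x is shorter than its
   length. *)
have asc_first : len (v * gen (if odd k.-1 then s else t))%g = (len v).+1.
  case: (len_mulgen hm v (if odd k.-1 then s else t)) => // E.
  have : x = (v * gen (if odd k.-1 then s else t) * gen_prod m (alt_word s t k.-1))%g.
    by rewrite xE -{1}(prednK k0) /= mulgA.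
  move=> /(congr1 len) xE'; have := lenM hm (v * gen (if odd k.-1 then s else t))%g
    (gen_prod m (alt_word s t k.-1)).
  have := len_prod hm (alt_word s t k.-1); rewrite -xE' lx E.
  have -> : size (alt_word s t k.-1) = k.-1 by elim: (k.-1) => //= j ->.
  by move: (len _) (len _) => a b; lia.
have vn : (len v < n)%N by apply: leq_trans lv _; rewrite -ltnS.
have [vs vt] : nonneg (act v (root s)) /\ nonneg (act v (root t)).
  have := IHn _ _ vn asc_next; have := IHn _ _ vn asc_first.
  by rewrite -{2}(prednK k0) /=; case: (odd k.-1).
(* If k reached the label, the braid relation would turn the end of the word into an alternating
   word ending in s, and x s would be too short. *)
have km : (k < m s t)%N \/ m s t = 0%N.
  have [->|m0] := eqVneq (m s t) 0%N; [by right|left].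
  rewrite ltnNge; apply/negP => mk.
  have [w sw wE] := alt_word_split s t (k - m s t) (m s t).
  have m0' : m s t = (m s t).-1.+1 by rewrite prednK // lt0n.
  have : (x * gen s = v * gen_prod m (w ++ alt_word s t (m s t).-1))%g.
    rewrite xE -(subnK mk) wE !gen_prod_cat -!mulgA (alt_braid hm) ?(eqP m0) //.
      by rewrite {1}m0' alt_word_rcons gen_prod_rcons coxeter_mulgenK // mulgA.
    exact/eqP.
  move=> /(congr1 len); rewrite xs lx => E.
  have := lenM hm v (gen_prod m (w ++ alt_word s t (m s t).-1)).
  have := len_prod hm (w ++ alt_word s t (m s t).-1); rewrite -E size_cat sw.
  have -> : size (alt_word s t (m s t).-1) = (m s t).-1.
    by elim: ((m s t).-1) => //= j ->.
  by move: (len _) (len _) mk m0' => a b; lia.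
have m1 : m s t <> 1%N by move=> /(proj2 hm)/eqP; rewrite (negPf st).
rewrite xE actM // act_prod // alt_word_root // actD // !actZ //.
apply: nonnegD; apply: nonnegZ => //; apply: chebU_kappa_ge0 => //.
  by case: km => [km|->]; [left; case: odd; lia | right].
by case: km => [km|->]; [left; case: odd; lia | right].
Qed.

Lemma act_root_le0 x s :
  len x = (len (x * gen s)%g).+1 -> nonneg (- act x (root s)).
Proof.
move=> xs; have : len (x * gen s * gen s)%g = (len (x * gen s)%g).+1.
  by rewrite coxeter_mulgenK.
by move=> /act_root_ge0; rewrite actM // act_gen // refl_root // actN.
Qed.

Lemma act_faithful x : (forall s, act x (root s) = root s) -> x = 1%g.
Proof.
move=> xs; apply: contrapT => /(len_descent hm)[s /act_root_le0/(_ s)].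
by rewrite xs coeffN coeffU eqxx mulr1; lra.
Qed.

Lemma act_inj x y : (forall s, act x (root s) = act y (root s)) -> x = y.
Proof.
move=> xy; apply: (mulgI x^-1%g); rewrite mulVg; apply/esym/act_faithful => s.
by rewrite actM // -xy actK.
Qed.

(** Induction on length: removing a descent s of x changes x u by a nonnegative multiple of x (root
    s), which is a negative root. *)
Lemma act_dominant u : (forall s, 0 <= cform m u (root s)) ->
  forall x, nonneg (u - act x u).
Proof.
move=> dom x; have [n] := ubnP (len x); elim: n => // n IHn in x *.
have [->|/eqP x1 xn] := eqVneq x 1%g.
  by move=> _ i; rewrite act1 // subrr coeff0.
have [s xs] := len_descent hm x1.
have -> : u - act x u = u - act (x * gen s)%g u +
    cform m u (root s) *: (- act x (root s)).
  rewrite actM // act_gen // reflE actD // actN // actZ //; by_coeff.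
apply: nonnegD; first by apply: IHn; rewrite xs in xn.
by apply: nonnegZ => //; apply: act_root_le0.
Qed.

End Tits.

(** * Direct factors are scalar *)

Lemma subgroup1 (G : groupType) (A : set G) : subgroup A -> A 1%g.
Proof. by case; rewrite inE. Qed.

Lemma subgroupV (G : groupType) (A : set G) x : subgroup A -> A x -> A x^-1%g.
Proof. by move=> /group_closedV AV Ax; have := AV x; rewrite !inE; apply. Qed.

Lemma subgroupM (G : groupType) (A : set G) x y :
  subgroup A -> A x -> A y -> A (x * y)%g.
Proof.
by move=> /group_closedM AM Ax Ay; have := AM x y; rewrite !inE; apply.
Qed.

Lemma subgroupI (G : groupType) (A : set G) : A 1%g ->
  (forall x y, A x -> A y -> A (x * y^-1)%g) -> subgroup A.
Proof.
move=> A1 AF; split; first by rewrite inE.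
by move=> x y; rewrite !inE; apply: AF.
Qed.

Lemma direct_productC (G : groupType) (A B : set G) :
  direct_product A B -> direct_product B A.
Proof.
case=> sA sB AB I0 gen; split=> //.
- by move=> b a Bb Aa; apply/commute_sym/AB.
- by rewrite setIC.
- by move=> x; have [a [b [Aa Bb ->]]] := gen x; exists b, a; split=> //; apply: AB.
Qed.

Section Irreducible.
Variables (R : realType) (I : choiceType) (m : I -> I -> nat).
Local Notation V := {freeg I / R}.
Local Notation G := (coxeter_group m).
Local Notation gen := (coxeter_gen m).
Local Notation cform := (cform m).
Local Notation root := (simple_root R).
Local Notation act := (@act R I m).
Hypothesis hm : coxeter_matrix m.
Hypothesis hirr : irreducible_coxeter m.

Lemma irreducible_ind (P : I -> Prop) s : P s ->
  (forall s t, coxeter_edge m s t -> P s -> P t) -> forall t, P t.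
Proof.
move=> Ps Pedge t; have [p sp ->] := hirr s t.
elim: p s Ps sp => //= u p IHp s Ps /andP[su up].
by apply: IHp up; apply: Pedge su Ps.
Qed.

Lemma edge_kappa_pos s t : coxeter_edge m s t -> 0 < kappa R (m s t).
Proof.
move=> /orP[/eqP->|st]; first by rewrite /kappa.
by apply: kappa_pos; lia.
Qed.

(** For an edge between s and t, w s_t (root s) - w (root s) is a nonzero multiple of w (root t), so
    the span of the orbit spreads along the connected graph. *)
Lemma orbit_span (Q : V -> Prop) s :
  (forall u v, Q u -> Q v -> Q (u + v)) -> (forall c v, Q v -> Q (c *: v)) ->
  (forall w, Q (act w (root s))) -> forall v, Q v.
Proof.
move=> QD QZ Qs.
have Qt : forall t w, Q (act w (root t)).
  apply: (irreducible_ind Qs) => {}s t st {}Qs w.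
  have k0 := edge_kappa_pos st.
  have -> : act w (root t) = (kappa R (m s t))^-1 *:
      (act (w * gen t)%g (root s) + (-1) *: act w (root s)).
    rewrite actM // act_gen // reflE cform_root actD // actN // actZ //.
    by apply/eqP/freeg_eqP => i; rewrite !(coeffZ, coeffD, coeffN); field; lra.
  by apply/QZ/QD => //; apply: QZ.
apply: freeg_ind_lin => //.
- by rewrite -(scale0r (root s)); apply: QZ; rewrite -(act1 hm (root s)).
- by move=> c t; apply: QZ; rewrite -(act1 hm (<<t>>)); apply: Qt.
Qed.

Lemma radical_fixed y : (forall v, cform y v = 0) -> forall x, act x y = y.
Proof.
move=> y0; apply: (coxeter_ind hm) => [|s x IHx]; first by rewrite act1.
by rewrite actM // IHx act_gen // refl_perp.
Qed.

Section TwoFactors.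
Variables (s : I).
Local Notation al := (root s).

(** As [al] has norm 2, this is the component of [act x al] along [al], and [root_perp] is the
    orthogonal one; its vanishing says that x preserves the line of [al]. *)
Definition root_coef (x : G) : R := cform (act x al) al / 2.
Definition root_perp (x : G) : V :=
  locked_with refl_key (act x al - root_coef x *: al).
Local Notation c := root_coef.
Local Notation perp := root_perp.

Lemma root_perpE x : perp x = act x al - c x *: al.
Proof. by rewrite /perp unlock. Qed.

Let al2 : cform al al = 2. Proof. exact: cform_root_diag. Qed.

Lemma coef_inv x : c x^-1%g = c x.
Proof. by rewrite /c act_formV // invgK (cformC hm). Qed.

Lemma perp_root x : cform (perp x) al = 0.
Proof. by rewrite root_perpE !cformE al2 /c; field. Qed.

Lemma perp_eq0 x k : act x al = k *: al -> perp x = 0.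
Proof. by move=> E; rewrite root_perpE /c E cformE al2 mulfK ?subrr // pnatr_eq0. Qed.

Lemma coef_norm x : perp x = 0 -> c x ^+ 2 = 1.
Proof.
rewrite root_perpE => /eqP; rewrite subr_eq0 => /eqP E.
have : cform (act x al) (act x al) = 2 by rewrite act_form.
by rewrite {1 2}E !cformE al2; nra.
Qed.

Definition splits (A B : set G) (a b : G) (la mu : R) :=
  [/\ direct_product A B, A a, B b, gen s = (a * b)%g
    & [/\ act a al = la *: al, act b al = mu *: al & la * mu = -1]].

Lemma splitsC A B a b la mu : splits A B a b la mu -> splits B A b a mu la.
Proof.
case=> AB Aa Bb sE [aE bE lm]; split=> //; first exact: direct_productC.
  by rewrite sE; case: AB => _ _ ABc _ _; apply: ABc.
by split; rewrite // mulrC.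
Qed.

Lemma splits_sq A B a b la mu : splits A B a b la mu -> la ^+ 2 = 1 /\ mu = - la.
Proof.
case=> _ _ _ _ [aE _ lm].
have : cform (act a al) (act a al) = 2 by rewrite act_form.
rewrite aE !cformE al2 => E; have l2 : la ^+ 2 = 1 by nra.
by split=> //; rewrite -[mu]mul1r -l2 expr2 -mulrA lm; ring.
Qed.

Section Half.
Variables (A B : set G) (a b : G) (la mu : R).
Hypothesis hs : splits A B a b la mu.
Let AB : direct_product A B. Proof. by case: hs. Qed.
Let Aa : A a. Proof. by case: hs. Qed.
Let Bb : B b. Proof. by case: hs. Qed.
Let sE : gen s = (a * b)%g. Proof. by case: hs. Qed.
Let aE : act a al = la *: al. Proof. by case: hs => _ _ _ _ []. Qed.
Let bE : act b al = mu *: al. Proof. by case: hs => _ _ _ _ []. Qed.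
Let la2 : la ^+ 2 = 1. Proof. by case: (splits_sq hs). Qed.
Let muE : mu = - la. Proof. by case: (splits_sq hs). Qed.

Let ab_comm g h v : A g -> B h -> act g (act h v) = act h (act g v).
Proof. by move=> Ag Bh; case: AB => _ _ C _ _; rewrite -!actM // C. Qed.

Let s_act v : act a (act b v) = v - cform v al *: al.
Proof. by rewrite -actM // -sE act_gen // reflE. Qed.

Lemma act_a_orbitB h : B h -> act a (act h al) = la *: act h al.
Proof. by move=> Bh; rewrite ab_comm // aE actZ. Qed.

Lemma act_b_orbitA g : A g -> act b (act g al) = mu *: act g al.
Proof. by move=> Ag; rewrite -ab_comm // bE actZ. Qed.

(** On the orbit of [al] under A, b is the scalar [mu], so a is known there from s = a b. *)
Lemma act_a_orbitA g : A g -> act a (act g al) = mu *: (act g al - (2 * c g) *: al).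
Proof.
move=> Ag; have := s_act (act g al); rewrite act_b_orbitA // actZ //.
move=> /(congr1 (fun v => mu *: v)); rewrite scalerA muE.
have -> : - la * - la = 1 by rewrite -la2; ring.
by rewrite scale1r => ->; congr (_ *: (_ - _ *: _)); rewrite /c; field.
Qed.

End Half.

Lemma act_b_orbitB A B a b la mu h : splits A B a b la mu ->
  B h -> act b (act h al) = la *: (act h al - (2 * c h) *: al).
Proof. by move=> /splitsC hs Bh; apply: (act_a_orbitA hs). Qed.

(** For v = g h al, both a v and b v are known by commuting past the opposite factor. Then a (b v) =
    s v = v - (v, al) al is a linear equation which expresses v through h al, g al and al. *)
Lemma act_perp A B a b la mu g h : splits A B a b la mu -> A g -> B h ->
  exists k, act g (perp h) = c g *: perp h + k *: al.
Proof.
move=> hs Ag Bh; have [l2 muE] := splits_sq hs.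
have [AB Aa Bb sE [aE bE lm]] := hs.
have ab_comm v : act g (act h v) = act h (act g v).
  by case: AB => _ _ C _ _; rewrite -!actM // C.
have ah_comm v : act a (act h v) = act h (act a v).
  by case: AB => _ _ C _ _; rewrite -!actM // C.
have bg_comm v : act b (act g v) = act g (act b v).
  by case: AB => _ _ C _ _; rewrite -!actM // -C.
set v := act g (act h al).
have av : act a v = mu *: (v - (2 * c g) *: act h al).
  rewrite /v ab_comm ah_comm (act_a_orbitA hs Ag) actZ // actD // actN // actZ //.
have bv : act b v = la *: (v - (2 * c h) *: act g al).
  by rewrite /v bg_comm (act_b_orbitB hs Bh) actZ // actD // actN // actZ.
have sv : act a (act b v) = v - cform v al *: al.
  by rewrite -actM // -sE act_gen // reflE.
rewrite bv actZ // actD // actN // actZ // av (act_a_orbitA hs Ag) in sv.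
pose k := (cform v al / 2) - 2 * c g * c h.
have vE : v = c g *: act h al + c h *: act g al + k *: al.
  move: sv; rewrite muE => /eqP/freeg_eqP sv; apply/eqP/freeg_eqP => i.
  have := sv i; rewrite /k !(coeffD, coeffN, coeffZ).
  move: (coeff i v) (coeff i (act h al)) (coeff i (act g al)) (coeff i al) =>
    x1 x2 x3 x4.
  move: (c g) (c h) (cform v al) => d e f E.
  have : la ^+ 2 * (x1 - (2 * d * x2) - 2 * e * (x3 - 2 * d * x4)) =
     - (x1 - f * x4) by rewrite -E; ring.
  by rewrite l2 mul1r; lra.
exists (k + c g * c h).
rewrite root_perpE actD // actN // actZ // -/v vE; by_coeff.
Qed.

Lemma act_a_perp A B a b la mu h : splits A B a b la mu -> B h ->
  act a (perp h) = la *: perp h.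
Proof.
move=> hs Bh; rewrite root_perpE actD // actN // actZ // (act_a_orbitB hs) //.
by have [_ _ _ _ [-> _ _]] := hs; by_coeff.
Qed.

Lemma act_b_perp A B a b la mu h : splits A B a b la mu -> B h ->
  act b (perp h) = la *: perp h.
Proof.
move=> hs Bh; have [l2 muE] := splits_sq hs.
rewrite root_perpE actD // actN // actZ // (act_b_orbitB hs) //.
have [_ _ _ _ [_ -> _]] := hs; rewrite muE; by_coeff.
Qed.

(** Applying g^-1 and then g to y = [perp h] puts (1 - c(g)^2) y in the span of al and g al. There b
    is [mu = - la], while b y = la y; so both sides vanish. The remaining relation between al and g
    al is trivial because g moves the line of al. *)
Lemma perp_coef_sq A B a b la mu g h : splits A B a b la mu -> A g -> B h ->
  perp g <> 0 -> perp h <> 0 -> c g ^+ 2 = 1 /\ cform (perp h) (act g al) = 0.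
Proof.
move=> hs Ag Bh x0 y0; have [l2 muE] := splits_sq hs.
have Agi : A g^-1%g by apply: subgroupV => //; case: hs => -[].
have [k1 gy] := act_perp hs Ag Bh; have [k2 giy] := act_perp hs Agi Bh.
set y := perp h in y0 gy giy *.
have yal : cform y al = 0 by apply: perp_root.
have k2E : cform y (act g al) = 2 * k2.
  rewrite (cformC hm) act_formV // (cformC hm) giy !cformE al2 yal; ring.
rewrite coef_inv in giy.
have yE : (1 - c g ^+ 2) *: y = (c g * k1) *: al + k2 *: act g al.
  have := actVK hm g y; rewrite giy actD // !actZ // gy.
  move=> /eqP/freeg_eqP E; apply/eqP/freeg_eqP => i.
  have := E i; rewrite !(coeffD, coeffN, coeffZ) => Ei.
  by rewrite mulrBl mul1r -{1}Ei; ring.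
have cg : c g ^+ 2 = 1.
  have := congr1 (act b) yE; rewrite actZ // (act_b_perp hs Bh) -/y.
  have [_ _ _ _ [_ bE _]] := hs.
  rewrite actD // !actZ // bE (act_b_orbitA hs) // => E.
  have : ((1 - c g ^+ 2) * (2 * la)) *: y = 0.
    move: E yE => /eqP/freeg_eqP E /eqP/freeg_eqP yE; apply/eqP/freeg_eqP => i.
    move: (E i) (yE i); rewrite muE !(coeffD, coeffN, coeffZ, coeff0) => E1 E2.
    have -> : (1 - c g ^+ 2) * (2 * la) * coeff i y =
      (1 - c g ^+ 2) * (la * coeff i y) + la * ((1 - c g ^+ 2) * coeff i y) by ring.
    by rewrite E1 E2; ring.
  move/eqP; rewrite scaler_eq0 => /orP[|/eqP //].
  rewrite mulf_eq0 => /orP[|/eqP]; first by rewrite subr_eq0 => /eqP <-.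
  move=> l0; move: l2; have -> : la = 0 by lra.
  by rewrite expr0n => /eqP; rewrite eq_sym oner_eq0.
split=> //; rewrite k2E; have [->|k20] := eqVneq k2 0; first by rewrite mulr0.
case: x0; apply: (@perp_eq0 _ (- (c g * k1) / k2)).
move: yE; rewrite cg subrr scale0r => /eqP/freeg_eqP E; apply/eqP/freeg_eqP => i.
have := E i; rewrite !(coeffD, coeffZ, coeff0) => Ei.
apply: (mulfI k20); rewrite mulrA [k2 * (_ / _)]mulrC divfK // mulNr.
by apply/eqP; rewrite -addr_eq0 addrC -Ei.
Qed.

(* If both factors move the line of [al], then all [root_coef] are 1 or -1    *)
(* and [perp h] lies in the radical, which is fixed by the whole group.       *)
Lemma perp_radical A B a b la mu g h : splits A B a b la mu -> A g -> B h ->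
  perp g <> 0 -> perp h <> 0 -> la = 1.
Proof.
move=> hs Ag Bh x0 y0; have [l2 muE] := splits_sq hs.
have [[sA sB AB _ ABgen] Aa Bb _ [aE bE _]] := hs.
have coefB h' : B h' -> c h' ^+ 2 = 1.
  move=> Bh'; have [/coef_norm //|/eqP y'0] := eqVneq (perp h') 0.
  by have [] := perp_coef_sq (splitsC hs) Bh' Ag y'0 x0.
have orbA g' : A g' -> cform (perp h) (act g' al) = 0.
  move=> Ag'; have [/eqP|/eqP x'0] := eqVneq (perp g') 0.
    by rewrite root_perpE subr_eq0 => /eqP ->; rewrite cformE perp_root mulr0.
  by have [] := perp_coef_sq hs Ag' Bh x'0 y0.
(* The coefficients of h^-1 h' and h^-1 b h' also have square 1: (D + 2 d e)^2 = (D - 2 d e)^2 = 4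
   with d e = 1 or -1, whence D = 0. *)
have orbB h' : B h' -> cform (perp h) (act h' al) = 0.
  move=> Bh'; set D := cform (perp h) (perp h').
  have hE x : act x al = perp x + c x *: al by rewrite root_perpE subrK.
  have sq_h x : B x -> cform (act h al) (act x al) ^+ 2 = 4.
    move=> Bx; have := coefB (h^-1 * x)%g (subgroupM sB (subgroupV sB Bh) Bx).
    rewrite /c actM // act_formV // invgK (cformC hm) => E.
    have -> : cform (act h al) (act x al) ^+ 2 =
      4 * (cform (act h al) (act x al) / 2) ^+ 2 by field.
    by rewrite E mulr1.
  have bh' : act b (act h' al) = la *: perp h' - (la * c h') *: al.
    rewrite hE actD // actZ // (act_b_perp hs Bh') bE muE; by_coeff.
  have := sq_h _ Bh'; have := sq_h _ (subgroupM sB Bb Bh').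
  rewrite actM // bh' !hE !cformE al2 perp_root (cformC hm al) perp_root -/D.
  have := coefB _ Bh; have := coefB _ Bh'.
  move: (c h) (c h') (D) => d e D' e2 d2 E1 E2.
  have E3 : la ^+ 2 * (D' - 2 * d * e) ^+ 2 = 4 by rewrite -E1; ring.
  have E4 : (D' + 2 * d * e) ^+ 2 = 4 by rewrite -E2; ring.
  rewrite l2 in E3; have de : (d * e) ^+ 2 = 1 by rewrite exprMn e2 d2 mulr1.
  have E5 : 4 * (D' * (d * e)) = 0 by nra.
  move: E5 => /eqP; rewrite !mulf_eq0 pnatr_eq0 /= => /orP[/eqP|].
    by move=> ->; ring.
  by move=> /orP[] /eqP z0; move: de; rewrite z0 ?(mul0r, mulr0) expr0n => /eqP;
    rewrite eq_sym oner_eq0.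
have y_rad v : cform (perp h) v = 0.
  move: v; apply: (@orbit_span _ s) => [u v u0 v0|k v v0|w].
  - by rewrite cformE u0 v0 addr0.
  - by rewrite cformE v0 mulr0.
  - have [g' [h' [Ag' Bh' ->]]] := ABgen w.
    have [k gy] := act_perp hs Ag' Bh'.
    have -> : act (g' * h')%g al =
        c g' *: perp h' + k *: al + c h' *: act g' al.
      rewrite -gy actM // root_perpE actD // actN // actZ //; by_coeff.
    by rewrite (root_perpE h') !cformE (orbB h') // orbA // perp_root; ring.
have := act_a_perp hs Bh; rewrite radical_fixed // => /eqP.
rewrite -subr_eq0 -{1}[perp h]scale1r -scalerBl scaler_eq0 => /orP[|/eqP //].
by rewrite subr_eq0 => /eqP.
Qed.

(** If both factors moved the line, [perp_radical] and its mirror image would give [la = mu = 1],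
    against [la * mu = -1]. *)
Lemma splits_scalar A B a b la mu : splits A B a b la mu ->
  (forall g, A g -> perp g = 0) \/ (forall h, B h -> perp h = 0).
Proof.
move=> hs; have [|] := pselect (exists2 g, A g & perp g <> 0); last first.
  move=> nA; left=> g Ag; apply: contrapT => g0; apply: nA; by exists g.
case=> g Ag g0; right=> h Bh; apply: contrapT => h0.
have la1 := perp_radical hs Ag Bh g0 h0.
have mu1 := perp_radical (splitsC hs) Bh Ag h0 g0.
have [_ _ _ _ [_ _]] := hs; rewrite la1 mu1; lra.
Qed.

Lemma eigen_root v : refl m s v = - v -> v = (cform v al / 2) *: al.
Proof.
rewrite reflE => /eqP/freeg_eqP E; apply/eqP/freeg_eqP => i.
have := E i; rewrite !(coeffD, coeffN, coeffZ).
by move: (coeff i v) (coeff i _) (cform v al) => p q r; lra.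
Qed.

(** The components a and b of s commute with s, so they preserve its eigenspace for -1, the line of
    [al]. *)
Lemma splits_exists A B : direct_product A B ->
  exists a b la mu, splits A B a b la mu.
Proof.
move=> AB; have [sA sB ABc _ ABgen] := AB.
have [a [b [Aa Bb sE]]] := ABgen (gen s).
have comm_root x : (gen s * x = x * gen s)%g -> act x al = c x *: al.
  move=> C; apply: eigen_root => //.
  by rewrite -act_gen // -actM // C actM // act_gen // refl_root // actN.
have aC : (gen s * a = a * gen s)%g by rewrite sE -mulgA -(ABc _ _ Aa Bb).
have bC : (gen s * b = b * gen s)%g by rewrite sE {1}(ABc _ _ Aa Bb) -mulgA.
exists a, b, (c a), (c b); split=> //; split; try exact: comm_root.
have := act_gen hm s al; rewrite sE actM // (comm_root b) // actZ //.
rewrite (comm_root a) // refl_root // scalerA mulrC => /eqP/freeg_eqP/(_ s).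
by rewrite coeffN coeffZ coeffU eqxx !mulr1.
Qed.

(** On the orbit of [al], h commutes with the component in A, and the component in B only scales
    [al]; the orbit spans V. *)
Lemma perp0_scalar A B h : direct_product A B ->
  (forall h, B h -> perp h = 0) -> B h -> forall v, act h v = c h *: v.
Proof.
move=> [sA sB ABc _ ABgen] B0 Bh; apply: (@orbit_span _ s) => [u v|k v|w].
- by rewrite actD // scalerDr => -> ->.
- by rewrite actZ // => ->; rewrite !scalerA mulrC.
- have Bal x : B x -> act x al = c x *: al.
    by move=> /B0/eqP; rewrite root_perpE subr_eq0 => /eqP.
  have [g [k [Ag Bk ->]]] := ABgen w.
  have hg : (h * (g * k) = g * (h * k))%g by rewrite !mulgA (ABc _ _ Ag Bh).
  rewrite -actM // hg !actM // !(Bal k) // !actZ // (Bal h) // !actZ //.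
  by rewrite !scalerA mulrC.
Qed.

Lemma perp0_sign A B h : direct_product A B ->
  (forall h, B h -> perp h = 0) -> B h ->
  h = 1%g \/ forall v, act h v = - v.
Proof.
move=> AB B0 Bh; have hE := perp0_scalar AB B0 Bh.
have := coef_norm (B0 _ Bh) => /eqP; rewrite sqrf_eq1 => /orP[]/eqP cE.
  by left; apply: (@act_faithful R _ _ hm) => t; rewrite hE cE scale1r.
by right=> v; rewrite hE cE scaleN1r.
Qed.

End TwoFactors.
End Irreducible.

Lemma multiplicative1 (G H : groupType) (f : {multiplicative G -> H}) : f 1%g = 1%g.
Proof. by apply: (mulgI (f 1%g)); rewrite -gmulfM !mulg1. Qed.

Lemma multiplicativeV (G H : groupType) (f : {multiplicative G -> H}) x :
  f x^-1%g = (f x)^-1%g.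
Proof. by apply/esym/mulg1_eq; rewrite -gmulfM mulgV multiplicative1. Qed.

(** * The element -1, the center and characters *)

Section NegOne.
Variables (R : realType) (I : choiceType) (m : I -> I -> nat).
Local Notation V := {freeg I / R}.
Local Notation G := (coxeter_group m).
Local Notation gen := (coxeter_gen m).
Local Notation root := (simple_root R).
Local Notation act := (@act R I m).
Hypothesis hm : coxeter_matrix m.

Definition neg_one (z : G) := forall v, act z v = - v.

Lemma neg_one_root z : (forall s, act z (root s) = - root s) -> neg_one z.
Proof.
move=> zr; apply: freeg_ind_lin => [|u v uE vE|c s].
- by rewrite -(scale0r 0) actZ // !scale0r oppr0.
- by rewrite actD // uE vE opprD.
- by rewrite actZ // zr scalerN.
Qed.

Lemma neg_one_sq z : neg_one z -> (z * z = 1)%g.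
Proof.
by move=> zN; apply: (@act_faithful R _ _ hm) => s; rewrite actM // !zN opprK.
Qed.

Lemma neg_one_commute z x : neg_one z -> commute z x.
Proof.
move=> zN; apply: (@act_inj R _ _ hm) => s.
by rewrite !actM // !zN actN.
Qed.

Lemma neg_one_neq1 z (s : I) : neg_one z -> z <> 1%g.
Proof.
move=> /(_ (root s)) zN z1; move: zN; rewrite z1 act1 // => /eqP/freeg_eqP/(_ s).
by rewrite coeffN coeffU eqxx mulr1; lra.
Qed.

Hypothesis hirr : irreducible_coxeter m.

(** A central element commutes with s, so it scales the root of s, then its orbit by the same
    scalar, then all of V; invariance of the form leaves 1 and -1. *)
Lemma center_neg_one z (s : I) : neg_one z -> center G = [set 1%g; z]%classic.
Proof.
move=> zN; apply/seteqP; split=> [x xC|x [->|->] y] /=; last first.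
- exact: neg_one_commute.
- exact/commute_sym/commute1.
have C : (gen s * x = x * gen s)%g by rewrite xC.
have xs : act x (root s) = root_coef R s x *: root s.
  apply: eigen_root => //.
  by rewrite -act_gen // -actM // C actM // act_gen // refl_root // actN.
have xE v : act x v = root_coef R s x *: v.
  move: v; apply: (@orbit_span _ _ _ hm hirr _ s) => [u v|k v|w].
  - by rewrite actD // scalerDr => -> ->.
  - by rewrite actZ // => ->; rewrite !scalerA mulrC.
  - by rewrite -actM // (xC w) actM // xs actZ.
have : root_coef R s x ^+ 2 = 1.
  by apply: coef_norm => //; rewrite root_perpE xs subrr.
move=> /eqP; rewrite sqrf_eq1 => /orP[]/eqP cE; [left|right].
  by apply: (@act_faithful R _ _ hm) => t; rewrite xE cE scale1r.
by apply: (@act_inj R _ _ hm) => t; rewrite xE cE scaleN1r zN.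
Qed.

Lemma coxeter_inhabited (x : G) : x <> 1%g -> exists s : I, True.
Proof.
elim/(coxeter_ind hm): x => [//|s x _ _]; by exists s.
Qed.

Definition is_char (chi : G -> bool) := forall x y, chi (x * y)%g = chi x (+) chi y.

Lemma char1 chi : is_char chi -> chi 1%g = false.
Proof. by move=> chiM; have := chiM 1%g 1%g; rewrite mulg1; case: (chi 1%g). Qed.

Lemma charX chi x n : is_char chi -> chi (x ^+ n)%g = odd n && chi x.
Proof.
move=> chiM; elim: n => [|n IHn]; first by rewrite expg0 char1.
by rewrite expgS chiM IHn /=; case: (odd n) (chi x) => [] [].
Qed.

(** The projection onto the factor of order 2, read as the indicator of the complement of A. *)
Lemma factor_char (A B : set G) z : direct_product A B -> B = [set 1%g; z]%classic ->
  z <> 1%g -> (z * z = 1)%g -> exists chi, is_char chi /\ chi z.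
Proof.
move=> [sA sB ABc AB1 ABgen] BE z1 zz; exists (fun x => ~~ `[< A x >]).
have zN : ~ A z.
  move=> Az; apply: z1; have : (A `&` B)%classic z by split; rewrite ?BE //; right.
  by rewrite AB1.
split; last by apply/asboolPn.
have Azz a : A a -> ~ A (a * z)%g.
  move=> Aa Aaz; apply: zN; have := subgroupM sA (subgroupV sA Aa) Aaz.
  by rewrite mulKg.
have mem x : exists a (e : bool), [/\ A a, x = (a * z ^+ e)%g & (~~ `[< A x >]) = e].
  have [a [b [Aa Bb ->]]] := ABgen x; exists a; move: Bb; rewrite BE => -[->|->].
    exists false; split; rewrite ?expg0 ?mulg1 //.
    by apply/negbTE/negPn/asboolP.
  by exists true; split; rewrite ?expg1 //; apply/asboolPn/Azz.
move=> x y; have [a [e [Aa -> ->]]] := mem x; have [b [f [Ab -> ->]]] := mem y.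
have zb : commute (z ^+ e)%g b.
  apply: commute_sym; apply: commuteX; apply: ABc => //.
  by rewrite BE; right.
have -> : (a * z ^+ e * (b * z ^+ f) = (a * b) * z ^+ (e (+) f))%g.
  rewrite -mulgA (mulgA (z ^+ e)%g) zb -!mulgA; congr (_ * (_ * _))%g.
  by case: e f {zb} => [] []; rewrite /= ?expg0 ?expg1 ?mul1g ?mulg1.
have Aab := subgroupM sA Aa Ab.
case: (e (+) f); first by rewrite expg1; apply/asboolPn/Azz.
by rewrite expg0 mulg1; apply/negbTE/negPn/asboolP.
Qed.

Lemma direct_product_neg_one (A B : set G) : direct_product A B ->
  A <> [set 1%g]%classic -> B <> [set 1%g]%classic ->
  exists z, [/\ neg_one z, A = center G \/ B = center G,
    exists chi, is_char chi /\ chi z & exists x, x <> 1%g /\ x <> z].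
Proof.
move=> AB A1 B1.
have nontriv C : subgroup C -> C <> [set 1%g]%classic -> exists2 x : G, C x & x <> 1%g.
  move=> sC C1; apply: contrapT => nC; apply: C1; apply/seteqP; split=> x /=.
    by move=> Cx; apply: contrapT => x1; apply: nC; exists x.
  by move=> ->; apply: subgroup1.
have [sA sB _ _ _] := AB; have [x0 Ax0 x01] := nontriv A sA A1.
have [s _] := coxeter_inhabited x01.
(* By symmetry, let B be the factor that preserves the line of the root. *)
wlog B0 : A B AB A1 B1 sA sB {x0 Ax0 x01} / forall h, B h -> root_perp R s h = 0.
  move=> H; have [a [b [la [mu hs]]]] := splits_exists R hm s AB.
  have [A0|B0] := splits_scalar hm hirr hs; last exact: (H A B).
  have [z [zN zc chi x]] := H B A (direct_productC AB) B1 A1 sB sA A0.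
  by exists z; split=> //; rewrite or_comm.
have [z Bz z1] := nontriv B sB B1; have [x Ax x1] := nontriv A sA A1.
have sgn := perp0_sign hm hirr AB B0.
have zN : neg_one z by case: (sgn _ Bz).
have BE : B = [set 1%g; z]%classic.
  apply/seteqP; split=> y /= => [By|[->|->] //]; last exact: subgroup1.
  have [->|yN] := sgn _ By; [by left|right].
  by apply: (@act_inj R _ _ hm) => t; rewrite yN zN.
exists z; split=> //.
- by right; rewrite (center_neg_one s zN).
- by apply: factor_char AB BE z1 (neg_one_sq zN).
- exists x; split=> // xz; apply: x1; case: AB => _ _ _ AB1 _.
  by have : (A `&` B)%classic x; [split; rewrite // xz | rewrite AB1].
Qed.

End NegOne.

Lemma type_coxeter_matrix T : T <> I2 1 -> coxeter_matrix (@type_matrix T).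
Proof.
move=> T1; split=> i j.
  by rewrite /type_matrix eq_sym minnC maxnC.
rewrite /type_matrix; have [-> //|/eqP ij] := eqVneq i j; split=> // E.
move: E T1 => {ij}; case: T i j => /=.
- by move=> n i j; case: ifP.
- by move=> n i j; do 2?case: ifP.
- by move=> n i j; case: ifP.
- by move=> i j; case: ifP.
- by move=> i j; do 2?case: ifP.
- by move=> k i j -> .
Qed.

Lemma pair_subgroup_isomorphic (G : groupType) (z : G) : z <> 1%g ->
  (z * z = 1)%g -> subgroup_isomorphic [set 1%g; z]%classic (coxeter_group_of (A_ 1)).
Proof.
move=> z1 zz; have hA : coxeter_matrix (@type_matrix (A_ 1)) by exact: type_coxeter_matrix.
have [|phi phiE] := coxeter_hom hA (f := fun=> z).
  by move=> s t _; rewrite zz expg1n.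
pose g : coxeter_group_of (A_ 1) := coxeter_gen (@type_matrix (A_ 1)) ord0.
have gE s : coxeter_gen (@type_matrix (A_ 1)) s = g by rewrite (ord1 s).
have two x : x = 1%g \/ x = g.
  elim/(coxeter_ind hA): x => [|s x [->|->]]; first by left.
    by right; rewrite gE mulg1.
  by left; rewrite gE /g coxeter_gen_sq.
have phi1 : phi 1%g = 1%g by rewrite multiplicative1.
exists phi; split=> [x y|].
  by case: (two x) (two y) => -> [] -> //; rewrite phi1 phiE => // /esym /z1.
apply/seteqP; split=> y /=; first by case=> x _ <-; case: (two x) => ->;
  rewrite ?phi1 ?phiE; [left|right].
by case=> ->; [exists 1%g; rewrite ?phi1|exists g; rewrite ?phiE].
Qed.

(** * Diagrams of the groups containing -1 *)

Section Diagram.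
Variables (R : realType) (I : choiceType) (m : I -> I -> nat).
Local Notation V := {freeg I / R}.
Local Notation G := (coxeter_group m).
Local Notation gen := (coxeter_gen m).
Local Notation root := (simple_root R).
Local Notation act := (@act R I m).
Local Notation K := (fun s t => kappa R (m s t)).
Hypothesis hm : coxeter_matrix m.
Variable z : G.
Hypothesis zN : neg_one R z.
Let m_sym s t : m s t = m t s. Proof. by apply/(proj1 hm). Qed.

(** If s does not occur in a word for z, then z leaves the coefficient at s unchanged, whereas -1
    changes its sign on [root s]. *)
Lemma neg_one_finite : exists2 p : seq I, uniq p & forall s, s \in p.
Proof.
have [u zE] := gen_prod_surj hm z; exists (undup u); first exact: undup_uniq.
move=> s; rewrite mem_undup; apply: contraT => su.
have : coeff s (act z (root s)) = 1.
  rewrite zE act_prod // (_ : coeff s _ = coeff s (root s)).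
    by rewrite coeffU eqxx mulr1.
  elim: (u) su (root s) => //= t w IHw; rewrite in_cons negb_or => /andP[st sw] v.
  rewrite reflE coeffD coeffN coeffZ coeffU eq_sym (negPf st) !mulr0 subr0.
  exact: IHw.
by rewrite zN coeffN coeffU eqxx mulr1; lra.
Qed.

Lemma cform_sum (r : seq I) (w : I -> R) v :
  cform m (\sum_(t <- r) w t *: root t) v = \sum_(t <- r) w t * cform m (root t) v.
Proof.
elim: r => [|t r IHr]; last by rewrite !big_cons !cformE IHr.
by rewrite !big_nil -(scale0r 0) cformE mul0r.
Qed.

Lemma coeff_sum (r : seq I) (w : I -> R) i :
  coeff i (\sum_(t <- r) w t *: root t) = \sum_(t <- r) w t * (t == i)%:R.
Proof.
elim: r => [|t r IHr]; last by rewrite !big_cons coeffD coeffZ coeffU mul1r IHr.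
by rewrite !big_nil coeff0.
Qed.

(* Such a [w] would be the opposite of a dominant vector, and -1 maps the     *)
(* latter to a vector which is not below it.                                  *)
Lemma no_subaffine (Y : seq I) (w : I -> R) : uniq Y -> Y <> [::] ->
  (forall s, s \in Y -> 0 < w s) ->
  (forall s, s \in Y -> exists r, [/\ uniq r, s \notin r, {subset r <= Y}
     & 2 * w s <= \sum_(t <- r) w t * K s t]) -> False.
Proof.
move=> uY Y0 w0 wK; set v := \sum_(t <- Y) w t *: root t.
have dom s : 0 <= cform m (- v) (root s).
  rewrite cformNl cform_sum oppr_ge0.
  have ge0 (r : seq I) : {subset r <= Y} -> s \notin r ->
      0 <= \sum_(t <- r) w t * K s t.
    move=> rY sr; rewrite big_seq; apply: sumr_ge0 => t tr.
    apply: mulr_ge0; first by apply/ltW/w0/rY.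
    apply: kappa_ge0 => /(proj2 hm) st; move: sr; rewrite st tr //.
  have [sY|sY] := boolP (s \in Y); last first.
    rewrite -oppr_ge0 -sumrN; have := ge0 Y (fun _ => id) sY.
    congr (0 <= _); apply: eq_bigr => t _.
    by rewrite cform_root m_sym mulrN opprK.
  have [r [ur sr rY]] := wK s sY.
  rewrite (perm_big _ (perm_to_rem sY)) big_cons cform_root_diag //.
  have pr : perm_eq (rem s Y) (r ++ [seq t <- rem s Y | t \notin r]).
    apply: uniq_perm; first exact: rem_uniq.
      rewrite cat_uniq ur filter_uniq ?rem_uniq // andbT /=.
      by apply/hasPn => t; rewrite mem_filter => /andP[].
    move=> t; rewrite mem_cat mem_filter; case: (boolP (t \in r)) => //= tr.
    by rewrite mem_rem_uniq // inE rY // andbT; apply: contraNneq sr => <-.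
  move=> le; rewrite (perm_big _ pr) big_cat /=.
  have := ge0 [seq t <- rem s Y | t \notin r].
  rewrite mem_filter mem_rem_uniq // inE eqxx andbF /= => /(_ _ isT) => rest.
  have {rest} := rest (fun t => ltac:(by rewrite mem_filter => /andP[_ /mem_rem])).
  move: le.
  have E (q : seq I) : \sum_(t <- q) w t * cform m (root t) (root s)
       = - \sum_(t <- q) w t * K s t.
    by rewrite -sumrN; apply: eq_bigr => t _; rewrite cform_root m_sym mulrN.
  by rewrite !E; lra.
case: Y Y0 => // y Y _ in uY w0 wK v dom *.
have := act_dominant hm dom z y; rewrite zN opprK coeffD coeffN.
suff : 0 < coeff y v by lra.
rewrite coeff_sum big_cons eqxx mulr1 ltr_pwDl ?w0 ?mem_head //.
rewrite big_seq; apply: sumr_ge0 => t tY.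
by rewrite mulr_ge0 ?ler0n // ltW // w0 // in_cons tY orbT.
Qed.

Definition lab n s t := (n <= m s t)%N || (m s t == 0%N).
Local Notation edge := (coxeter_edge m).

Lemma labE n s t : lab n s t = (n <= m s t)%N || (m s t == 0%N).
Proof. by []. Qed.

Lemma edgeE s t : edge s t = lab 3 s t.
Proof. by rewrite /lab /coxeter_edge /= orbC. Qed.

Lemma labC n s t : lab n s t = lab n t s.
Proof. by rewrite /lab m_sym. Qed.

Lemma lab_kappa n s t : (0 < n)%N -> lab n s t -> kappa R n <= K s t.
Proof. by move=> n0 /orP[nm|/eqP st0]; apply: kappa_le => //; [left|right]. Qed.

Lemma edge_kappa s t : edge s t -> 1 <= K s t.
Proof. by rewrite edgeE -(kappa3 R) => /lab_kappa; apply. Qed.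

Lemma edgeC s t : edge s t = edge t s.
Proof. by rewrite !edgeE labC. Qed.

Lemma edge_neq s t : edge s t -> s != t.
Proof.
by apply: contraTneq => ->; rewrite /coxeter_edge /= (proj2 ((proj2 hm) t t) erefl).
Qed.

Lemma non_edge s t : s != t -> ~~ edge s t -> m s t = 2.
Proof.
rewrite /coxeter_edge /= => /eqP st; have : m s t <> 1%N by move=> /(proj2 hm).
by move=> m1 /norP[/eqP m0]; rewrite -ltnNge => m3; lia.
Qed.

Lemma edge_label3 s t : edge s t -> ~~ lab 4 s t -> m s t = 3.
Proof. by rewrite edgeE /lab => /orP[]; lia. Qed.

(* The vertices [l] outside a path ending at [e] are those of an end of an    *)
(* affine diagram of type B, C or D: a fork with null vector coefficients 1,  *)
(* or an edge of label 4 with coefficient sqrt 2, the path having coefficient *)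
(* 2 everywhere.                                                              *)
Definition feature (e : I) (l : seq I) (c : R) :=
  [/\ 0 < c, forall t, t \in l -> c <= K t e & 2 <= \sum_(t <- l) c * K e t].

Lemma feature2 e a b : edge e a -> edge e b -> feature e [:: a; b] 1.
Proof.
move=> ea eb; split=> // [t|].
  by rewrite !inE => /orP[]/eqP->; rewrite m_sym; apply: edge_kappa.
by rewrite !big_cons big_nil; have := edge_kappa ea; have := edge_kappa eb; lra.
Qed.

Lemma feature4 e a : lab 4 e a -> feature e [:: a] (kappa R 4).
Proof.
move=> ea; have k0 : 0 < kappa R 4 by apply: kappa_pos.
have := @lab_kappa 4 _ _ isT ea => le; split=> // [t|].
  by rewrite inE => /eqP->; rewrite m_sym.
by rewrite !big_cons big_nil; have := kappa4 R; nra.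
Qed.

(** Each vertex of the path has weight 2 and gets at least 2 from either side: from its neighbour,
    or at an end from the feature. *)
Lemma no_double_end d q l1 c1 l2 c2 : (0 < size q)%N -> uniq (q ++ l1 ++ l2) ->
  (forall i, (i.+1 < size q)%N -> edge (nth d q i) (nth d q i.+1)) ->
  feature (nth d q 0) l1 c1 -> feature (nth d q (size q).-1) l2 c2 -> False.
Proof.
move=> q0; rewrite !cat_uniq has_cat => /and3P[uq /norP[ql1 ql2] /and3P[ul1 l12 ul2]].
move=> qe [c10 c1K c1s] [c20 c2K c2s].
pose w s : R := if s \in q then 2 else if s \in l1 then c1 else c2.
have wq i : (i < size q)%N -> w (nth d q i) = 2 by move=> iq; rewrite /w mem_nth.
have w1 s : s \in l1 -> w s = c1.
  by move=> s1; rewrite /w s1 (negPf (hasPn ql1 _ s1)).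
have w2 s : s \in l2 -> w s = c2.
  by move=> s2; rewrite /w (negPf (hasPn ql2 _ s2)) (negPf (hasPn l12 _ s2)).
apply: (@no_subaffine (q ++ l1 ++ l2) w).
- by rewrite !cat_uniq uq ul1 ul2 has_cat negb_or ql1 ql2 l12.
- by case: (q) q0.
- move=> s; rewrite !mem_cat => /or3P[sq|s1|s2]; first by rewrite /w sq.
    by rewrite w1.
  by rewrite w2.
move=> s; rewrite !mem_cat => /or3P[sq|s1|s2]; last 2 first.
- exists [:: nth d q 0]; split=> //.
  + by rewrite inE; apply: contraTneq s1 => ->; apply: (contraL (hasPn ql1 _)); rewrite mem_nth.
  + by move=> t; rewrite inE => /eqP->; rewrite mem_cat mem_nth.
  + by rewrite big_seq1 w1 // wq //; have := c1K _ s1; lra.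
- exists [:: nth d q (size q).-1]; split=> //.
  + rewrite inE; apply: contraTneq s2 => ->; apply: (contraL (hasPn ql2 _)).
    by rewrite mem_nth // prednK.
  + by move=> t; rewrite inE => /eqP->; rewrite mem_cat mem_nth // prednK.
  + by rewrite big_seq1 w2 // wq ?prednK //; have := c2K _ s2; lra.
have [i iq <-] := nthP d sq.
pose left := if i == 0%N then l1 else [:: nth d q i.-1].
pose right := if i == (size q).-1 then l2 else [:: nth d q i.+1].
have ind k k' : (k < size q)%N -> (k' < size q)%N -> (nth d q k == nth d q k') = (k == k').
  by move=> kq k'q; rewrite nth_uniq.
have l1q k : (k < size q)%N -> (nth d q k \in l1) = false.
  by move=> kq; apply/negbTE/(contraL (hasPn ql1 _)); rewrite mem_nth.
have l2q k : (k < size q)%N -> (nth d q k \in l2) = false.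
  by move=> kq; apply/negbTE/(contraL (hasPn ql2 _)); rewrite mem_nth.
have iq1 : (i.-1 < size q)%N by clear -iq; lia.
have iqS : i != (size q).-1 -> (i.+1 < size q)%N by clear -iq; lia.
have leftS : 2 <= \sum_(t <- left) w t * K (nth d q i) t.
  rewrite /left; case: eqP => [->|i0].
    by rewrite big_seq (eq_bigr (fun t => c1 * K (nth d q 0) t)) -?big_seq // => t /w1->.
  rewrite big_seq1 wq // m_sym; have := qe i.-1; rewrite prednK ?lt0n; last exact/eqP.
  by move=> /(_ iq)/edge_kappa; lra.
have rightS : 2 <= \sum_(t <- right) w t * K (nth d q i) t.
  rewrite /right; case: eqP => [->|/eqP/iqS iqS'].
    by rewrite big_seq (eq_bigr (fun t => c2 * K (nth d q (size q).-1) t)) -?big_seq // => t /w2->.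
  by rewrite big_seq1 wq //; have := edge_kappa (qe _ iqS'); lra.
exists (left ++ right); split.
- rewrite cat_uniq /left /right; case: eqP => i0; case: eqP => [iS|/eqP/iqS iS] /=;
    rewrite ?ul1 ?ul2 ?andbT //=.
  + by rewrite orbF l1q.
  + by apply/hasPn => t t2; rewrite inE; apply: contraTneq t2 => ->; rewrite l2q.
  + by rewrite orbF inE ind //; clear; lia.
- rewrite mem_cat negb_or /left /right; case: eqP => i0; case: eqP => [iS|/eqP/iqS iS] /=;
    rewrite ?inE ?ind ?l1q ?l2q //=; move: i0; clear; lia.
- move=> t; rewrite !mem_cat /left /right => /orP[].
    case: eqP => i0; first by move=> ->; rewrite orbT.
    by rewrite inE => /eqP->; rewrite mem_nth.
  case: eqP => [iS|/eqP/iqS iS]; first by move=> ->; rewrite !orbT.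
  by rewrite inE => /eqP->; rewrite mem_nth.
- by rewrite big_cat /= wq //; lra.
Qed.

(** The constant weight 1 is the null vector of the affine diagram of type A. *)
Lemma no_cycle d q : (2 < size q)%N -> uniq q ->
  (forall i, (i.+1 < size q)%N -> edge (nth d q i) (nth d q i.+1)) ->
  edge (nth d q (size q).-1) (nth d q 0) -> False.
Proof.
move=> q3 uq qe qc; apply: (@no_subaffine q (fun=> 1)) => //.
  by case: (q) q3.
move=> s sq; have [i iq <-] := nthP d sq.
pose j := if i == 0%N then (size q).-1 else i.-1.
pose k := if i == (size q).-1 then 0%N else i.+1.
have jq : (j < size q)%N by rewrite /j; case: eqP; lia.
have kq : (k < size q)%N by rewrite /k; case: eqP; lia.
have ej : edge (nth d q i) (nth d q j).
  rewrite /j; case: eqP => [->|i0]; first by rewrite edgeC.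
  by rewrite edgeC; have := qe i.-1; rewrite prednK; [apply|lia].
have ek : edge (nth d q i) (nth d q k).
  by rewrite /k; case: eqP => [->//|iS]; apply: qe; lia.
exists [:: nth d q j; nth d q k]; split.
- by rewrite /= !inE andbT nth_uniq // /j /k; case: (i =P 0%N); case: (i =P (size q).-1); clear -q3 iq; lia.
- by rewrite !inE !nth_uniq // /j /k; case: (i =P 0%N); case: (i =P (size q).-1); clear -q3 iq; lia.
- by move=> t; rewrite !inE => /orP[]/eqP->; rewrite mem_nth.
- by rewrite !big_cons big_nil; have := edge_kappa ej; have := edge_kappa ek; lra.
Qed.

(** The inequality is checked by computation on a model diagram with weights W and edges E; the
    actual labels only increase the right-hand side, as [kappa] is at least 1 on edges. *)
Lemma no_subaffine_simply_laced d (Y : seq I) (W : seq nat) (E : seq (nat * nat)) :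
  uniq Y -> size Y = size W -> W <> [::] ->
  (forall i j, (i, j) \in E -> edge (nth d Y i) (nth d Y j)) ->
  all (fun i => (0 < nth 0 W i) && ((i, i) \notin E) && (2 * nth 0 W i <=
    \sum_(j <- [seq j <- iota 0 (size W) | ((i, j) \in E) || ((j, i) \in E)]) nth 0 W j))%N
    (iota 0 (size W)) -> False.
Proof.
move=> uY sY W0 YE /allP chk; pose w s : R := (nth 0%N W (index s Y))%:R.
have wE i : (i < size W)%N -> w (nth d Y i) = (nth 0%N W i)%:R.
  by rewrite -sY => iY; rewrite /w index_uniq.
apply: (@no_subaffine Y w) => //.
- by move=> Y0; apply: W0; apply: size0nil; rewrite -sY Y0.
- move=> s /(nthP d)[i iY <-]; rewrite wE -?sY // ltr0n.
  by have := chk i; rewrite mem_iota -sY iY => /(_ isT)/andP[/andP[]].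
move=> s /(nthP d)[i iY <-]; have := chk i.
rewrite mem_iota -sY iY => /(_ isT)/andP[/andP[Wi Ei] le].
set N := [seq j <- _ | _] in le; exists [seq nth d Y j | j <- N].
have NY j : j \in N -> (j < size Y)%N.
  by rewrite mem_filter mem_iota => /andP[].
split.
- rewrite map_inj_in_uniq ?filter_uniq ?iota_uniq // => a b /NY aY /NY bY /eqP.
  by rewrite nth_uniq // => /eqP.
- apply/mapP => -[j jN /eqP]; rewrite nth_uniq //; last exact: NY.
  move=> /eqP ij; move: jN; rewrite -ij mem_filter orbb (negPf Ei) //.
- by move=> t /mapP[j /NY jY ->]; rewrite mem_nth.
rewrite wE -?sY // big_map -natrM; apply: (@le_trans _ _ (\sum_(j <- N) (nth 0%N W j)%:R)).
  by rewrite -natr_sum ler_nat.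
rewrite !big_seq; apply: ler_sum => j jN; rewrite wE -?sY ?NY //.
rewrite ler_peMr ?ler0n //; apply: edge_kappa.
by move: jN; rewrite mem_filter => /andP[/orP[]/YE + _] //; rewrite edgeC.
Qed.

(** L bounds the values of [kappa] along the path from below. Past the last vertex the default
    weight 0 stands for the missing neighbour. *)
Lemma no_subaffine_path d (Y : seq I) (W L : seq R) :
  uniq Y -> size Y = size W -> W <> [::] ->
  (forall i, (i.+1 < size Y)%N -> nth 0 L i <= K (nth d Y i) (nth d Y i.+1)) ->
  (forall i, (i < size Y)%N -> 0 < nth 0 W i) ->
  (forall i, (i < size Y)%N -> 2 * nth 0 W i <=
    (if i is j.+1 then nth 0 W j * nth 0 L j else 0) + nth 0 W i.+1 * nth 0 L i) ->
  False.
Proof.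
move=> uY sY W0 YL Wpos Wle; pose w s : R := nth 0 W (index s Y).
have wE i : (i < size Y)%N -> w (nth d Y i) = nth 0 W i.
  by move=> iY; rewrite /w index_uniq.
apply: (@no_subaffine Y w) => //.
- by move=> Y0; apply: W0; apply: size0nil; rewrite -sY Y0.
- by move=> s /(nthP d)[i iY <-]; rewrite wE // Wpos.
move=> s /(nthP d)[i iY <-]; rewrite wE //.
pose left := if i is j.+1 then [:: nth d Y j] else [::].
pose right := if (i.+1 < size Y)%N then [:: nth d Y i.+1] else [::].
exists (left ++ right); split.
- rewrite /left /right; case: (i) iY => [|j] jY; case: ifP => //= jS.
  by rewrite inE nth_uniq //; lia.
- rewrite mem_cat negb_or /left /right.
  by case: (i) iY => [|j] jY; case: ifP => //= jS; rewrite !inE !nth_uniq //; lia.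
- move=> t; rewrite mem_cat /left /right => /orP[].
    by case: (i) iY => // j jY; rewrite inE => /eqP->; rewrite mem_nth //; lia.
  by case: ifP => // iS; rewrite inE => /eqP->; rewrite mem_nth.
apply: le_trans (Wle i iY) _; rewrite big_cat; apply: lerD.
  rewrite /left; case: (i) iY => [|j] jY; first by rewrite big_nil.
  rewrite big_seq1 wE ?(ltnW jY) // ler_pM2l ?Wpos ?(ltnW jY) //.
  by rewrite m_sym YL.
rewrite /right; case: ifP => iS; last by rewrite big_nil nth_default ?mul0r // -sY; lia.
by rewrite big_seq1 wE // ler_pM2l ?Wpos // YL.
Qed.

End Diagram.

Section Segments.
Variables (T : eqType) (d : T).

Definition segment (P : seq T) i k := take k (drop i P).

Lemma size_segment P i k : (i + k <= size P)%N -> size (segment P i k) = k.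
Proof. by move=> ikP; rewrite size_takel // size_drop; lia. Qed.

Lemma nth_segment P i k a : (a < k)%N -> nth d (segment P i k) a = nth d P (i + a).
Proof. by move=> ak; rewrite nth_take // nth_drop. Qed.

Lemma uniq_segment P i k : uniq P -> uniq (segment P i k).
Proof. by move=> uP; apply/take_uniq/drop_uniq. Qed.

Lemma sub_segment P i k y : y \in segment P i k -> y \in P.
Proof. by move=> /mem_take /mem_drop. Qed.

Lemma notin_nth P y k : y \notin P -> (k < size P)%N ->
  ((y == nth d P k) = false) * ((nth d P k == y) = false).
Proof.
move=> yP kP; have : y != nth d P k by apply: contraNneq yP => ->; rewrite mem_nth.
by move=> yn; split; apply/negbTE; rewrite // eq_sym.
Qed.

Lemma mem_segment P i k j : uniq P -> (j < size P)%N -> (i + k <= size P)%N ->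
  (nth d P j \in segment P i k) = (i <= j < i + k)%N.
Proof.
move=> uP jP ikP; apply/idP/idP => [/(nthP d)[a]|/andP[ij jik]].
  rewrite size_segment // => ak; rewrite nth_segment // => /eqP.
  by rewrite nth_uniq //; [move=> /eqP<-; clear -ak; lia|clear -ak ikP; lia].
apply/(nthP d); exists (j - i)%N; first by rewrite size_segment //; clear -ij jik; lia.
by rewrite nth_segment ?subnKC //; clear -ij jik; lia.
Qed.

End Segments.

(** * Longest paths and their branches *)

Section Classification.
Variables (R : realType) (I : choiceType) (m : I -> I -> nat).
Local Notation G := (coxeter_group m).
Local Notation edge := (coxeter_edge m).
Local Notation K := (fun s t => kappa R (m s t)).
Local Notation lab := (lab m).
Hypothesis hm : coxeter_matrix m.
Hypothesis hirr : irreducible_coxeter m.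
Variable z : G.
Hypothesis zN : neg_one R z.
Variable d : (I : eqType).
Let m_sym s t : m s t = m t s. Proof. by apply/(proj1 hm). Qed.
Local Notation x := (nth d).

Definition simple_path (P : seq (I : eqType)) :=
  uniq P /\ forall i, (i.+1 < size P)%N -> edge (x P i) (x P i.+1).

Definition longest_path P :=
  [/\ simple_path P, (0 < size P)%N & forall Q, simple_path Q -> (size Q <= size P)%N].

Lemma longest_path_ex : exists P, longest_path P.
Proof.
have [p up pE] := neg_one_finite hm zN.
pose Q k := `[< exists P, simple_path P /\ size P = k >].
have Q1 : Q 1%N by apply/asboolP; exists [:: d].
have Qle k : Q k -> (k <= size p)%N.
  by move=> /asboolP[P [[uP _] <-]]; apply: uniq_leq_size.
case: (ex_maxnP (ex_intro (fun k => is_true (Q k)) 1%N Q1) Qle) => k /asboolP[P [sP sk]] kmax.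
exists P; split=> // [|P' sP']; first by rewrite sk; apply: kmax.
by rewrite sk; apply: kmax; apply/asboolP; exists P'.
Qed.

Lemma simple_path_rev P : simple_path P -> simple_path (rev P).
Proof.
case=> uP eP; split; first by rewrite rev_uniq.
move=> i; rewrite size_rev => iP; rewrite !nth_rev //; last exact: ltnW.
rewrite edgeC //; have := eP (size P - i.+2)%N.
have -> : ((size P - i.+2).+1 = size P - i.+1)%N by clear -iP; simpl in *; lia.
by apply; clear -iP; simpl in *; lia.
Qed.

Lemma longest_path_rev P : longest_path P -> longest_path (rev P).
Proof.
case=> sP P0 Pmax; split; rewrite ?size_rev //; exact: simple_path_rev.
Qed.

Lemma simple_path_segment P i k : simple_path P -> (i + k <= size P)%N ->
  simple_path (segment P i k).
Proof.
move=> [uP eP] ikP; split; first exact: uniq_segment.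
move=> j; rewrite size_segment // => jk; rewrite !nth_segment //; last exact: ltnW.
by rewrite addnS; apply: eP; clear -jk ikP; simpl in *; lia.
Qed.

Lemma chordless P i j : simple_path P -> (i.+1 < j)%N -> (j < size P)%N ->
  ~~ edge (x P i) (x P j).
Proof.
move=> sP ij jP; apply/negP => e.
have ijP : (i + (j - i).+1 <= size P)%N by clear -ij jP; simpl in *; lia.
have [uS eS] := simple_path_segment sP ijP.
apply: (no_cycle hm zN _ uS eS); rewrite size_segment //; first by clear -ij; simpl in *; lia.
rewrite !nth_segment //= addn0 edgeC //.
by have -> : (i + (j - i) = j)%N by clear -ij; simpl in *; lia.
Qed.

Lemma path_label P i j : simple_path P -> (i < j)%N -> (j < size P)%N ->
  m (x P i) (x P j) = if j == i.+1 then m (x P i) (x P i.+1) else 2.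
Proof.
move=> sP ij jP; case: eqP => [->//|ijS]; apply: non_edge => //.
  by case: sP => uP _; rewrite nth_uniq //; clear -ij jP; simpl in *; lia.
by apply: chordless => //; clear -ij ijS; simpl in *; lia.
Qed.

Lemma single_neighbour P y i j : simple_path P -> y \notin P -> (i < j)%N ->
  (j < size P)%N -> edge y (x P i) -> edge y (x P j) -> False.
Proof.
move=> sP yP ij jP ei ej.
have ijP : (i + (j - i).+1 <= size P)%N by clear -ij jP; simpl in *; lia.
have [uS eS] := simple_path_segment sP ijP.
apply: (@no_cycle _ _ _ hm _ zN d (y :: segment P i (j - i).+1)).
- by rewrite /= size_segment //; clear -ij; simpl in *; lia.
- by rewrite /= uS andbT; apply: contra yP; apply: sub_segment.
- move=> [|k] /=; rewrite size_segment // => kS.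
    by rewrite nth_segment // addn0.
  by apply: eS; rewrite size_segment.
- rewrite /= size_segment // -[x _ _]/(x (segment P i (j - i).+1) (j - i)).
  rewrite nth_segment //= edgeC //.
  by have -> : (i + (j - i) = j)%N by clear -ij; simpl in *; lia.
Qed.

(** Otherwise y would prolong the longest path. *)
Lemma outside_end0 P y : longest_path P -> y \notin P -> edge y (x P 0) -> False.
Proof.
case=> [[uP eP] P0 Pmax] yP e0; have : (size (y :: P) <= size P)%N.
  apply: Pmax; split; first by rewrite /= yP.
  by move=> [|i] //= iP; apply: eP.
by rewrite /= ltnn.
Qed.

Lemma outside_end P y : longest_path P -> y \notin P ->
  edge y (x P (size P).-1) -> False.
Proof.
move=> lP yP e; apply: (@outside_end0 (rev P) y); first exact: longest_path_rev.
  by rewrite mem_rev.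
by rewrite nth_rev ?subn1 //; case: lP.
Qed.

Lemma two_features P i j l1 (c1 : R) l2 (c2 : R) : simple_path P -> (i <= j)%N ->
  (j < size P)%N -> uniq (l1 ++ l2) ->
  (forall t, t \in l1 ++ l2 -> t \notin segment P i (j - i).+1) ->
  feature m (x P i) l1 c1 -> feature m (x P j) l2 c2 -> False.
Proof.
move=> sP ij jP ul lP f1 f2.
have ijP : (i + (j - i).+1 <= size P)%N by clear -ij jP; simpl in *; lia.
have [uS eS] := simple_path_segment sP ijP.
apply: (@no_double_end _ _ _ hm _ zN d (segment P i (j - i).+1) l1 c1 l2 c2 _ _ eS).
- by rewrite size_segment.
- by rewrite cat_uniq uS ul andbT; apply/hasPn.
- by rewrite nth_segment // addn0.
- rewrite size_segment // nth_segment //=.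
  by have -> : (i + (j - i) = j)%N by clear -ij; simpl in *; lia.
Qed.

(** Two labels above 3 enclose an affine diagram of type C. *)
Lemma one_big_label P i j : simple_path P -> (i < j)%N -> (j.+1 < size P)%N ->
  lab 4 (x P i) (x P i.+1) -> lab 4 (x P j) (x P j.+1) -> False.
Proof.
move=> sP ij jP li lj; have uP : uniq P by case: sP.
apply: (@two_features P i.+1 j [:: x P i] (kappa R 4) [:: x P j.+1] (kappa R 4)) => //.
- exact: ltnW.
- by rewrite /= inE nth_uniq ?andbT //; clear -ij jP; simpl in *; lia.
- by move=> t; rewrite !inE => /orP[]/eqP->; rewrite mem_segment //; clear -ij jP; simpl in *; lia.
- by apply: feature4 => //; rewrite labC.
- by apply: feature4.
Qed.

Definition branch P y i := [/\ y \notin P, (i < size P)%N & edge y (x P i)].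

Lemma branch_inner P y i : longest_path P -> branch P y i ->
  (0 < i)%N /\ (i.+1 < size P)%N.
Proof.
move=> lP [yP iP e]; split.
  by rewrite lt0n; apply/eqP => i0; apply: (outside_end0 lP yP); rewrite -i0.
rewrite ltn_neqAle iP andbT; apply/eqP => iS; apply: (outside_end lP yP).
by rewrite -iS.
Qed.

Lemma branch_rev P y i : branch P y i -> branch (rev P) y (size P - i.+1).
Proof.
case=> yP iP e; split; rewrite ?mem_rev ?size_rev //; first by clear -iP; simpl in *; lia.
rewrite nth_rev; last by clear -iP; simpl in *; lia.
by have -> : (size P - (size P - i.+1).+1 = i)%N by clear -iP; simpl in *; lia.
Qed.

(** Two forks enclose an affine diagram of type D. *)
Lemma one_branch P y y' i j : longest_path P -> (i <= j)%N -> y != y' ->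
  branch P y i -> branch P y' j -> False.
Proof.
move=> lP ij yy' bi bj; have [sP _ _] := lP; have [uP eP] := sP.
have [i0 iS] := branch_inner lP bi; have [j0 jS] := branch_inner lP bj.
case: bi bj => yP iP ei [y'P jP ej].
have iP1 : (i.-1 < size P)%N by clear -iP; simpl in *; lia.
have iE : i.-1.+1 = i by rewrite prednK.
apply: (@two_features P i j [:: y; x P i.-1] 1 [:: y'; x P j.+1] 1) => //.
- rewrite /= !inE !negb_or yy' /= nth_uniq // !(notin_nth d yP) //.
  by rewrite !(notin_nth d y'P) //=; clear -ij i0; simpl in *; lia.
- have sub t : t \notin P -> t \notin segment P i (j - i).+1.
    by apply: contra; apply: sub_segment.
  move=> t; rewrite !inE => /or4P[]/eqP->; try exact: sub.
    by rewrite mem_segment //; clear -ij i0 jP; simpl in *; lia.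
  by rewrite mem_segment //; clear -ij jP; simpl in *; lia.
- apply: feature2 => //; rewrite // edgeC //.
  by rewrite -{2}iE; apply: eP; rewrite iE.
- by apply: feature2 => //; rewrite ?(edgeC hm _ y') //; apply: eP.
Qed.

(** A fork and a label above 3 enclose an affine diagram of type B. *)
Lemma branch_label P y i j : longest_path P -> branch P y i ->
  (j.+1 < size P)%N -> lab 4 (x P j) (x P j.+1) -> False.
Proof.
wlog ij : P i j / (i <= j)%N.
  move=> H lP bi jP lj; have [ij|ij] := leqP i j; first exact: (H P i j).
  have iP : (i < size P)%N by case: bi.
  apply: (H (rev P) (size P - i.+1)%N (size P - j.+2)%N).
  - by clear -ij; simpl in *; lia.
  - exact: longest_path_rev.
  - exact: branch_rev.
  - by rewrite size_rev; clear -jP; simpl in *; lia.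
  rewrite labC // !nth_rev; try by clear -jP; simpl in *; lia.
  have -> : (size P - (size P - j.+2).+1 = j.+1)%N by clear -jP; simpl in *; lia.
  by have -> : (size P - (size P - j.+2).+2 = j)%N by clear -jP; simpl in *; lia.
move=> lP bi jS lj; have [sP _ _] := lP; have [uP eP] := sP.
have [i0 iS] := branch_inner lP bi; case: bi => yP iP ei.
have iP1 : (i.-1 < size P)%N by clear -iP; simpl in *; lia.
have iE : i.-1.+1 = i by rewrite prednK.
apply: (@two_features P i j [:: y; x P i.-1] 1 [:: x P j.+1] (kappa R 4)) => //.
- exact: ltnW.
- rewrite /= !inE !negb_or nth_uniq // andbT.
  by rewrite !(notin_nth d yP) //=; clear -ij i0; simpl in *; lia.
- have jP := ltnW jS; move=> t; rewrite !inE => /or3P[]/eqP->.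
  + by apply: contra yP; apply: sub_segment.
  + by rewrite mem_segment //; clear -ij i0 jP; simpl in *; lia.
  + by rewrite mem_segment //; clear -ij jP; simpl in *; lia.
- apply: feature2 => //; rewrite // edgeC //.
  by rewrite -{2}iE; apply: eP; rewrite iE.
- by apply: feature4.
Qed.

Lemma branch_own_label P y i : longest_path P -> branch P y i -> ~~ lab 4 y (x P i).
Proof.
move=> lP bi; apply/negP => l4; have [sP _ _] := lP; have [uP eP] := sP.
have [i0 iS] := branch_inner lP bi; case: bi => yP iP ei.
have iP1 : (i.-1 < size P)%N by clear -iP; simpl in *; lia.
have iE : i.-1.+1 = i by rewrite prednK.
apply: (@two_features P i i [:: y] (kappa R 4) [:: x P i.-1; x P i.+1] 1) => //.
- rewrite /= !inE !negb_or nth_uniq // andbT.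
  by rewrite !(notin_nth d yP) //=; clear -i0; simpl in *; lia.
- move=> t; rewrite !inE => /or3P[]/eqP->.
  + by apply: contra yP; apply: sub_segment.
  + by rewrite mem_segment //; clear -i0 iP; simpl in *; lia.
  + by rewrite mem_segment //; clear -iP; simpl in *; lia.
- by apply: feature4 => //; rewrite labC.
- apply: feature2 => //; last exact: eP.
  by rewrite edgeC // -{2}iE; apply: eP; rewrite iE.
Qed.

(** Since P is longest, the branch point is at distance at least 2 from both ends, so y and y' would
    complete three arms of length 2. *)
Lemma branch_arm P y y' i : longest_path P -> branch P y i -> y' \notin P ->
  y' != y -> edge y y' -> False.
Proof.
move=> lP bi y'P y'y e; have [sP P0 Pmax] := lP; have [uP eP] := sP.
(* If k were 1, replacing the first vertex of Q by y', y would lengthen the path. *)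
have arm Q k : longest_path Q -> branch Q y k -> y' \notin Q -> (1 < k)%N.
  move=> [[uQ eQ] Q0 Qmax] bk y'Q.
  have [k0 kS] : (0 < k)%N /\ (k.+1 < size Q)%N by apply: branch_inner bk.
  case: bk => yQ kQ ek; rewrite ltn_neqAle k0 andbT; apply/eqP => k1.
  rewrite -k1 in ek kS; pose Q' : seq (I : eqType) := [:: y', y & drop 1 Q].
  have : (size Q' <= size Q)%N.
    apply: Qmax; rewrite /Q'; split.
      rewrite /= drop_uniq // inE negb_or y'y andbT.
      by rewrite (contra _ y'Q) ?(contra _ yQ) // => /mem_drop.
    move=> [|[|j]] //=; rewrite ?nth_drop ?size_drop //; first by rewrite edgeC.
    by move=> jS; apply: eQ; clear -jS; simpl in *; lia.
  by rewrite /Q' /= size_drop; clear -kS; simpl in *; lia.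
have i2 := arm P i lP bi y'P.
have := arm (rev P) (size P - i.+1)%N (longest_path_rev lP) (branch_rev bi).
rewrite mem_rev => /(_ y'P) ri2; case: bi => yP iP ei.
have sS : (i - 2 + 5 <= size P)%N by clear -i2 ri2; simpl in *; lia.
have [uS eS] := simple_path_segment sP sS.
have notS t : t \notin P -> t \notin segment P (i - 2) 5.
  by apply: contra; apply: sub_segment.
(* the null vector of the affine diagram of type E6 *)
apply: (@no_subaffine_simply_laced _ _ _ hm _ zN d
  [:: y', y & segment P (i - 2) 5] [:: 1; 2; 1; 2; 3; 2; 1]
  [:: (0, 1); (1, 4); (2, 3); (3, 4); (4, 5); (5, 6)])%N => //.
- by rewrite /= uS inE negb_or y'y !notS.
- by rewrite /= size_segment.
- have seg k : (k < 4)%N -> edge (x P (i - 2 + k)) (x P (i - 2 + k.+1)).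
    by move=> k4; rewrite addnS; apply: eP; clear -k4 sS; simpl in *; lia.
  have i2E : (i - 2 + 2 = i)%N by rewrite subnK.
  move=> a b; rewrite !inE => /or4P[/eqP[-> ->]|/eqP[-> ->]|/eqP[-> ->]|].
  + by rewrite /= edgeC.
  + by rewrite /= nth_segment // i2E.
  + by rewrite /= !nth_segment //; apply: seg.
  by move=> /or3P[]/eqP[-> ->]; rewrite /= !nth_segment //; apply: seg.
- by rewrite /= !big_cons !big_nil.
Qed.

Lemma path_covers P : longest_path P -> (forall y i, ~ branch P y i) ->
  forall s, s \in P.
Proof.
move=> [[uP eP] P0 Pmax] nb; apply: (irreducible_ind hirr (s := x P 0)).
  by rewrite mem_nth.
move=> s t st /(nthP d)[i iP sE]; apply: contraT => tP.
by case: (nb t i); split; rewrite // sE edgeC.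
Qed.

Lemma branch_covers P y i : longest_path P -> branch P y i ->
  forall s, s \in y :: P.
Proof.
move=> lP bi; apply: (irreducible_ind hirr (s := y)); first by rewrite mem_head.
move=> s t st; rewrite inE => sy; apply: contraT.
rewrite inE negb_or => /andP[ty tP]; case/predU1P: sy => [sE|/(nthP d)[j jP sE]].
  by case: (branch_arm lP bi tP ty); rewrite -sE.
have bj : branch P t j by split; rewrite // sE edgeC.
have [ij|/ltnW ij] := leqP i j.
  by case: (@one_branch P y t i j) => //; rewrite eq_sym.
by case: (@one_branch P t y j i).
Qed.

Lemma branch_label_y P y i j : longest_path P -> branch P y i ->
  (j < size P)%N -> m y (x P j) = if j == i then 3 else 2.
Proof.
move=> lP bi jP; have [sP _ _] := lP; have [yP iP ei] := bi.
case: eqP => [->|ji]; first exact: edge_label3 ei (branch_own_label lP bi).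
apply: non_edge => //; first by apply: contraNneq yP => ->; rewrite mem_nth.
apply/negP => ej; have [ij|ij|/esym//] := ltngtP i j.
  exact: (single_neighbour sP yP ij).
exact: (single_neighbour sP yP ij).
Qed.

Lemma branch_label_path P y i j k : longest_path P -> branch P y i ->
  (j < k)%N -> (k < size P)%N -> m (x P j) (x P k) = if k == j.+1 then 3 else 2.
Proof.
move=> lP bi jk kP; have [sP _ _] := lP; rewrite path_label //.
case: eqP => // kE; rewrite kE in kP; have [_ eP] := sP.
apply: edge_label3; first exact: eP.
by apply/negP; apply: branch_label lP bi kP.
Qed.

Definition lists T (Y : seq (I : eqType)) :=
  [/\ uniq Y, forall s, s \in Y, size Y = rank T
    & forall i j, (i < j)%N -> (j < size Y)%N ->
        m (x Y i) (x Y j) = edge_label T i.+1 j.+1].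

(* All reflections are then conjugate, so that the sign is the only nontrivial *)
(* character; it is 1 at -1, whose determinant is 1.                          *)
Definition odd_and_even (Y : seq (I : eqType)) :=
  [/\ uniq Y, forall s, s \in Y, ~~ odd (size Y)
    & forall s t, edge s t -> odd (m s t)].

Definition lists_F4 (Y : seq (I : eqType)) :=
  [/\ uniq Y, forall s, s \in Y, size Y = 4%N
    & forall i j, (i < j)%N -> (j < 4)%N ->
       m (x Y i) (x Y j) = (if j == i.+1 then if i == 1 then 4 else 3 else 2)%N].

End Classification.

(** * The list of diagrams *)

Section ClassificationTheorem.
Variables (R : realType) (I : choiceType) (m : I -> I -> nat).
Local Notation G := (coxeter_group m).
Local Notation edge := (coxeter_edge m).
Local Notation K := (fun s t => kappa R (m s t)).
Local Notation lab := (lab m).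
Hypothesis hm : coxeter_matrix m.
Hypothesis hirr : irreducible_coxeter m.
Variable z : G.
Hypothesis zN : neg_one R z.
Variable d : (I : eqType).
Let m_sym s t : m s t = m t s. Proof. by apply/(proj1 hm). Qed.
Local Notation x := (nth d).
Local Notation lists := (lists m d).
Local Notation lists_F4 := (lists_F4 m d).
Local Notation longest_path := (longest_path m d).
Local Notation branch := (branch m d).

(** The diagrams D_n with n even, E6, E8, H4 and I2 with an odd label all fall under
    [odd_and_even]. *)
Definition classified :=
  [\/ exists T Y, lists T Y /\
        [\/ exists2 n, (0 < n)%N & T = A_ n, exists2 n, (2 < n)%N & T = B_ n
          | exists2 n, odd n && (3 < n)%N & T = D_ n],
      exists T Y, lists T Y /\
        [\/ T = E7, T = H3 | exists2 k, ~~ odd k && (3 < k)%N & T = I2 k],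
      exists Y, odd_and_even m Y | exists Y, lists_F4 Y].

Lemma branch_odd P y i : longest_path P -> branch P y i ->
  forall s t, edge s t -> odd (m s t).
Proof.
move=> lP bi s t st; have cov := branch_covers hm hirr zN lP bi.
suff : m s t = 3 \/ m s t = 2 by case=> mst //; move: st; rewrite /coxeter_edge /= mst.
have yx j : (j < size P)%N -> m y (x P j) = 3 \/ m y (x P j) = 2.
  by move=> jP; rewrite (branch_label_y hm zN lP bi jP); case: eqP; [left|right].
have xx j k : (j < k)%N -> (k < size P)%N -> m (x P j) (x P k) = 3 \/ m (x P j) (x P k) = 2.
  by move=> jk kP; rewrite (branch_label_path hm zN lP bi jk kP); case: eqP; [left|right].
have := edge_neq hm st; move: (cov s) (cov t); rewrite !inE.
move=> /predU1P[->|/(nthP d)[j jP <-]] /predU1P[->|/(nthP d)[k kP <-]].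
- by rewrite eqxx.
- by move=> _; apply: yx.
- by move=> _; rewrite m_sym; apply: yx.
- by case: (ltngtP j k) => [jk _|kj _|->]; [apply: xx|rewrite m_sym; apply: xx|rewrite eqxx].
Qed.

(** Besides y there are two arms of lengths i and size P - i - 1, and reversal makes i the smaller.
    For i = 1 this is type D; for i = 2 it is E6, E7, E8 or contains affine E8; for i > 2 it
    contains affine E7. *)
Lemma branch_classified P y i : longest_path P -> branch P y i -> classified.
Proof.
wlog ile : P i / (i <= size P - i.+1)%N.
  move=> H lP bi; have [ile|ile] := leqP i (size P - i.+1); first exact: (H P i).
  apply: (H (rev P) (size P - i.+1)%N).
  - by rewrite size_rev; clear -ile; simpl in *; lia.
  - exact: longest_path_rev.
  - exact: branch_rev.
move=> lP bi; have [sP _ _] := lP; have [uP eP] := sP.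
have [i0 iS] := branch_inner hm lP bi; have [yP iP ei] := bi.
have cov := branch_covers hm hirr zN lP bi.
have uyP : uniq (y :: P) by rewrite /= yP.
have Ly j : (j < size P)%N -> m y (x P j) = if j == i then 3 else 2.
  exact: (branch_label_y hm zN lP bi).
have LP j k : (j < k)%N -> (k < size P)%N ->
    m (x P j) (x P k) = if k == j.+1 then 3 else 2.
  exact: (branch_label_path hm zN lP bi).
have notS t a b : t \notin P -> t \notin segment P a b.
  by apply: contra; apply: sub_segment.
have [i1|i1] := eqVneq i 1%N.
  have [oddP|evenP] := boolP (odd (size P).+1); last first.
    by constructor 3; exists (y :: P); split=> //; apply: branch_odd lP bi.
  constructor 1; exists (D_ (size P).+1), (y :: P); split; last first.
    constructor 3; exists (size P).+1 => //; rewrite oddP.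
    by clear -i1 iS ile; simpl in *; lia.
  split=> // -[|a] [|b] // ab bP.
    rewrite [LHS]/= Ly // i1 /= !inE !xpair_eqE /=.
    by case: b {ab bP} => [|[|b]].
  rewrite [LHS]/= LP // /= !inE !xpair_eqE /=.
  by case: a ab {bP} => [|[|a]] //=; case: b => [|[|b]].
have [i2|i2] := eqVneq i 2%N.
  have n5 : (4 < size P)%N by clear -i2 iS ile; simpl in *; lia.
  have [n5'|n5'] := eqVneq (size P) 5%N.
    constructor 3; exists (y :: P); split=> //; first by rewrite /= n5'.
    exact: branch_odd lP bi.
  have [n6|n6] := eqVneq (size P) 6%N.
    (* In the numbering of E7 the branch y is s_2, between the first two vertices of the path. *)
    constructor 2; exists E7, [:: x P 0, y & drop 1 P]; split; last by constructor 1.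
    have PE : P = x P 0 :: drop 1 P.
      by case: (P) n6 => [//|a l _]; rewrite /= drop0.
    have pE : perm_eq [:: x P 0, y & drop 1 P] (y :: P).
      have -> : y :: P = [:: y] ++ [:: x P 0] ++ drop 1 P by rewrite /= -PE.
      by rewrite perm_sym perm_catCA.
    split.
    - by rewrite (perm_uniq pE).
    - by move=> s; rewrite (perm_mem pE).
    - by rewrite (perm_size pE) /= n6.
    rewrite (perm_size pE) /= n6 => a b ab b7.
    have nthE c : (1 < c)%N -> (c < 7)%N -> x [:: x P 0, y & drop 1 P] c = x P c.-1.
      by case: c => [|[|c]] //= _ _; rewrite nth_drop.
    case: a ab => [|[|a]] ab.
    - case: b ab b7 => [|[|b]] // _ b7; first by rewrite [LHS]/= m_sym Ly ?i2 ?n6.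
      rewrite (nthE b.+2) // [x _ 0]/= LP ?n6 //.
      by case: b b7 => [|[|[|[|[|b]]]]].
    - rewrite (nthE b) // [x _ 1]/= Ly ?i2 ?n6; last by case: b ab b7.
      by case: b ab b7 => [|[|[|[|[|[|[|b]]]]]]].
    - have b1 : (1 < b)%N by exact: leq_ltn_trans ab.
      rewrite (nthE a.+2) ?(ltn_trans ab) // (nthE b) // LP ?n6; last 2 first.
      + by case: (b) ab.
      + by case: (b) b7.
      by case: a b {b1} ab b7 => [|[|[|[|a]]]] [|[|[|[|[|[|[|b]]]]]]].
  have [n7|n7] := eqVneq (size P) 7%N.
    constructor 3; exists (y :: P); split=> //; first by rewrite /= n7.
    exact: branch_odd lP bi.
  have n8 : (0 + 8 <= size P)%N by clear -n5 n5' n6 n7; simpl in *; lia.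
  have [uS eS] := simple_path_segment sP n8.
  (* the null vector of the affine diagram of type E8 *)
  case: (@no_subaffine_simply_laced _ _ _ hm _ zN d
    (y :: segment P 0 8) [:: 3; 2; 4; 6; 5; 4; 3; 2; 1]
    [:: (0, 3); (1, 2); (2, 3); (3, 4); (4, 5); (5, 6); (6, 7); (7, 8)])%N => //.
  - by rewrite /= uS notS.
  - by rewrite /= size_segment.
  - have seg k : (k < 7)%N -> edge (x P (0 + k)) (x P (0 + k.+1)).
      by move=> k7; apply: eP; clear -k7 n8; simpl in *; lia.
    move=> a b; rewrite !inE => /or4P[/eqP[-> ->]|/eqP[-> ->]|/eqP[-> ->]|].
    + by rewrite /= nth_segment // -i2.
    + by rewrite /= !nth_segment //; apply: seg.
    + by rewrite /= !nth_segment //; apply: seg.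
    move=> /or4P[/eqP[-> ->]|/eqP[-> ->]|/eqP[-> ->]|/orP[]/eqP[-> ->]];
    by rewrite /= !nth_segment //; apply: seg.
  - by rewrite /= !big_cons !big_nil.
have n7 : (i - 3 + 7 <= size P)%N by clear -i0 i1 i2 ile iS; simpl in *; lia.
have i3 : (i - 3 + 3 = i)%N by clear -i0 i1 i2; simpl in *; lia.
have [uS eS] := simple_path_segment sP n7.
(* the null vector of the affine diagram of type E7 *)
case: (@no_subaffine_simply_laced _ _ _ hm _ zN d
  (y :: segment P (i - 3) 7) [:: 2; 1; 2; 3; 4; 3; 2; 1]
  [:: (0, 4); (1, 2); (2, 3); (3, 4); (4, 5); (5, 6); (6, 7)])%N => //.
- by rewrite /= uS notS.
- by rewrite /= size_segment.
- have seg k : (k < 6)%N -> edge (x P (i - 3 + k)) (x P (i - 3 + k.+1)).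
    by move=> k7; rewrite addnS; apply: eP; clear -k7 n7; simpl in *; lia.
  move=> a b; rewrite !inE => /or4P[/eqP[-> ->]|/eqP[-> ->]|/eqP[-> ->]|].
  + by rewrite /= nth_segment // i3.
  + by rewrite /= !nth_segment //; apply: seg.
  + by rewrite /= !nth_segment //; apply: seg.
  move=> /or4P[]/eqP[-> ->]; by rewrite /= !nth_segment //; apply: seg.
- by rewrite /= !big_cons !big_nil.
Qed.

Lemma odd_listing P : (forall s, s \in P) ->
  (forall j k, (j < k)%N -> (k < size P)%N -> edge (x P j) (x P k) ->
     odd (m (x P j) (x P k))) -> forall s t, edge s t -> odd (m s t).
Proof.
move=> cov oddP s t st; have := edge_neq hm st; move: st.
have [/(nthP d)[j jP <-] /(nthP d)[k kP <-]] := (cov s, cov t).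
case: (ltngtP j k) => [jk e _|kj e _|->]; last by rewrite eqxx.
- exact: oddP.
- by rewrite m_sym; apply: oddP => //; rewrite edgeC.
Qed.

Lemma segment_weights P i k (W L : seq R) : longest_path P ->
  (i + k <= size P)%N -> (0 < k)%N -> k = size W ->
  (forall j, (j.+1 < k)%N -> nth 0 L j <= K (x P (i + j)) (x P (i + j).+1)) ->
  (forall j, (j < k)%N -> 0 < nth 0 W j) ->
  (forall j, (j < k)%N -> 2 * nth 0 W j <=
    (if j is l.+1 then nth 0 W l * nth 0 L l else 0) + nth 0 W j.+1 * nth 0 L j) ->
  False.
Proof.
move=> [sP _ _] ikP k0 kW LK W0 WL; have [uS eS] := simple_path_segment sP ikP.
apply: (@no_subaffine_path _ _ _ hm _ zN d (segment P i k) W L) => //;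
  rewrite ?size_segment //.
- by case: (W) kW k0 => // ->.
- by move=> j jk; rewrite !nth_segment ?(ltnW jk) // addnS; apply: LK.
Qed.

(** By reversal the marked edge lies in the first half. At the end of the path it gives I2, B, H3 or
    H4; inside, only F4 remains. *)
Lemma big_label_classified P i : longest_path P -> (forall s, s \in P) ->
  (i.+1 < size P)%N -> lab 4 (x P i) (x P i.+1) -> classified.
Proof.
wlog ile : P i / (i <= size P - i.+2)%N.
  move=> H lP cov iS li; have [ile|ile] := leqP i (size P - i.+2); first exact: (H P i).
  apply: (H (rev P) (size P - i.+2)%N).
  - by rewrite size_rev; clear -ile; simpl in *; lia.
  - exact: longest_path_rev.
  - by move=> s; rewrite mem_rev.
  - by rewrite size_rev; clear -iS; simpl in *; lia.
  rewrite labC // !nth_rev; try by clear -iS; simpl in *; lia.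
  have -> : (size P - (size P - i.+2).+1 = i.+1)%N by clear -iS; simpl in *; lia.
  by have -> : (size P - (size P - i.+2).+2 = i)%N by clear -iS; simpl in *; lia.
move=> lP cov iS li; have [sP _ _] := lP; have [uP eP] := sP.
have L3 j : j != i -> (j.+1 < size P)%N -> m (x P j) (x P j.+1) = 3.
  move=> ji jS; apply: edge_label3; first exact: eP.
  apply/negP => lj; have [jlti|iltj|jei] := ltngtP j i.
  - exact: (one_big_label hm zN sP jlti iS lj li).
  - exact: (one_big_label hm zN sP iltj jS li lj).
  - by rewrite jei eqxx in ji.
have LP j k : (j < k)%N -> (k < size P)%N -> m (x P j) (x P k) =
    if k == j.+1 then if j == i then m (x P i) (x P i.+1) else 3 else 2.
  move=> jk kP; rewrite (path_label hm zN sP jk kP); case: eqP => // kE.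
  by rewrite kE in kP; case: eqP => [->//|/eqP ji]; apply: L3.
have Kedge j : (j.+1 < size P)%N -> 1 <= K (x P j) (x P j.+1).
  by move=> jS; apply/edge_kappa/eP.
have k40 : 0 < kappa R 4 by apply: kappa_pos.
have k50 : 0 < kappa R 5 by apply: kappa_pos.
have k60 : 0 < kappa R 6 by apply: kappa_pos.
have := kappa4 R; have := kappa5 R; have := kappa6 R.
rewrite !expr2 => kap6 kap5 kap4.
have k53 : 3 / 2 <= kappa R 5.
  rewrite leNgt; apply/negP => lt.
  have : 0 < (3 / 2 - kappa R 5) * kappa R 5 by rewrite mulr_gt0 // subr_gt0.
  by rewrite mulrBl kap5; move: (kappa R 5) lt => k lt; lra.
set mu := m (x P i) (x P i.+1) in LP.
have [i0|i0] := eqVneq i 0%N.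
  have [n2|n2] := eqVneq (size P) 2%N.
    have mu0 : mu <> 0%N.
      (* An infinite label is the affine diagram of type A1, with null vector (1, 1). *)
      move=> mu0; apply: (@segment_weights P 0 2 [:: 1; 1] [:: 2]) => //.
      - by rewrite n2.
      - by case=> [|j] //= _; move: mu0; rewrite /mu i0 => ->; rewrite /kappa.
      - by case=> [|[|j]] //=.
      - by case=> [|[|j]] //= _; lra.
    have mu4 : (3 < mu)%N.
      by move: li; rewrite !labE -/mu => /orP[//|/eqP].
    have LP2 j k : (j < k)%N -> (k < size P)%N -> m (x P j) (x P k) = mu.
      move=> jk kP; rewrite LP // i0.
      by move: kP; rewrite n2; case: k j jk => [|[|k]] [|j].
    have [odd_mu|even_mu] := boolP (odd mu).
      constructor 3; exists P; split=> //; first by rewrite n2.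
      by apply: odd_listing cov _ => j k jk kP _; rewrite LP2.
    constructor 2; exists (I2 mu), P; split.
      by split=> // j k jk kP; rewrite LP2.
    by constructor 3; exists mu; rewrite ?even_mu.
  have n3 : (0 + 3 <= size P)%N by clear -n2 iS i0; simpl in *; lia.
  have no6 : ~~ lab 6 (x P i) (x P i.+1).
    apply/negP => l6.
    (* the null vector of the affine diagram of type G2 *)
    apply: (@segment_weights P 0 3 [:: kappa R 6; 2; 1] [:: kappa R 6; 1]) => //.
    - case=> [|[|j]] //= _; last exact: Kedge.
      by have := @lab_kappa R _ _ 6 _ _ isT l6; rewrite i0.
    - by case=> [|[|[|j]]] //=.
    - by case=> [|[|[|j]]] //= _; lra.
  have [mu4|mu5] : mu = 4 \/ mu = 5.
    move: li no6; rewrite !labE -/mu; clear; case: mu => [|[|[|[|[|[|]]]]]] //=;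
    by [left|right].
    constructor 1; exists (B_ (size P)), P; split; last by constructor 2; exists (size P).
    split=> // j k jk kP; rewrite LP // i0 mu4 /= !eqSS.
    by case: eqP.
  have [n3'|n3'] := eqVneq (size P) 3%N.
    constructor 2; exists H3, P; split; last by constructor 2.
    split=> // j k jk; rewrite n3' => k3; rewrite LP ?n3' // i0 mu5 /=.
    by move: jk k3; case: k j => [|[|[|k]]] [|[|j]].
  have [n4|n4] := eqVneq (size P) 4%N.
    constructor 3; exists P; split=> //; first by rewrite n4.
    apply: odd_listing cov _ => j k jk kP; rewrite /coxeter_edge /= LP //.
    by case: ifP => // _; case: ifP => // _ _; rewrite mu5.
  have n5 : (0 + 5 <= size P)%N by clear -n3 n3' n4; simpl in *; lia.
  (* This diagram is hyperbolic. At the second vertex the inequality is 8 <= 2 kappa(5)^2 + 3 = 2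
     kappa(5) + 5, which is [k53]. *)
  case: (@segment_weights P 0 5 [:: 2 * kappa R 5; 4; 3; 2; 1]
    [:: kappa R 5; 1; 1; 1]) => //.
  - case=> [|j] j5; first by move: mu5; rewrite /mu i0 /= => ->.
    rewrite (_ : nth _ _ _ = 1); last by case: j j5 => [|[|[|j]]].
    by apply: Kedge; clear -n5 j5; simpl in *; lia.
  - by case=> [|[|[|[|[|j]]]]] //= _; lra.
  - by case=> [|[|[|[|[|j]]]]] //= _; lra.
have n4 : (i.-1 + 4 <= size P)%N by clear -i0 iS ile; simpl in *; lia.
have i1 : i.-1.+1 = i by rewrite prednK // lt0n.
have no5 : ~~ lab 5 (x P i) (x P i.+1).
  apply/negP => l5.
  (* At the middle vertices the inequality is 4 <= 1 + 2 kappa(5), again from [k53]. *)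
  apply: (@segment_weights P i.-1 4 [:: 1; 2; 2; 1] [:: 1; kappa R 5; 1]) => //.
  - case=> [|[|[|j]]] //= _.
    + by rewrite addn0; apply: Kedge; rewrite i1; apply: ltnW.
    + by rewrite addn1 i1; apply: (lab_kappa _ _ l5).
    + by rewrite addn2 i1; apply: Kedge; clear -n4 i1; simpl in *; lia.
  - by case=> [|[|[|[|j]]]] //=.
  - by case=> [|[|[|[|j]]]] //= _; lra.
have mu4 : mu = 4.
  by move: li no5; rewrite !labE -/mu; clear; case: mu => [|[|[|[|[|]]]]].
have [n4'|n4'] := eqVneq (size P) 4%N.
  have i1' : i = 1%N by clear -n4' i0 iS ile; simpl in *; lia.
  constructor 4; exists P; split=> // j k jk k4; rewrite LP ?n4' // i1' mu4.
  by [].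
have n5 : (i.-1 + 5 <= size P)%N by clear -n4' i0 iS ile; simpl in *; lia.
(* the null vector of the affine diagram of type F4 *)
case: (@segment_weights P i.-1 5 [:: kappa R 4; 2 * kappa R 4; 3; 2; 1]
  [:: 1; kappa R 4; 1; 1]) => //.
- case=> [|[|j]] j5.
  + by rewrite addn0; apply: Kedge; rewrite i1; apply: ltnW.
  + by rewrite addn1 i1; apply: (lab_kappa _ _ li).
  rewrite (_ : nth _ _ _ = 1); last by case: j j5 => [|[|j]].
  by apply: Kedge; clear -n5 j5; simpl in *; lia.
- by case=> [|[|[|[|[|j]]]]] //= _; lra.
- by case=> [|[|[|[|[|j]]]]] //= _; lra.
Qed.

Lemma classification : classified.
Proof.
have [P lP] := longest_path_ex hm zN d.
have [[y [i bi]]|nb] := pselect (exists y i, branch P y i).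
  exact: branch_classified lP bi.
have cov : forall s, s \in P.
  by apply: (path_covers hm hirr lP) => y i bi; apply: nb; exists y, i.
have [[i [iS li]]|no4] := pselect (exists i, (i.+1 < size P)%N /\ lab 4 (x P i) (x P i.+1)).
  exact: (big_label_classified lP cov iS li).
have [sP P0 _] := lP; have [uP eP] := sP.
constructor 1; exists (A_ (size P)), P; split; last by constructor 1; exists (size P).
split=> // i j ij jP; rewrite (path_label hm zN sP ij jP) /= eqSS.
case: eqP => // jE; rewrite jE in jP.
apply: edge_label3; first exact: eP.
by apply/negP => l4; apply: no4; exists i.
Qed.

End ClassificationTheorem.

(** * Computing -1 *)

Section Determinant.
Variables (R : realType) (I : choiceType) (m : I -> I -> nat).
Local Notation G := (coxeter_group m).
Local Notation gen := (coxeter_gen m).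
Local Notation act := (@act R I m).
Local Notation root := (simple_root R).
Hypothesis hm : coxeter_matrix m.
Variable Y : seq (I : eqType).
Hypothesis uY : uniq Y.
Hypothesis covY : forall s, s \in Y.
Local Notation n := (size Y).
Let y (i : 'I_n) : I := tnth (in_tuple Y) i.
Let y_inj : injective y.
Proof. by move=> i j /tuple_uniqP; apply. Qed.
Let y_surj s : exists i, s = y i.
Proof. by have /tnthP := (covY s : s \in in_tuple Y). Qed.

Lemma freeg_sum_seq (v : {freeg I / R}) : v = \sum_i coeff (y i) v *: root (y i).
Proof.
apply/eqP/freeg_eqP => s; have [k ->] := y_surj s.
rewrite raddf_sum (bigD1 k) //= big1 => [|i ik]; rewrite coeffZ coeffU mul1r.
  by rewrite eqxx mulr1 addr0.
by rewrite (inj_eq y_inj) (negPf ik) mulr0.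
Qed.

Definition act_mx (x : G) : 'M[R]_n :=
  \matrix_(i, j) coeff (y i) (act x (root (y j))).

Lemma act_mxM x x' : act_mx (x * x')%g = act_mx x *m act_mx x'.
Proof.
apply/matrixP => i j; rewrite !mxE actM // {1}(freeg_sum_seq (act x' _)).
have -> : act x (\sum_k coeff (y k) (act x' (root (y j))) *: root (y k)) =
    \sum_k coeff (y k) (act x' (root (y j))) *: act x (root (y k)).
  elim/big_rec2: _ => [|k u v _ <-]; first by rewrite -(scale0r 0) actZ // !scale0r.
  by rewrite actD // actZ.
by rewrite raddf_sum; apply: eq_bigr => k _; rewrite /= coeffZ !mxE mulrC.
Qed.

Lemma det_act_gen s : \det (act_mx (gen s)) = -1.
Proof.
have [k ->] := y_surj s; set M := act_mx _.
have ME i j : M i j = (i == j)%:R - cform m (root (y j)) (root (y k)) * (k == i)%:R.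
  rewrite mxE act_gen // reflE coeffD coeffN coeffZ !coeffU !mul1r.
  by rewrite !(inj_eq y_inj) (eq_sym j i).
(* M differs from the identity only in row k, so both have the same cofactors along that row. *)
have -> : \det M = (M *m \adj (1%:M)) k k.
  rewrite (expand_det_row _ k) mxE; apply: eq_bigr => j _; congr (_ * _).
  rewrite [RHS]mxE /cofactor; congr (_ * \det _); apply/matrixP => a b.
  by rewrite 2![LHS]mxE ME 3![RHS]mxE (negPf (neq_lift _ _)) mulr0 subr0.
have := mul_mx_adj (1%:M : 'M[R]_n); rewrite mul1mx det1 => ->.
by rewrite mulmx1 ME eqxx cform_root_diag // !mulr1n; ring.
Qed.

(** The sign is the determinant of the action, since reflections have determinant -1. *)
Lemma parity_neg_one z (chi : G -> bool) : neg_one R z -> parity_spec chi -> chi z = odd n.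
Proof.
move=> zN [chiM chi1].
have detE x : \det (act_mx x) = (-1) ^+ (chi x).
  elim/(coxeter_ind hm): x => [|s x IHx].
    rewrite char1 // expr0 (_ : act_mx _ = 1%:M) ?det1 //.
    apply/matrixP => i j; rewrite !mxE act1 // coeffU mul1r (inj_eq y_inj).
    by rewrite eq_sym.
  by rewrite act_mxM det_mulmx IHx det_act_gen chiM chi1 addTb mulN1r signrN.
have := detE z; have -> : act_mx z = (-1)%:M.
  apply/matrixP => i j; rewrite !mxE zN coeffN coeffU mul1r (inj_eq y_inj).
  by rewrite eq_sym; case: eqP; rewrite ?oppr0.
by rewrite det_scalar -(signr_odd _ n) => e; apply/esym/(@signr_inj R).
Qed.

Lemma odd_and_even_char z (chi : G -> bool) : irreducible_coxeter m -> neg_one R z ->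
  ~~ odd n -> (forall s t, coxeter_edge m s t -> odd (m s t)) ->
  is_char chi -> chi z = false.
Proof.
move=> hirr zN evn oddm chiM; case: (pselect (exists s : I, True)) => [[s0 _]|nI];
    last first.
  by rewrite (_ : z = 1%g) ?char1 //; apply: (@act_faithful R _ _ hm) => s; case: nI; exists s.
have cst s : chi (gen s) = chi (gen s0).
  move: s; apply: (irreducible_ind hirr (s := s0)) => // s t st <-.
  have st0 : m s t <> 0%N by move=> st0; have := oddm _ _ st; rewrite st0.
  have := congr1 chi (coxeter_gen_rel st0); rewrite charX // char1 // oddm //=.
  by rewrite chiM; case: (chi (gen s)) (chi (gen t)) => [] [].
case E : (chi (gen s0)).
  rewrite (@parity_neg_one z chi zN); first exact/negbTE.
  by split=> // s; rewrite cst E.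
have chi0 x : chi x = false.
  by elim/(coxeter_ind hm): x => [|s x IHx]; rewrite ?char1 // chiM IHx cst E.
exact: chi0.
Qed.

End Determinant.

(** * Exact computation of the action in coordinates *)

Section Coordinates.
Variables (R : realType) (I : choiceType) (m : I -> I -> nat).
Local Notation G := (coxeter_group m).
Local Notation gen := (coxeter_gen m).
Local Notation act := (@act R I m).
Local Notation root := (simple_root R).
Hypothesis hm : coxeter_matrix m.
Variables (n : nat) (y : nat -> I) (lbl : nat -> nat -> nat).
Hypothesis y_surj : forall s, exists2 i, (i < n)%N & s = y i.
Hypothesis lblE : forall i j, (i < n)%N -> (j < n)%N -> m (y i) (y j) = lbl i j.

(* Exact computation in Z[th] with th^2 = p th + q; the pair (a, b) encodes   *)
(* a + b th.                                                                  *)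
Variables (th : R) (p q : int).
Hypothesis thE : th ^+ 2 = p%:~R * th + q%:~R.
Local Notation A := (int * int)%type.
Definition qeval (u : A) : R := u.1%:~R + u.2%:~R * th.
Definition qadd (u v : A) : A := (u.1 + v.1, u.2 + v.2).
Definition qopp (u : A) : A := (- u.1, - u.2).
Definition qmul (u v : A) : A :=
  (u.1 * v.1 + q * (u.2 * v.2), u.1 * v.2 + u.2 * v.1 + p * (u.2 * v.2)).

Lemma qevalD u v : qeval (qadd u v) = qeval u + qeval v.
Proof. by rewrite /qeval /= !intrD; ring. Qed.

Lemma qevalN u : qeval (qopp u) = - qeval u.
Proof. by rewrite /qeval /= !intrN; ring. Qed.

Lemma qevalM u v : qeval (qmul u v) = qeval u * qeval v.
Proof.
rewrite /qeval /= !intrD !intrM.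
have -> : forall a b c d : R, (a + b * th) * (c + d * th) =
  a * c + (a * d + b * c) * th + b * d * th ^+ 2 by move=> *; ring.
by rewrite thE; ring.
Qed.

Variable kz : nat -> A.
Hypothesis kzE : forall i j, (i < n)%N -> (j < n)%N ->
  qeval (kz (lbl i j)) = kappa R (lbl i j).

(** A reflection changes one coordinate only; the term j = i, where [kappa] is -2, turns l_i into
    -l_i. *)
Definition coord_refl (i : nat) (l : seq A) : seq A :=
  set_nth (0, 0) l i (foldr qadd (nth (0, 0) l i)
    [seq qmul (nth (0, 0) l j) (kz (lbl j i)) | j <- iota 0 n]).

Definition coord_vec (l : seq A) : {freeg I / R} :=
  \sum_(0 <= j < n) qeval (nth (0, 0) l j) *: root (y j).

Lemma coord_vecE l : coord_vec l =
  \sum_(j <- iota 0 n) qeval (nth (0, 0) l j) *: root (y j).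
Proof. by rewrite /coord_vec /index_iota subn0. Qed.

Lemma coord_reflE i l : (i < n)%N ->
  refl m (y i) (coord_vec l) = coord_vec (coord_refl i l).
Proof.
move=> iN; have foldE (a : A) r : qeval (foldr qadd a r) = qeval a + \sum_(u <- r) qeval u.
  elim: r => [|u r IHr] /=; first by rewrite big_nil addr0.
  by rewrite qevalD IHr big_cons; ring.
set b := \sum_(j <- iota 0 n) qeval (nth (0, 0) l j) * kappa R (lbl j i).
have bE : cform m (coord_vec l) (root (y i)) = - b.
  have sumE (r : seq nat) : all (fun j => j < n)%N r ->
      cform m (\sum_(j <- r) qeval (nth (0, 0) l j) *: root (y j)) (root (y i)) =
      - \sum_(j <- r) qeval (nth (0, 0) l j) * kappa R (lbl j i).
    elim: r => [_|j r IHr /= /andP[jn rn]].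
      by rewrite !big_nil oppr0 -(scale0r 0) cformE mul0r.
    by rewrite !big_cons !cformE IHr // cform_root lblE //; ring.
  by rewrite coord_vecE sumE //; apply/allP => j; rewrite mem_iota.
have newE : qeval (nth (0, 0) (coord_refl i l) i) = qeval (nth (0, 0) l i) + b.
  rewrite /coord_refl nth_set_nth /= eqxx foldE big_map; congr (_ + _).
  rewrite /b !big_seq; apply: eq_bigr => j; rewrite mem_iota => /andP[_ jn].
  by rewrite qevalM kzE.
have oldE j : j != i -> nth (0, 0) (coord_refl i l) j = nth (0, 0) l j.
  by move=> ji; rewrite /coord_refl nth_set_nth /= (negPf ji).
rewrite reflE bE !coord_vecE !(bigD1_seq i) ?iota_uniq ?mem_iota //= newE.
rewrite [in RHS](eq_bigr (fun j => qeval (nth (0, 0) l j) *: root (y j))); last first.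
  by move=> j ji; rewrite oldE.
by move: (\sum_(_ <- _ | _) _) => w; by_coeff.
Qed.

Lemma coord_act w l : all (fun i => i < n)%N w ->
  act (gen_prod m [seq y i | i <- w]) (coord_vec l) = coord_vec (foldr coord_refl l w).
Proof.
move=> wn; rewrite act_prod //; elim: w wn => //= i w IHw /andP[iN wn].
by rewrite IHw // coord_reflE.
Qed.

Definition coord_basis (j : nat) : seq A := [seq ((i == j)%:Z, 0 : int) | i <- iota 0 n].

Lemma coord_neg_one w : all (fun i => i < n)%N w ->
  all (fun j => foldr coord_refl (coord_basis j) w == map qopp (coord_basis j))
    (iota 0 n) -> neg_one R (gen_prod m [seq y i | i <- w]).
Proof.
move=> wn /allP chk; apply: neg_one_root => // s.
have [j jn ->] := y_surj s.
have nthB i : (i < n)%N -> nth (0, 0) (coord_basis j) i = ((i == j)%:Z, 0 : int).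
  by move=> iN; rewrite (nth_map 0%N) ?size_iota // nth_iota.
have basisE : root (y j) = coord_vec (coord_basis j).
  rewrite coord_vecE (bigD1_seq j) ?iota_uniq ?mem_iota //= big_seq_cond big1.
    by rewrite nthB // eqxx /qeval /= mul0r !addr0 scale1r.
  move=> i /andP[]; rewrite mem_iota => /andP[_ iN] ij.
  by rewrite nthB // (negPf ij) /qeval /= mul0r addr0 scale0r.
rewrite [in LHS]basisE coord_act // (eqP (chk j _)) ?mem_iota // basisE !coord_vecE.
rewrite -sumrN !big_seq; apply: eq_bigr => i; rewrite mem_iota => /andP[_ iN].
rewrite (nth_map (0, 0)) ?size_map ?size_iota // qevalN scaleNr //.
Qed.

End Coordinates.

(** * Morphisms given by roots *)

Section Intertwine.
Variables (R : realType) (I J : choiceType) (m : I -> I -> nat) (m' : J -> J -> nat).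
Hypotheses (hm : coxeter_matrix m) (hm' : coxeter_matrix m').
Variables (phi : {multiplicative coxeter_group m -> coxeter_group m'}).
Variable beta : I -> {freeg J / R}.
Hypothesis phi_refl : forall s u,
  act (phi (coxeter_gen m s)) u = u - cform m' u (beta s) *: beta s.
Hypothesis beta_form : forall s t, cform m' (beta s) (beta t) = - kappa R (m s t).

(** On generators this is the equality of the Gram matrices of the [beta s] and of the simple
    roots. *)
Lemma intertwine x v : act (phi x) (fglift beta v) = fglift beta (act x v).
Proof.
elim/(coxeter_ind hm): x v => [|s x IHx] v; first by rewrite multiplicative1 !act1.
rewrite gmulfM !actM // IHx phi_refl act_gen // reflE.
rewrite fgliftD -!scaleNr fgliftZ fgliftU; congr (_ + - _ *: _).
elim/freeg_ind_lin: (act x v) => [|u w IHu IHw|c t].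
- by rewrite fglift0 !cform0l.
- by rewrite fgliftD !cformE IHu IHw.
- by rewrite fgliftZ fgliftU !cformE beta_form cform_root.
Qed.

End Intertwine.

Lemma bij_multiplicative (G H : groupType) (f : {multiplicative G -> H}) g :
  cancel f g -> cancel g f -> {morph g : x y / (x * y)%g}.
Proof. by move=> fK gK x y; apply: (can_inj fK); rewrite gK gmulfM !gK. Qed.

Section DiagramIso.
Variables (R : realType) (I J : choiceType) (m : I -> I -> nat) (m' : J -> J -> nat).
Hypotheses (hm : coxeter_matrix m) (hm' : coxeter_matrix m').
Variables (sg : I -> J) (sg' : J -> I).
Hypotheses (sgK : cancel sg sg') (sgK' : cancel sg' sg).
Hypothesis sgE : forall s t, m' (sg s) (sg t) = m s t.

Lemma diagram_iso : exists phi : {multiplicative coxeter_group m -> coxeter_group m'},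
  bijective phi /\ forall z, neg_one R z -> neg_one R (phi z).
Proof.
have [|phi phiE] := coxeter_hom hm (f := fun s => coxeter_gen m' (sg s)).
  by move=> s t st; rewrite -sgE coxeter_gen_rel // sgE.
have [|psi psiE] := coxeter_hom hm' (f := fun s => coxeter_gen m (sg' s)).
  move=> s t st; have E : m (sg' s) (sg' t) = m' s t by rewrite -sgE !sgK'.
  by rewrite -E coxeter_gen_rel // E.
exists phi; split.
  exists psi => x.
    elim/(coxeter_ind hm): x => [|s x IHx]; first by rewrite !multiplicative1.
    by rewrite !gmulfM IHx phiE psiE sgK.
  elim/(coxeter_ind hm'): x => [|s x IHx]; first by rewrite !multiplicative1.
  by rewrite !gmulfM IHx psiE phiE sgK'.
move=> z zN; apply: neg_one_root => // s.
have rE t : fglift (fun s => simple_root R (sg s)) (simple_root R t) = simple_root R (sg t).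
  exact: fgliftU.
rewrite -(sgK' s) -rE intertwine // => [|t u|t u].
- by rewrite zN -!(scaleN1r (_ : {freeg _ / R})) fgliftZ.
- by rewrite phiE act_gen // reflE.
- by rewrite cform_root sgE.
Qed.

End DiagramIso.

(* A direct complement of {1, -1} is the kernel of a character [chi].         *)
Definition centered (R : realType) (I : choiceType) (m : I -> I -> nat) :=
  exists z : coxeter_group m, neg_one R z /\
    exists chi : coxeter_group m -> bool, is_char chi /\ chi z.

Definition type_label T a b : nat :=
  if a == b then 1%N else edge_label T (minn a b).+1 (maxn a b).+1.

Lemma type_matrixE T (i j : 'I_(rank T)) : type_matrix i j = type_label T i j.
Proof. by []. Qed.

Lemma type_labelC T a b : type_label T a b = type_label T b a.
Proof. by rewrite /type_label eq_sym minnC maxnC. Qed.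

Lemma type_label_lt T a b : (a < b)%N -> type_label T a b = edge_label T a.+1 b.+1.
Proof.
move=> ab; rewrite /type_label (minn_idPl (ltnW ab)) (maxn_idPr (ltnW ab)).
by rewrite ltn_eqF.
Qed.

Lemma lists_iso (R : realType) (I : choiceType) (m : I -> I -> nat) d T Y :
  coxeter_matrix m -> lists m d T Y -> T <> I2 1 -> centered R m ->
  group_isomorphic (coxeter_group m) (coxeter_group_of T) /\
  centered R (@type_matrix T).
Proof.
move=> hm [uY cov sY lE] T1 [z [zN [chi [chiM chiz]]]].
have hT := type_coxeter_matrix T1.
have ltY s : (index s Y < rank T)%N by rewrite -sY index_mem.
have labE i j : (i < rank T)%N -> (j < rank T)%N ->
    m (nth d Y i) (nth d Y j) = type_label T i j.
  rewrite -sY => iY jY; case: (ltngtP i j) => [ij|ji|<-].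
  - by rewrite type_label_lt // lE.
  - by rewrite type_labelC type_label_lt // (proj1 hm) lE.
  - by rewrite /type_label eqxx (proj2 ((proj2 hm) _ _) erefl).
have [||| phi [bphi phiN]] := @diagram_iso R I _ m (@type_matrix T) hm hT
  (fun s => Ordinal (ltY s)) (fun i : 'I_(rank T) => nth d Y i).
- by move=> s /=; rewrite nth_index.
- by move=> i; apply/val_inj; rewrite /= index_uniq ?sY.
- by move=> s t; rewrite type_matrixE /= -labE // !nth_index.
split; first by exists phi.
exists (phi z); split; first exact: phiN.
have [g gK Kg] := bphi; exists (chi \o g); split=> [x y|] /=.
  by rewrite (bij_multiplicative gK Kg) chiM.
by rewrite gK.
Qed.

(** * Reflection subgroups of index 2 *)

Section Fold.
Variables (R : realType) (I : choiceType) (m m' : I -> I -> nat) (o e : I) (k : nat).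
Hypotheses (hm : coxeter_matrix m) (hm' : coxeter_matrix m').
Hypotheses (oe : o != e) (k1 : (1 < k)%N).
Hypotheses (m_oe : m o e = (2 * k)%N) (m'_oe : m' o e = k).
Hypothesis m_o : forall t, t != o -> t != e -> m o t = 2.
Hypothesis m'_o : forall t, t != o -> t != e -> m' o t = m e t.
Hypothesis m'_rest : forall s t, s != o -> t != o -> m' s t = m s t.
Local Notation gen := (coxeter_gen m).
Local Notation root := (simple_root R).
Local Notation V := {freeg I / R}.

(* The reflections in s_o(a_e), a_e and the other simple roots generate a     *)
(* subgroup of index 2 with Coxeter matrix [m'].                              *)
Definition fold_gen (s : I) : coxeter_group m :=
  if s == o then (gen o * gen e * gen o)%g else gen s.

Let m_sym s t : m s t = m t s. Proof. by apply/(proj1 hm). Qed.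
Let m'_sym s t : m' s t = m' t s. Proof. by apply/(proj1 hm'). Qed.
Let m_diag s : m s s = 1%N. Proof. by apply/(proj2 hm). Qed.
Let m'_diag s : m' s s = 1%N. Proof. by apply/(proj2 hm'). Qed.

Let gen_o_comm t : t != o -> t != e -> (gen o * gen t = gen t * gen o)%g.
Proof.
move=> to te; have ot0 : m o t <> 0%N by rewrite m_o.
have := coxeter_gen_rel ot0; rewrite m_o // expg2 => E.
by have := mulg1_eq E; rewrite invgM !coxeter_genV // => ->.
Qed.

Let conj_expg (x y : coxeter_group m) n : (x * x = 1)%g ->
  ((x * y * x) ^+ n = x * y ^+ n * x)%g.
Proof.
move=> xx; elim: n => [|n IHn]; first by rewrite !expg0 mulg1 xx.
by rewrite !expgS IHn !mulgA -(mulgA (x * y)%g) xx mulg1.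
Qed.

(** For [t = e] the product is (s_o s_e)^2. For the other t, s_o commutes with s_t, so the product
    is the conjugate of s_e s_t by s_o. *)
Let fold_rel_o t : m' o t <> 0%N -> ((fold_gen o * fold_gen t) ^+ m' o t = 1)%g.
Proof.
move=> ot0; rewrite {1}/fold_gen eqxx; have [-> |to] := eqVneq t o.
  rewrite m'_diag expg1 /fold_gen eqxx !mulgA coxeter_mulgenK //.
  by rewrite !(coxeter_mulgenK, coxeter_gen_sq).
rewrite /fold_gen (negPf to); have [->|te] := eqVneq t e.
  rewrite m'_oe -!mulgA mulgA -expg2 -expgnA -m_oe coxeter_gen_rel // m_oe.
  by apply/eqP; rewrite muln_eq0 -lt0n; case: (k) k1.
rewrite -mulgA (gen_o_comm to te) mulgA -(mulgA (gen o)) conj_expg; last exact: coxeter_gen_sq.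
rewrite m'_o // coxeter_gen_rel -?m'_o // mulg1; exact: coxeter_gen_sq.
Qed.

Lemma fold_hom : exists phi : {multiplicative coxeter_group m' -> coxeter_group m},
  forall s, phi (coxeter_gen m' s) = fold_gen s.
Proof.
apply: coxeter_hom => // s t st; have [so|so] := eqVneq s o.
  by rewrite so; apply: fold_rel_o; rewrite -so.
have [to|to] := eqVneq t o; last first.
  by rewrite /fold_gen (negPf so) (negPf to) m'_rest // coxeter_gen_rel // -m'_rest.
rewrite to in st *; have := fold_rel_o (t := s); rewrite m'_sym => /(_ st) E.
have fK u : ((fold_gen u)^-1 = fold_gen u)%g.
  rewrite /fold_gen; case: ifP => _; rewrite ?invgM ?coxeter_genV // mulgA //.
have -> : (fold_gen s * fold_gen o = (fold_gen o * fold_gen s)^-1)%g.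
  by rewrite invgM !fK.
by rewrite expVgn E invg1.
Qed.

Definition fold_root (s : I) : V := if s == o then refl m o (root e) else root s.

(** The decisive value, at (o, e), is 2 - kappa(2k)^2 = - kappa(k), by [kappa_double]. *)
Lemma fold_root_form s t : cform m (fold_root s) (fold_root t) = - kappa R (m' s t).
Proof.
have form_o u : cform m (fold_root o) (fold_root u) = - kappa R (m' o u).
  rewrite {1}/fold_root eqxx /fold_root; have [->|uo] := eqVneq u o.
    by rewrite cform_refl // cform_root_diag // m'_diag kappa1; ring.
  rewrite reflE !cformE !cform_root (m_sym e o) m_oe; have [->|ue] := eqVneq u e.
    rewrite m'_oe m_oe m_diag kappa1; have := @kappa_double R k.
    by move=> /(_ (ltnW k1)); rewrite expr2; lra.
  by rewrite m_o // kappa2 m'_o //; ring.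
have [->|so] := eqVneq s o; first exact: form_o.
have [->|to] := eqVneq t o; first by rewrite cformC // form_o m'_sym.
by rewrite /fold_root (negPf so) (negPf to) cform_root m'_rest.
Qed.

Lemma fold_act (phi : {multiplicative coxeter_group m' -> coxeter_group m}) :
  (forall s, phi (coxeter_gen m' s) = fold_gen s) ->
  forall x v, act (phi x) (fglift fold_root v) = fglift fold_root (act x v).
Proof.
move=> phiE; apply: intertwine => //; last exact: fold_root_form.
move=> s u; rewrite phiE /fold_gen /fold_root; case: eqP => _; last first.
  by rewrite act_gen // reflE.
rewrite !actM // !act_gen // [refl m e _]reflE reflD -scaleNr reflZ reflK //.
rewrite scaleNr; congr (_ - _ *: _).
by rewrite -{1}(reflK hm o (root e)) cform_refl.
Qed.

Let kap_pos : 0 < kappa R (2 * k).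
Proof. by apply: kappa_pos; clear -k1; lia. Qed.

(** The map is triangular: it sends root o to root e + kappa(2k) root o, with kappa(2k) > 0, and
    fixes the other roots. *)
Lemma fold_lift_inj : injective (fglift fold_root).
Proof.
have LE v : fglift fold_root v =
    v + coeff o v *: (root e + (kappa R (2 * k) - 1) *: root o).
  elim/freeg_ind_lin: v => [|u w IHu IHw|c s].
  - by rewrite fglift0 coeff0 scale0r addr0.
  - rewrite fgliftD IHu IHw coeffD; by_coeff.
  - rewrite fgliftZ fgliftU coeffZ coeffU /fold_root.
    have [->|so] := eqVneq s o; last by rewrite mulr0n !mulr0 scale0r addr0.
    rewrite reflE cform_root m_sym m_oe /simple_root mulr1n; by_coeff.
move=> u v; rewrite !LE => /eqP/freeg_eqP uv.
have uvo : coeff o u = coeff o v.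
  have := uv o; rewrite !(coeffD, coeffZ) !coeffU eqxx eq_sym (negPf oe).
  rewrite mulr0n mulr1n !mul1r !add0r !mulr1 !mulrBr !mulr1.
  rewrite ![_ + (_ - _)]addrC !subrK => /mulIf; apply; exact: lt0r_neq0.
apply/eqP/freeg_eqP => i; have := uv i; rewrite !coeffD !coeffZ uvo.
exact: addIr.
Qed.

Lemma fold_inj (phi : {multiplicative coxeter_group m' -> coxeter_group m}) :
  (forall s, phi (coxeter_gen m' s) = fold_gen s) -> injective phi.
Proof.
move=> phiE x y xy; apply: (@act_inj R _ _ hm') => s; apply: fold_lift_inj.
by rewrite -!(fold_act phiE) xy.
Qed.

(** The folded roots span V, since root o is recovered after division by kappa(2k). *)
Lemma fold_neg_one (phi : {multiplicative coxeter_group m' -> coxeter_group m}) z :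
  (forall s, phi (coxeter_gen m' s) = fold_gen s) -> neg_one R z -> neg_one R (phi z).
Proof.
move=> phiE zN; apply: neg_one_root => //.
have zL v : act (phi z) (fglift fold_root v) = - fglift fold_root v.
  by rewrite (fold_act phiE) zN -!scaleN1r fgliftZ.
have rootE s : s != o -> root s = fglift fold_root (root s).
  by move=> so; rewrite fgliftU /fold_root (negPf so).
move=> s; have [->|so] := eqVneq s o; last by rewrite rootE.
have oE : root o = (kappa R (2 * k))^-1 *: fglift fold_root (root o - root e).
  rewrite fgliftD -scaleN1r fgliftZ -(rootE e) 1?eq_sym // fgliftU /fold_root eqxx.
  rewrite reflE cform_root m_sym m_oe; apply/eqP/freeg_eqP => i.
  by rewrite !(coeffZ, coeffD, coeffN); field; apply: lt0r_neq0.
by rewrite oE actZ // zL scalerN.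
Qed.

(** All labels between o and another vertex are even, so o may have a value of its own. *)
Lemma fold_char : exists chi : coxeter_group m -> bool,
  is_char chi /\ forall s, chi (gen s) = (s == o).
Proof.
apply: coxeter_char => // s t; have [->|so] := eqVneq s o; have [->|to] := eqVneq t o => //.
  have [->|te] := eqVneq t e; first by rewrite m_oe oddM.
  by rewrite m_o.
rewrite m_sym; have [->|se] := eqVneq s e; first by rewrite m_oe oddM.
by rewrite m_o.
Qed.

Lemma fold_char0 chi (phi : {multiplicative coxeter_group m' -> coxeter_group m}) :
  is_char chi -> (forall s, chi (gen s) = (s == o)) ->
  (forall s, phi (coxeter_gen m' s) = fold_gen s) -> forall x, chi (phi x) = false.
Proof.
move=> chiM chi_gen phiE; apply: (coxeter_ind hm') => [|s x IHx].
  by rewrite multiplicative1 char1.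
rewrite gmulfM chiM IHx phiE /fold_gen; case: eqP => [_|/eqP/negPf so].
  by rewrite !chiM !chi_gen eqxx eq_sym (negPf oe).
by rewrite chi_gen so.
Qed.

(** Conjugation by s_o exchanges the images of o and e and fixes the other ones, so the image of
    [phi] and its coset by s_o exhaust the group. *)
Lemma fold_coset (phi : {multiplicative coxeter_group m' -> coxeter_group m}) x :
  (forall s, phi (coxeter_gen m' s) = fold_gen s) ->
  exists y (b : bool), x = (phi y * gen o ^+ b)%g.
Proof.
move=> phiE; have eo : e != o by rewrite eq_sym.
have norm y : exists y', (gen o * phi y = phi y' * gen o)%g.
  elim/(coxeter_ind hm'): y => [|s y [y' IHy]].
    by exists 1%g; rewrite !multiplicative1 mulg1 mul1g.
  suff [t tE] : exists t, (gen o * phi (coxeter_gen m' s) = phi (coxeter_gen m' t) * gen o)%g.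
    by exists (coxeter_gen m' t * y')%g; rewrite !gmulfM mulgA tE -!mulgA IHy.
  rewrite phiE /fold_gen; have [_|so] := eqVneq s o.
    by exists e; rewrite phiE /fold_gen (negPf eo) -!mulgA coxeter_genK.
  have [->|se] := eqVneq s e.
    by exists o; rewrite phiE /fold_gen eqxx coxeter_mulgenK.
  by exists s; rewrite phiE /fold_gen (negPf so) gen_o_comm.
elim/(coxeter_ind hm): x => [|s x [y [b ->]]].
  by exists 1%g, false; rewrite multiplicative1 expg0 mulg1.
have [->|so] := eqVneq s o; last first.
  by exists (coxeter_gen m' s * y)%g, b; rewrite gmulfM phiE /fold_gen (negPf so) mulgA.
have [y' y'E] := norm y; exists y', (~~ b).
rewrite mulgA y'E -mulgA; case: b => /=; rewrite ?expg1 ?expg0 ?mulg1 //.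
by rewrite coxeter_gen_sq // mulg1.
Qed.

End Fold.

(** * The finite types *)

Section Types.
Variable R : realType.

Lemma type_label_A n a b : (a < b)%N ->
  type_label (A_ n) a b = if b == a.+1 then 3 else 2.
Proof. by move=> ab; rewrite type_label_lt. Qed.

Lemma type_label_B n a b : (a < b)%N ->
  type_label (B_ n) a b = if b == a.+1 then if a == 0 then 4 else 3 else 2.
Proof. by move=> ab; rewrite type_label_lt. Qed.

Lemma type_label_D n a b : (a < b)%N -> type_label (D_ n) a b =
  if (b == 2) && (a < 2)%N || (2 <= a)%N && (b == a.+1) then 3 else 2.
Proof.
move=> ab; rewrite type_label_lt //= !inE !xpair_eqE /= !eqSS.
by case: a b ab => [|[|a]] [|[|[|b]]].
Qed.

Section Ordinals.
Variables (n : nat) (n0 : (0 < n)%N).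
Definition node (i : nat) : 'I_n := insubd (Ordinal n0) i.

Lemma node_val i : (i < n)%N -> node i = i :> nat.
Proof. by move=> iN; rewrite val_insubd iN. Qed.

Lemma nodeK (i : 'I_n) : node i = i.
Proof. by apply/val_inj; rewrite /= node_val. Qed.

Lemma node_eq i j : (i < n)%N -> (j < n)%N -> (node i == node j) = (i == j).
Proof. by move=> iN jN; rewrite -val_eqE /= !node_val. Qed.

End Ordinals.

(** Each vertex but the first has a neighbour of smaller height h, hence descends to the first
    one. *)
Lemma type_irreducible T (T0 : (0 < rank T)%N) (h : nat -> nat) :
  (forall b, (b < rank T)%N -> b <> 0%N ->
     exists a, [/\ (a < rank T)%N, (h a < h b)%N & (2 < type_label T a b)%N]) ->
  irreducible_coxeter (@type_matrix T).
Proof.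
move=> par; pose e := coxeter_edge (@type_matrix T).
have eC : symmetric e.
  by move=> i j; rewrite /e /coxeter_edge /= !type_matrixE type_labelC.
have con0 k b : (h b <= k)%N -> (b < rank T)%N -> connect e (node T0 0) (node T0 b).
  elim: k b => [|k IHk] b hb bT; have [->|/eqP b0] := eqVneq b 0%N;
    try exact: connect0; have [a [aT ab lab3]] := par b bT b0.
    by move: hb ab; rewrite leqn0 => /eqP ->.
  apply: connect_trans (IHk a _ aT) (connect1 _).
    by rewrite -ltnS; apply: leq_trans ab hb.
  by rewrite /e /coxeter_edge /= type_matrixE !node_val // lab3 orbT.
move=> i j; apply/connectP; apply: (@connect_trans _ _ (node T0 0)).
  by rewrite (sym_connect_sym eC) -(nodeK T0 i) (con0 (h i)).
by rewrite -(nodeK T0 j) (con0 (h j)).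
Qed.

Section TypeB.
Variables (n : nat) (n1 : (1 < n)%N).
Local Notation m := (@type_matrix (B_ n)).
Let hm : coxeter_matrix m. Proof. exact: type_coxeter_matrix. Qed.
Local Notation y := (node (ltnW n1) : nat -> 'I_(rank (B_ n))).
Local Notation q := (kappa R 4).
Local Notation root := (simple_root R).

Let mE i j : (i < n)%N -> (j < n)%N -> m (y i) (y j) = type_label (B_ n) i j.
Proof. by move=> iN jN; rewrite type_matrixE !node_val. Qed.

(* The orthonormal basis permuted up to sign by the group. *)
Fixpoint ortho (j : nat) : {freeg 'I_(rank (B_ n)) / R} :=
  if j is j'.+1 then ortho j' + root (y j) else (q / 2) *: root (y 0%N).

Let qq : q * q = 2. Proof. by rewrite -expr2 kappa4. Qed.

Let qh : q / 2 * q = 1. Proof. by rewrite mulrAC qq divff // pnatr_eq0. Qed.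

Lemma ortho_form j i : (j < n)%N -> (i < n)%N ->
  cform m (ortho j) (root (y i)) =
    if i == 0%N then if j == 0%N then q else 0
    else if j == i then 1 else if j.+1 == i then -1 else 0.
Proof.
move=> jN iN; elim: j jN => [jN|j IHj jN].
  rewrite /= cformE cform_root mE //; case: i iN => [|i] iN.
    by rewrite /type_label /= kappa1; lra.
  rewrite type_label_B //= eqSS; rewrite (eq_sym 1%N) eqSS.
  by case: eqP => _; rewrite /= ?mulrN ?qh // kappa2 mulr0 oppr0.
rewrite [ortho _]/= cformE IHj ?(ltnW jN) // cform_root mE //.
case: (ltngtP j.+1 i) {IHj} => [ji|ij|<-].
- rewrite type_label_B //; case: i ji {iN} => // i ji.
  rewrite (_ : (j == i.+1) = false) /=; last by rewrite ltn_eqF // ltnW.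
  by rewrite !eqSS (eq_sym i); case: eqP => _; rewrite ?kappa3 ?kappa2; ring.
- rewrite type_labelC type_label_B //.
  case: i ij {iN} => [_|i ij].
    by rewrite /= eqSS; case: (j) => [|j'] /=; rewrite ?kappa2; ring.
  rewrite (_ : (j.+2 == i.+1) = false) /=; last by rewrite gtn_eqF // ltnW // ltnW.
  by rewrite eqSS; case: eqP => _; rewrite ?kappa3 ?kappa2; ring.
- by rewrite /type_label eqxx kappa1 /= ltn_eqF //; ring.
Qed.

Lemma refl_ortho j i : (j < n)%N -> (i < n)%N -> refl m (y i) (ortho j) =
  if i == 0%N then if j == 0%N then - ortho 0 else ortho j
  else if j == i then ortho i.-1 else if j.+1 == i then ortho i else ortho j.
Proof.
move=> jN iN; rewrite reflE ortho_form //; case: i iN => [|i] iN /=.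
  case: eqP => [->|_]; last by rewrite scale0r subr0.
  by apply/eqP/freeg_eqP => a; rewrite /= !(coeffD, coeffN, coeffZ); field.
case: eqP => [->|_]; first by rewrite scale1r addrK.
rewrite eqSS; case: eqP => [->|_]; last by rewrite scale0r subr0.
by rewrite scaleN1r opprK.
Qed.

Local Notation G := (coxeter_group m).

Fixpoint coxeter_elt (k : nat) : G :=
  if k is k'.+1 then (coxeter_elt k' * coxeter_gen m (y k'))%g else 1%g.

Local Arguments ortho : simpl never.
Local Arguments coxeter_elt : simpl never.

Lemma coxeter_eltS k : coxeter_elt k.+1 = (coxeter_elt k * coxeter_gen m (y k))%g.
Proof. by []. Qed.

Lemma coxeter_elt_ortho k j : (k <= n)%N -> (j < n)%N -> act (coxeter_elt k) (ortho j) =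
  if (j < k)%N then if j.+1 == k then - ortho 0 else ortho j.+1 else ortho j.
Proof.
elim: k j => [|k IHk] j kN jN; first by rewrite act1.
rewrite coxeter_eltS actM // act_gen // refl_ortho // !ltnS eqSS.
case: k kN IHk => [|k] kN IHk /=.
  by rewrite leqn0; case: eqP => [_|_]; rewrite ?actN // act1.
case: (ltngtP j k.+1) => [jk|jk|_] /=.
- rewrite eqSS; case: eqP => [->|jk'].
    by rewrite IHk ?(ltnW kN) // ltnn.
  rewrite IHk ?(ltnW kN) // jk eqSS; case: eqP => [//|_].
  by [].
- rewrite eqSS; case: eqP => [jk'|_]; first by move: jk; rewrite -jk' ltnNge leqnSn.
  by rewrite IHk ?(ltnW kN) // ltnNge (ltnW jk).
- by rewrite IHk ?(ltnW kN) ?ltnSn ?eqxx // ltnW.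
Qed.

Lemma coxeter_eltX_ortho a j : (j + a < n)%N ->
  act (coxeter_elt n ^+ a)%g (ortho j) = ortho (j + a).
Proof.
elim: a => [|a IHa] jN; first by rewrite expg0 act1 // addn0.
rewrite addnS in jN *; rewrite expgS actM // IHa ?(ltnW jN) //.
by rewrite coxeter_elt_ortho ?(ltnW jN) // (ltn_eqF jN).
Qed.

(** The Coxeter element is a signed cycle of the orthonormal basis: e_0 to e_1 and so on, and
    e_(n-1) to -e_0. *)
Lemma coxeter_elt_B_neg_one : neg_one R (coxeter_elt n ^+ n)%g.
Proof.
have ortho_neg j : (j < n)%N -> act (coxeter_elt n ^+ n)%g (ortho j) = - ortho j.
  (* Of the n steps, n - j - 1 lead to the last vector, one more to -e_0, and j bring it back to
     place j. *)
  move=> jN; have nE : n = (j + (n - j).-1.+1)%N by rewrite prednK ?subnKC ?subn_gt0 ?(ltnW jN).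
  have -> : (coxeter_elt n ^+ n = coxeter_elt n ^+ j * coxeter_elt n ^+ (n - j).-1.+1)%g.
    by rewrite -expgnDr -nE.
  rewrite actM // expgS actM // coxeter_eltX_ortho; last first.
    by rewrite -ltnS -addnS -nE.
  have lE : (j + (n - j).-1).+1 = n by rewrite -addnS -nE.
  rewrite coxeter_elt_ortho //; last by rewrite -ltnS lE.
  rewrite lE leqnn eqxx actN // coxeter_eltX_ortho ?add0n //.
apply: neg_one_root => // s; rewrite -(nodeK (ltnW n1) s); case: (val s) (ltn_ord s) => [|i] iN.
  have -> : root (y 0%N) = q *: ortho 0 by rewrite /ortho scalerA mulrC qh scale1r.
  by rewrite actZ // ortho_neg // scalerN.
have -> : root (y i.+1) = ortho i.+1 - ortho i by rewrite [ortho i.+1]addrC addrK.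
by rewrite actD // actN // !ortho_neg ?(ltnW iN) // [RHS]opprD.
Qed.

Lemma parity_coxeter_elt chi k : parity_spec chi -> chi (coxeter_elt k) = odd k.
Proof.
move=> [chiM chi1]; elim: k => [|k IHk]; first by rewrite char1.
by rewrite coxeter_eltS chiM IHk chi1 addbT.
Qed.

End TypeB.

Section TypeI2.
Variable k : nat.
Hypothesis k1 : (0 < k)%N.
Local Notation m := (@type_matrix (I2 (2 * k))).
Let hm : coxeter_matrix m. Proof. by apply: type_coxeter_matrix => -[]; lia. Qed.
Local Notation y := (node (isT : (0 < 2)%N) : nat -> 'I_(rank (I2 (2 * k)))).

(** Half of the braid relation is the rotation by pi: [chebU] is 0 at 2k and -1 at 2k + 1. *)
Lemma coxeter_elt_I2_neg_one :
  neg_one R ((coxeter_gen m (y 0%N) * coxeter_gen m (y 1%N)) ^+ k)%g.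
Proof.
have half s t : s != t -> m s t = (2 * k)%N ->
    act ((coxeter_gen m s * coxeter_gen m t) ^+ k)%g (simple_root R s) = - simple_root R s.
  move=> st mst; have := alt_prod m s t (k + k).
  rewrite addnn odd_double /= doubleK mul1g => <-.
  rewrite act_prod // alt_word_root // odd_double mst -mul2n.
  by rewrite chebU_kappa_Sn ?chebU_kappa_n ?scale0r ?addr0 ?scaleN1r //; lia.
have ne : y 0%N != y 1%N by rewrite node_eq.
have mE : m (y 0%N) (y 1%N) = (2 * k)%N by rewrite type_matrixE !node_val.
have mE' : m (y 1%N) (y 0%N) = (2 * k)%N by rewrite (proj1 hm).
apply: neg_one_root => // s.
have : (s == y 0%N) || (s == y 1%N).
  by rewrite -!val_eqE /= !node_val //; case: s => [[|[|]]].
case/orP => /eqP ->; first exact: half.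
have := half _ _ _ mE'; rewrite eq_sym => /(_ ne) E.
(* For the second root, exchange the two factors, which inverts the element. *)
have -> : ((coxeter_gen m (y 0%N) * coxeter_gen m (y 1%N)) ^+ k =
    ((coxeter_gen m (y 1%N) * coxeter_gen m (y 0%N)) ^+ k)^-1)%g.
  by rewrite -expVgn invgM !coxeter_genV.
by apply: (can_inj (actK hm ((coxeter_gen m (y 1%N) * coxeter_gen m (y 0%N)) ^+ k)%g));
  rewrite actVK // actN // E opprK.
Qed.

End TypeI2.
End Types.

(** * The types E7, H3 and F4 *)

Section SporadicTypes.
Variable R : realType.

(* Twice the cosine for the labels at most 5; the pair (0, 1) stands for a    *)
(* parameter equal to [kappa R 4] or [kappa R 5].                             *)
Definition label_coord (l : nat) : int * int :=
  match l with 1%N => (-2, 0) | 3%N => (1, 0) | 4%N | 5%N => (0, 1) | _ => (0, 0) end.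

Lemma label_coordE th l : l <> 0%N -> (l < 6)%N ->
  (l = 4 -> th = kappa R 4) -> (l = 5 -> th = kappa R 5) ->
  qeval th (label_coord l) = kappa R l.
Proof.
case: l => [|[|[|[|[|[|l]]]]]] // _ _ h4 h5; rewrite /qeval /=.
- by rewrite kappa1 mul0r addr0.
- by rewrite kappa2 mul0r addr0.
- by rewrite kappa3 mul0r addr0.
- by rewrite h4 // mul1r add0r.
- by rewrite h5 // mul1r add0r.
Qed.

(** Used with h half the Coxeter number, 9 for E7, 5 for H3 and 6 for F4, when this power of a
    Coxeter element is -1. *)
Definition coxeter_word (n h : nat) : seq nat := flatten (nseq h (iota 0 n)).

Lemma type_coord_neg_one T (T0 : (0 < rank T)%N) th p q w :
  coxeter_matrix (@type_matrix T) -> th ^+ 2 = p%:~R * th + q%:~R ->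
  (forall i j, (i < rank T)%N -> (j < rank T)%N ->
     qeval th (label_coord (type_label T i j)) = kappa R (type_label T i j)) ->
  all (fun i => i < rank T)%N w ->
  all (fun j => foldr (coord_refl (rank T) (type_label T) p q label_coord)
      (coord_basis (rank T) j) w == map qopp (coord_basis (rank T) j)) (iota 0 (rank T)) ->
  neg_one R (gen_prod (@type_matrix T) [seq node T0 i | i <- w]).
Proof.
move=> hm thE lE wT chk; apply: (coord_neg_one hm _ _ thE lE wT chk).
- by move=> s; exists s; rewrite ?nodeK.
- by move=> i j iT jT; rewrite type_matrixE !node_val.
Qed.

Lemma E7_neg_one : neg_one R (gen_prod (@type_matrix E7)
  [seq node (isT : (0 < rank E7)%N) i | i <- coxeter_word 7 9]).
Proof.
apply: (@type_coord_neg_one _ _ 0 0 0).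
- exact: type_coxeter_matrix.
- by rewrite expr0n /= mulr0 addr0.
- by move=> i j _ _; rewrite label_coordE // /type_label /=; do 2?case: ifP.
- by [].
- by vm_compute.
Qed.

Lemma H3_neg_one : neg_one R (gen_prod (@type_matrix H3)
  [seq node (isT : (0 < rank H3)%N) i | i <- coxeter_word 3 5]).
Proof.
apply: (@type_coord_neg_one _ _ (kappa R 5) 1 1).
- exact: type_coxeter_matrix.
- by rewrite kappa5 mul1r.
- by move=> i j _ _; rewrite label_coordE // /type_label /=; do 3?case: ifP.
- by [].
- by vm_compute.
Qed.

Lemma F4_neg_one (I : choiceType) (m : I -> I -> nat) d Y : coxeter_matrix m ->
  lists_F4 m d Y ->
  neg_one R (gen_prod m [seq nth d Y i | i <- coxeter_word 4 6]).
Proof.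
move=> hm [uY cov sY lE].
pose lbl i j := if i == j then 1%N else if (maxn i j) == (minn i j).+1
   then if minn i j == 1%N then 4 else 3 else 2.
apply: (@coord_neg_one R I m hm 4 (nth d Y) lbl _ _ (kappa R 4) 0 2 _ label_coord).
- by move=> s; exists (index s Y); [rewrite -sY index_mem|rewrite nth_index].
- move=> i j i4 j4; rewrite /lbl; case: (ltngtP i j) => [ij|ji|<-].
  + by rewrite lE // (minn_idPl (ltnW ij)) (maxn_idPr (ltnW ij)).
  + by rewrite (proj1 hm) lE // (minn_idPr (ltnW ji)) (maxn_idPl (ltnW ji)).
  + by rewrite (proj2 ((proj2 hm) _ _) erefl).
- by rewrite kappa4 mul0r add0r.
- by move=> i j _ _; rewrite label_coordE // /lbl; do 3?case: ifP.
- by [].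
- by vm_compute.
Qed.

(** In the word for -1 each generator occurs six times, so every character is trivial on it. *)
Lemma F4_char (I : choiceType) (m : I -> I -> nat) d Y z (chi : coxeter_group m -> bool) :
  coxeter_matrix m -> lists_F4 m d Y -> neg_one R z -> is_char chi -> chi z = false.
Proof.
move=> hm hY zN chiM.
have -> : z = gen_prod m [seq nth d Y i | i <- coxeter_word 4 6].
  by apply: (@act_inj R _ _ hm) => s; rewrite zN (F4_neg_one hm hY).
rewrite /coxeter_word /= !chiM char1 //.
move: (chi _) (chi _) (chi _) (chi _) => a b c e.
by case: a b c e => [] [] [] [].
Qed.

End SporadicTypes.

Lemma group_isomorphic_sym (G H : groupType) : group_isomorphic G H -> group_isomorphic H G.
Proof.
case=> f [g fK gK]; pose gm := isMultiplicative.Build H G g (bij_multiplicative fK gK).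
pose gM : {multiplicative H -> G} := HB.pack g gm.
by exists gM; exists f.
Qed.

Lemma group_isomorphic_trans (G H K : groupType) :
  group_isomorphic G H -> group_isomorphic H K -> group_isomorphic G K.
Proof.
case=> f [f' fK f'K] [g [g' gK g'K]].
have fgM : {morph g \o f : x y / (x * y)%g} by move=> x y; rewrite /= !gmulfM.
pose fgm := isMultiplicative.Build G K (g \o f) fgM.
pose fg : {multiplicative G -> K} := HB.pack (g \o f) fgm.
exists fg; exists (f' \o g') => x /=; first by rewrite gK fK.
by rewrite f'K g'K.
Qed.

(** * Type A does not contain -1 *)

Section TypeA.
Variables (R : realType) (n : nat) (n1 : (1 < n)%N).
Local Notation m := (@type_matrix (A_ n)).
Local Notation V := {freeg 'I_(rank (A_ n)) / R}.
Let hm : coxeter_matrix m. Proof. exact: type_coxeter_matrix. Qed.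
Local Notation y := (node (ltnW n1) : nat -> 'I_(rank (A_ n))).

Definition node_coeff (j : nat) (v : V) : R := if (j < n)%N then coeff (y j) v else 0.

(* The weights of the standard representation, which the Weyl group permutes. *)
Definition weight (j : nat) (v : V) : R :=
  node_coeff j v - (if j is i.+1 then node_coeff i v else 0).

Lemma weightD j u v : weight j (u + v) = weight j u + weight j v.
Proof.
rewrite /weight /node_coeff; case: j => [|j]; do ?case: ifP => _;
  by rewrite ?coeffD; ring.
Qed.

Lemma weightZ j c v : weight j (c *: v) = c * weight j v.
Proof.
rewrite /weight /node_coeff; case: j => [|j]; do ?case: ifP => _;
  by rewrite ?coeffZ; ring.
Qed.

Lemma weight_root j a : (a < n)%N ->
  weight j (simple_root R (y a)) = (a == j)%:R - (a.+1 == j)%:R.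
Proof.
move=> aN; have cE i : node_coeff i (simple_root R (y a)) = (a == i)%:R.
  rewrite /node_coeff coeffU mul1r; case: ifP => iN; first by rewrite node_eq.
  by case: eqP => // ai; move: iN; rewrite -ai aN.
by rewrite /weight cE; case: j => // j; rewrite cE eqSS.
Qed.

Lemma weight_form i v : (i < n)%N ->
  cform m v (simple_root R (y i)) = weight i v - weight i.+1 v.
Proof.
move=> iN; elim/freeg_ind_lin: v => [|u v IHu IHv|c s].
- by rewrite cform0l -(scale0r (0 : V)) !weightZ; ring.
- by rewrite cformE !weightD IHu IHv; ring.
rewrite cformE !weightZ -mulrBr; congr (_ * _).
rewrite -(nodeK (ltnW n1) s); have aN := ltn_ord s; set a := val s in aN *.
rewrite -/(simple_root R (y a)) cform_root type_matrixE !node_val // !weight_root // eqSS.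
case: (ltngtP a i) => [ai|ia|<-].
- have aiS : (a < i.+1)%N by rewrite ltnS ltnW.
  rewrite type_label_A // (ltn_eqF aiS) (eq_sym i).
  by case: eqP => _; rewrite ?kappa3 ?kappa2 /= ; ring.
- have iaS : (i < a.+1)%N by rewrite ltnS ltnW.
  rewrite type_labelC type_label_A // (gtn_eqF iaS).
  by case: eqP => _; rewrite ?kappa3 ?kappa2 /=; ring.
- by rewrite /type_label eqxx kappa1 (gtn_eqF (ltnSn _)) (ltn_eqF (ltnSn _)) /=; ring.
Qed.

Lemma weight_orbit (x : coxeter_group m) j : exists k, forall v : V, weight j (act x v) = weight k v.
Proof.
elim/(coxeter_ind hm): x j => [|s x IHx] j; first by exists j => v; rewrite act1.
have [i iN ->] : exists2 i, (i < n)%N & s = y i.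
  by exists (val s); rewrite ?nodeK //; apply: ltn_ord.
pose j' := if j == i then i.+1 else if j == i.+1 then i else j.
have [k kE] := IHx j'; exists k => v; rewrite -kE actM // act_gen // reflE.
rewrite -scaleNr weightD weightZ weight_form // weight_root // /j'.
move: (act x v) => u; rewrite (eq_sym i) (eq_sym i.+1).
case: eqP => [->|_]; first by rewrite (ltn_eqF (ltnSn i)) /=; ring.
by case: eqP => [->|_] /=; ring.
Qed.

(** The opposite of the first weight would be a weight; its value -1 on the first root singles out
    the second weight, which is 1 and not 0 on the second root. *)
Lemma type_A_no_neg_one z : neg_one R (z : coxeter_group m) -> False.
Proof.
move=> zN; have [k kE] := weight_orbit z 0.
have w0 := kE (simple_root R (y 0)); have w1 := kE (simple_root R (y 1)).
rewrite zN -scaleN1r weightZ !weight_root ?(ltnW n1) //= in w0.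
rewrite zN -scaleN1r weightZ !weight_root //= in w1.
by case: k {kE} w0 w1 => [|[|[|k]]] /=; lra.
Qed.

End TypeA.

(** * Product decompositions from folding *)

Section FoldProduct.
Variables (R : realType) (I : choiceType) (m m' : I -> I -> nat) (o e : I) (k : nat).

Definition fold_data :=
  [/\ o != e, (1 < k)%N, m o e = (2 * k)%N, m' o e = k &
   [/\ forall t, t != o -> t != e -> m o t = 2%N,
       forall t, t != o -> t != e -> m' o t = m e t
     & forall s t, s != o -> t != o -> m' s t = m s t]].

Hypotheses (hm : coxeter_matrix m) (hm' : coxeter_matrix m').
Hypothesis hf : fold_data.

(** The subgroup lies in the kernel of [chi] and has index at most 2, so a central involution
    outside this kernel generates a direct complement. *)
Lemma fold_product z : neg_one R z ->
  (forall chi : coxeter_group m -> bool, is_char chi ->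
     (forall s, chi (coxeter_gen m s) = (s == o)) -> chi z) ->
  group_isomorphic (coxeter_group m) (coxeter_group_of (A_ 1) * coxeter_group m')%type.
Proof.
have [oe k1 m_oe m'_oe [m_o m'_o m'_rest]] := hf.
move=> zN chi_z; have [phi phiE] := fold_hom hm hm' k1 m_oe m'_oe m_o m'_o m'_rest.
have [chi [chiM chi_gen]] := fold_char hm m_oe m_o.
have chiz := chi_z chi chiM chi_gen; have chi0 := fold_char0 hm' oe chiM chi_gen phiE.
have phi_inj := fold_inj R hm hm' oe k1 m_oe m'_oe m_o m'_o m'_rest phiE.
have [ze [ze_inj zeE]] := pair_subgroup_isomorphic (neg_one_neq1 hm o zN) (neg_one_sq hm zN).
have zeC u : ze u = 1%g \/ ze u = z.
  have : range ze (ze u) by exists u.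
  by rewrite zeE => -[]; [left|right].
have ze_comm u (w : coxeter_group m) : (ze u * w = w * ze u)%g.
  case: (zeC u) => ->; first by rewrite mul1g mulg1.
  exact: (neg_one_commute hm w zN).
pose F (p : coxeter_group_of (A_ 1) * coxeter_group m') := (ze p.1 * phi p.2)%g.
have FM : {morph F : p q / (p * q)%g}.
  move=> [u1 y1] [u2 y2]; rewrite /F /= !gmulfM -!mulgA; congr (_ * _)%g.
  by rewrite !mulgA ze_comm.
have F_inj : injective F.
  move=> [u1 y1] [u2 y2]; rewrite /F /= => E.
  have ze12 : ze u1 = ze u2.
    have := congr1 chi E; rewrite !chiM !chi0 !addbF.
    by case: (zeC u1) (zeC u2) => -> [] ->; rewrite ?char1 ?chiz.
  by move: E; rewrite ze12 => /mulgI/phi_inj ->; rewrite (ze_inj _ _ ze12).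
have F_surj x : exists p, F p = x.
  have [u0 u0E] : exists u, ze u = z.
    have : range ze z by rewrite zeE; right.
    by case=> u _ <-; exists u.
  have [y0 [b0 zE]] := fold_coset hm hm' oe m_o z phiE.
  (* As [chi] is trivial on the image of [phi] but not at z, z lies in the other coset. *)
  have {}zE : z = (phi y0 * coxeter_gen m o)%g.
    rewrite zE; case: b0 zE => zE; first by rewrite expg1.
    by move: chiz; rewrite zE expg0 mulg1 chi0.
  have [y [[] ->]] := fold_coset hm hm' oe m_o x phiE.
    exists (u0, y * y0^-1)%g; rewrite /F /= u0E -u0E ze_comm u0E zE gmulfM multiplicativeV.
    by rewrite expg1 -!mulgA mulKg.
  by exists (1, y)%g; rewrite /F /= multiplicative1 mul1g expg0 mulg1.
have [g gE] := choice F_surj.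
apply: group_isomorphic_sym; pose Fm := isMultiplicative.Build _ _ F FM.
pose FF : {multiplicative (coxeter_group_of (A_ 1) * coxeter_group m')%type -> coxeter_group m} :=
  HB.pack F Fm.
by exists FF; exists g => // p; apply: F_inj; rewrite /= gE.
Qed.

Lemma fold_char_neg_one z' chi : neg_one R (z' : coxeter_group m') -> 
  is_char chi -> (forall s, chi (coxeter_gen m s) = (s == o)) ->
  exists2 z, neg_one R z & chi z = false.
Proof.
have [oe k1 m_oe m'_oe [m_o m'_o m'_rest]] := hf.
move=> zN chiM chi_gen; have [phi phiE] := fold_hom hm hm' k1 m_oe m'_oe m_o m'_o m'_rest.
exists (phi z').
  exact: (fold_neg_one hm hm' oe k1 m_oe m'_oe m_o m'_o m'_rest phiE).
exact: (fold_char0 hm' oe chiM chi_gen phiE).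
Qed.

End FoldProduct.

Lemma fold_data_BD n (n1 : (1 < n)%N) :
  @fold_data 'I_n (@type_matrix (B_ n)) (@type_matrix (D_ n))
    (node (ltnW n1) 0) (node (ltnW n1) 1) 2.
Proof.
have val_neq (t : 'I_n) a (a1 : (a < n)%N) : t != node (ltnW n1) a -> nat_of_ord t != a.
  by rewrite -val_eqE /= node_val.
have n0 := ltnW n1; split=> //; rewrite ?node_eq //.
- by rewrite type_matrixE !node_val.
- by rewrite type_matrixE !node_val.
split=> [t /val_neq-/(_ n0) t0 /val_neq-/(_ n1) t1|t /val_neq-/(_ n0) t0 /val_neq-/(_ n1) t1|
  s t /val_neq-/(_ n0) s0 /val_neq-/(_ n0) t0]; rewrite !type_matrixE ?node_val //.
- by rewrite type_label_B ?lt0n // (negPf t1).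
- rewrite type_label_D ?lt0n // type_label_B; last by case: (nat_of_ord t) t0 t1 => [|[|j]].
  by case: (nat_of_ord t) t0 t1 => [|[|[|]]].
- wlog st : s t s0 t0 / (nat_of_ord s <= nat_of_ord t)%N.
    move=> H; have [st|st] := leqP (nat_of_ord s) (nat_of_ord t); first exact: H.
    by rewrite type_labelC (type_labelC (B_ n)) H // ltnW.
  move: st; rewrite leq_eqVlt => /orP[/eqP->|st]; first by rewrite /type_label eqxx.
  rewrite type_label_D // type_label_B // (negPf s0).
  by case: (nat_of_ord s) (nat_of_ord t) s0 t0 st => [|[|a]] [|[|[|b]]].
Qed.

Lemma fold_data_I2 k (k1 : (1 < k)%N) :
  @fold_data 'I_2 (@type_matrix (I2 (2 * k))) (@type_matrix (I2 k))
    (node (isT : (0 < 2)%N) 0) (node (isT : (0 < 2)%N) 1) k.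
Proof.
have two (t : 'I_2) : t != node (isT : (0 < 2)%N) 0 -> t = node (isT : (0 < 2)%N) 1.
  by move=> t0; apply/val_inj; move: t0; rewrite -val_eqE /= !node_val //; case: t => [[|[|]]].
split=> //; rewrite ?node_eq ?type_matrixE ?node_val //.
split=> [t /two->|t /two->|s t /two-> /two->]; rewrite ?eqxx //.
by rewrite !type_matrixE !node_val.
Qed.

(** * The center as a direct factor *)

Section CenterFactor.
Variables (R : realType) (I : choiceType) (m : I -> I -> nat).
Local Notation G := (coxeter_group m).
Hypothesis hm : coxeter_matrix m.
Hypothesis hirr : irreducible_coxeter m.

Lemma center_char_product (z : G) (chi : G -> bool) (s : I) : neg_one R z -> is_char chi ->
  chi z -> direct_product (center G) [set x | ~~ chi x].
Proof.
move=> zN chiM chiz; have zz := neg_one_sq hm zN; have chi1 := char1 chiM.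
have zC x := neg_one_commute hm x zN.
have CE := center_neg_one hm hirr s zN.
have zV : (z^-1 = z)%g by apply: mulg1_eq.
have chiV x : chi x^-1%g = chi x.
  by have := chiM x x^-1%g; rewrite mulgV chi1; case: (chi x) (chi x^-1%g) => [] [].
split.
- rewrite CE; apply: subgroupI => [|x y]; first by left.
  by case=> -> [] ->; rewrite ?invg1 ?zV ?mulg1 ?mul1g ?zz; [left|right|right|left].
- apply: subgroupI => /= [|x y]; first by rewrite chi1.
  by rewrite chiM chiV => /negPf-> /negPf->.
- by move=> a b aC _; apply: aC.
- apply/seteqP; split=> x /=; rewrite CE; first by case=> -[->|->] //; rewrite chiz.
  by move=> ->; rewrite chi1; split=> //; left.
- move=> x; rewrite CE; case chix: (chi x); last first.
    by exists 1%g, x; rewrite /= chix mul1g; split=> //; left.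
  exists z, (z * x)%g; split; [by right|by rewrite /= chiM chiz chix|].
  by rewrite mulgA zz mul1g.
Qed.

Lemma gen_neq1 s : coxeter_gen m s <> 1%g.
Proof.
move=> /(congr1 (fun x => act x (simple_root R s))); rewrite act1 // act_gen // refl_root //.
by move=> /eqP/freeg_eqP/(_ s); rewrite coeffN coeffU eqxx mulr1; lra.
Qed.

Lemma gen_neq_neg_one (s t : I) (z : G) : s != t -> neg_one R z -> coxeter_gen m s <> z.
Proof.
move=> st zN /(congr1 (fun x => act x (simple_root R t))); rewrite zN act_gen // reflE.
move=> /eqP/freeg_eqP/(_ t); rewrite !(coeffD, coeffN, coeffZ) !coeffU eqxx (negPf st).
by rewrite mulr0n mulr1n; lra.
Qed.

Lemma center_proper_factor (s t : I) : s != t -> centered R m -> proper_direct_factor (center G).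
Proof.
move=> st [z [zN [chi [chiM chiz]]]]; have CE := center_neg_one hm hirr s zN.
split.
- move=> C1; apply: (neg_one_neq1 hm s zN); have : center G z by rewrite CE; right.
  by rewrite C1.
- move=> CT; have : center G (coxeter_gen m s) by rewrite CT.
  by rewrite CE => -[/gen_neq1|/(gen_neq_neg_one st zN)].
- by exists [set x | ~~ chi x]; apply: center_char_product chiM chiz.
Qed.

(** All words for w, in particular a shortest one, have the parity given by [chi w]. *)
Lemma even_elementsE (chi : G -> bool) : parity_spec chi ->
  even_elements (range (coxeter_gen m)) = [set x | ~~ chi x].
Proof.
move=> chiP; have [chiM chi1] := chiP.
have word_parity w n : has_word (range (coxeter_gen m)) w n -> chi w = odd n.
  case=> u [<- uS <-]; elim: u uS => [_|x u IHu uS].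
    by rewrite big_nil char1.
  rewrite big_cons chiM IHu => [|s su]; last by apply: uS; rewrite inE su orbT.
  by have [s _ <-] := uS x (mem_head _ _); rewrite chi1.
apply/seteqP; split=> w /=; first by case=> n [[/word_parity-> _]].
move=> wev; have [u [su wE]] := len_word hm w.
have hw : has_word (range (coxeter_gen m)) w (len hm w).
  exists [seq coxeter_gen m s | s <- u]; split; rewrite ?size_map //.
    by move=> x /mapP[s _ ->]; exists s.
  by rewrite wE; elim: (u) => [|s v IHv] /=; rewrite ?big_nil // big_cons IHv.
have ex : exists n, `[< has_word (range (coxeter_gen m)) w n >].
  by exists (len hm w); apply/asboolP.
case: (ex_minnP ex) => n /asboolP wn nmin; exists n; split.
  by split=> // j wj; apply: nmin; apply/asboolP.
by rewrite -(word_parity _ _ wn).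
Qed.

End CenterFactor.

(** * The exceptional types *)

Section Exceptional.
Variable R : realType.

Lemma exceptional_rank T : exceptional_type T -> (1 < rank T)%N.
Proof. by case=> //= k k1; lia. Qed.

Lemma exceptional_matrix T : exceptional_type T -> coxeter_matrix (@type_matrix T).
Proof. by case=> *; apply: type_coxeter_matrix => // -[]; lia. Qed.

Lemma exceptional_irreducible T : exceptional_type T ->
  irreducible_coxeter (@type_matrix T).
Proof.
move=> hT; have T0 := ltnW (exceptional_rank hT).
case: hT T0 => [k k1|k k1||] T0.
- apply: (type_irreducible T0 (h := id)) => -[//|b] bT _; exists b; split=> //.
    exact: ltnW.
  by rewrite type_label_B // eqxx; case: ifP.
- apply: (type_irreducible T0 (h := id)) => -[//|[|//]] _ _.
  by exists 0%N; split=> //; rewrite type_label_lt //=; lia.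
- pose h b := nth 0%N [:: 0; 3; 1; 2; 3; 4; 5]%N b.
  pose p b := nth 0%N [:: 0; 3; 0; 2; 3; 4; 5]%N b.
  apply: (type_irreducible T0 (h := h)) => b bT b0; exists (p b).
  by case: b bT b0 => [|[|[|[|[|[|[|b]]]]]]].
- apply: (type_irreducible T0 (h := id)) => b bT b0; exists b.-1.
  by case: b bT b0 => [|[|[|b]]].
Qed.

Lemma parity_centered T (z : coxeter_group (@type_matrix T)) n : coxeter_matrix (@type_matrix T) ->
  neg_one R z -> (forall chi : coxeter_group (@type_matrix T) -> bool, parity_spec chi -> chi z = odd n) -> odd n ->
  centered R (@type_matrix T).
Proof.
move=> hm zN zodd on; have [chi chiP] := coxeter_parity hm.
by exists z; split=> //; exists chi; rewrite (zodd _ chiP); case: chiP.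
Qed.

Lemma sporadic_parity T n (T0 : (0 < rank T)%N)
    (chi : coxeter_group (@type_matrix T) -> bool) :
  parity_spec chi -> chi (gen_prod (@type_matrix T)
    [seq node T0 i | i <- coxeter_word (rank T) n]) = odd (n * rank T).
Proof.
move=> chiP; rewrite (parity_prod _ chiP) size_map /coxeter_word size_flatten.
by rewrite /shape map_nseq size_iota sumn_nseq mulnC.
Qed.

Lemma exceptional_centered T : exceptional_type T -> centered R (@type_matrix T).
Proof.
move=> hT; have hm := exceptional_matrix hT; case: hT hm => [k k1|k k1||] hm.
- have n1 : (1 < 2 * k + 1)%N by lia.
  apply: (parity_centered (n := (2 * k + 1)%N) hm (coxeter_elt_B_neg_one (R := R) n1)).
    by move=> chi chiP; rewrite charX ?(parity_coxeter_elt n1 _ chiP) ?andbb; case: chiP.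
  by rewrite addn1 /= oddM.
- have kE : (4 * k + 2 = 2 * (2 * k + 1))%N by lia.
  rewrite kE in hm *; have h1 : (0 < 2 * k + 1)%N by lia.
  exists ((coxeter_gen (@type_matrix (I2 (2 * (2 * k + 1)))) (node (isT : (0 < 2)%N) 0) *
    coxeter_gen (@type_matrix (I2 (2 * (2 * k + 1)))) (node (isT : (0 < 2)%N) 1))
    ^+ (2 * k + 1))%g.
  split; first exact: coxeter_elt_I2_neg_one.
  (* In rank 2 the sign is trivial at -1; the character that separates the two generators is used
     instead. *)
  have [| oe k1' m_oe m'_oe [m_o m'_o m'_rest]] := @fold_data_I2 (2 * k + 1); first by lia.
  have [chi [chiM chi_gen]] := fold_char hm m_oe m_o; exists chi; split=> //.
  have odd1 : odd (2 * k + 1) by rewrite addn1 /= oddM.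
  by rewrite charX // odd1 /= chiM !chi_gen eqxx eq_sym (negPf oe).
- apply: (parity_centered (n := (9 * 7)%N) hm (E7_neg_one (R := R))) => // chi chiP.
  exact: (@sporadic_parity E7 9 isT chi chiP).
- apply: (parity_centered (n := (5 * 3)%N) hm (H3_neg_one (R := R))) => // chi chiP.
  exact: (@sporadic_parity H3 5 isT chi chiP).
Qed.

(** A -1 in D_n would be the -1 of B_n and lie in the kernel of the folding character. But -1 is the
    n-th power of a Coxeter element, in which s_1 occurs n times, an odd number. *)
Lemma type_D_odd_not_centered n : odd n -> (3 < n)%N -> ~ centered R (@type_matrix (D_ n)).
Proof.
move=> on n3 [z' [zN' _]]; have n1 : (1 < n)%N by lia.
have hB : coxeter_matrix (@type_matrix (B_ n)) by exact: type_coxeter_matrix.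
have hD : coxeter_matrix (@type_matrix (D_ n)) by exact: type_coxeter_matrix.
have hf := fold_data_BD n1; have [oe k1 m_oe m'_oe [m_o m'_o m'_rest]] := hf.
have [chi [chiM chi_gen]] := fold_char hB m_oe m_o.
have [z zN] := fold_char_neg_one (R := R) hB hD hf zN' chiM chi_gen.
have -> : z = (coxeter_elt n1 n ^+ n)%g.
  by apply: (@act_inj R _ _ hB) => s; rewrite zN (coxeter_elt_B_neg_one (R := R) n1).
rewrite charX // on /=.
have chi_elt j : (0 < j)%N -> (j <= n)%N -> chi (coxeter_elt n1 j).
  elim: j => // -[_ _ _|j IHj _ jn].
    by rewrite /= chiM char1 // chi_gen eqxx.
  by rewrite coxeter_eltS chiM IHj ?(ltnW jn) // chi_gen node_eq ?(ltnW n1).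
by rewrite chi_elt // ltnW.
Qed.

End Exceptional.

(** * Direct decompositions *)

Lemma centered_exceptional (R : realType) (I : choiceType) (m : I -> I -> nat)
    (z x : coxeter_group m) (chi : coxeter_group m -> bool) :
  coxeter_matrix m -> irreducible_coxeter m -> neg_one R z -> is_char chi -> chi z ->
  x <> 1%g -> x <> z ->
  exists T, exceptional_type T /\ group_isomorphic (coxeter_group m) (coxeter_group_of T).
Proof.
move=> hm hirr zN chiM chiz x1 xz; have [d _] := coxeter_inhabited hm x1.
have cen : centered R m by exists z; split=> //; exists chi.
have [|||] := classification hm hirr zN d.
- move=> [T [Y [hY]]] [[n n0 TE]|[n n2 TE]|[n /andP[on n3] TE]].
  + have T1 : T <> I2 1 by rewrite TE.
    have [_ [z' [z'N _]]] := lists_iso hm hY T1 cen.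
    case: (ltngtP n 1%N) => [|n1|n1]; first by case: n n0 {TE}.
      by move: z' z'N; rewrite TE => z' /(type_A_no_neg_one n1).
    (* In rank 1 the group has only the elements 1 and z, which [x] excludes. *)
    have sg s : s = d.
      case: hY => uY cov sY _; have := cov s; have := cov d; move: sY.
      by rewrite TE n1; case: (Y) => [|a [|b l]] //= _; rewrite !inE => /eqP-> /eqP->.
    have two y : y = 1%g \/ y = coxeter_gen m d.
      elim/(coxeter_ind hm): y => [|s y [->|->]]; rewrite ?(sg s); first by left.
        by right; rewrite mulg1.
      by left; rewrite coxeter_gen_sq.
    case: (two x) => // xE; case: (two z) => zE; last by case: xz; rewrite xE zE.
    by case: (neg_one_neq1 hm d zN).
  + have T1 : T <> I2 1 by rewrite TE.
    have [iso [z' [z'N [c [cM cz']]]]] := lists_iso hm hY T1 cen.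
    exists T; split=> //; move: z' z'N c cM cz'; rewrite TE => z' z'N c cM.
    have n1 := ltnW n2; have hB : coxeter_matrix (@type_matrix (B_ n)) by exact: type_coxeter_matrix.
    have -> : z' = (coxeter_elt n1 n ^+ n)%g.
      by apply: (@act_inj R _ _ hB) => s; rewrite z'N (coxeter_elt_B_neg_one (R := R) n1).
    rewrite charX // => /andP[on _].
    have -> : n = (2 * n./2 + 1)%N by rewrite -{1}(odd_double_half n) on mul2n addnC.
    by constructor; case: (n) n2 => [|[|[]]].
  + have T1 : T <> I2 1 by rewrite TE.
    have [_ cT] := lists_iso hm hY T1 cen.
    by rewrite TE in cT; case: (type_D_odd_not_centered on n3 cT).
- move=> [T [Y [hY]]] TE.
  have T1 : T <> I2 1 by case: TE => [->|->|[k /andP[_ k3] ->]] // -[k1]; rewrite k1 in k3.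
  have [iso cT] := lists_iso hm hY T1 cen.
  exists T; split=> //; case: TE cT => [->|->|[k /andP[ek k3] ->]] {iso}; try by constructor.
  have -> : k = (2 * k./2)%N by rewrite mul2n -{1}(odd_double_half k) (negPf ek).
  have j1 : (1 < k./2)%N by case: (k) k3 => [|[|[|[|]]]].
  move: (k./2) j1 => j j1 [z' [z'N [c [cM]]]].
  have hI : coxeter_matrix (@type_matrix (I2 (2 * j))).
    by apply: type_coxeter_matrix => -[]; lia.
  have j0 := ltnW j1; have zE := coxeter_elt_I2_neg_one (R := R) j0.
  have -> := @act_inj R _ _ hI z' _ (fun s => etrans (z'N _) (esym (zE _))).
  rewrite charX // => /andP[oj _].
  have -> : (2 * j = 4 * j./2 + 2)%N.
    by have := odd_double_half j; rewrite oj -mul2n; lia.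
  by constructor; case: (j) j1 oj => [|[|[]]].
- move=> [Y [uY cov evY oddY]].
  by move: chiz; rewrite (odd_and_even_char hm uY cov hirr zN evY oddY chiM).
- by move=> [Y hY]; move: chiz; rewrite (F4_char hm hY zN chiM).
Qed.

(** * Transport along an isomorphism *)

Section Transport.
Variables (G H : groupType) (f : {multiplicative G -> H}) (g : H -> G).
Hypotheses (fK : cancel f g) (gK : cancel g f).

Lemma subgroup_preimage A : subgroup A -> subgroup (f @^-1` A).
Proof.
move=> sA; apply: subgroupI => [|x y Ax Ay] /=.
  by rewrite multiplicative1; apply: subgroup1.
by rewrite gmulfM multiplicativeV; apply: subgroupM => //; apply: subgroupV.
Qed.

Lemma preimage_eq1 A : f @^-1` A = [set 1%g] -> A = [set 1%g].
Proof.
move=> /seteqP[A1 A1']; apply/seteqP; split=> x /=.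
  by move=> Ax; rewrite -(gK x) (A1 (g x)) ?multiplicative1 //= gK.
by move=> ->; rewrite -(multiplicative1 f); apply: A1'.
Qed.

Lemma preimage_inj A B : f @^-1` A = f @^-1` B -> A = B.
Proof.
by move=> /seteqP[AB BA]; apply/seteqP; split=> x; rewrite -(gK x); [apply: AB|apply: BA].
Qed.

Lemma center_preimage : f @^-1` center H = center G.
Proof.
apply/seteqP; split=> x /= xC y.
  by apply: (can_inj fK); rewrite !gmulfM xC.
by rewrite -(gK y) /commute -!gmulfM xC.
Qed.

Lemma direct_product_preimage A B :
  direct_product A B -> direct_product (f @^-1` A) (f @^-1` B).
Proof.
case=> sA sB AB AB1 ABgen; split.
- exact: subgroup_preimage.
- exact: subgroup_preimage.
- by move=> a b Aa Bb; apply: (can_inj fK); rewrite !gmulfM AB.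
- apply/seteqP; split=> x /=.
    move=> [Ax Bx]; have : (A `&` B) (f x) by [].
    by rewrite AB1 /= -(multiplicative1 f) => /(can_inj fK).
  move=> ->; rewrite multiplicative1; have : (A `&` B) 1%g by rewrite AB1.
  by [].
- move=> x; have [a [b [Aa Bb xE]]] := ABgen (f x).
  exists (g a), (g b); rewrite /= !gK; split=> //.
  by apply: (can_inj fK); rewrite gmulfM !gK.
Qed.

End Transport.

Lemma center_factor_iso (G H : groupType) : group_isomorphic G H ->
  proper_direct_factor (center H) -> proper_direct_factor (center G).
Proof.
case=> f [g fK gK] [C1 CT [B HB]]; rewrite -(center_preimage fK gK); split.
- by move/(preimage_eq1 gK).
- by rewrite -(preimage_setT f) => /(preimage_inj gK).
- by exists (f @^-1` B); apply: (direct_product_preimage fK gK).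
Qed.

Lemma exceptional_center_factor (G : groupType) T : exceptional_type T ->
  group_isomorphic G (coxeter_group_of T) -> proper_direct_factor (center G).
Proof.
move=> hT iso; apply: (center_factor_iso iso).
have n1 := exceptional_rank hT.
apply: (@center_proper_factor Rdefinitions.R _ _ (exceptional_matrix hT)
  (exceptional_irreducible hT) (node (ltnW n1) 0) (node (ltnW n1) 1)).
  by rewrite node_eq // ltnW.
exact: exceptional_centered.
Qed.

Lemma coxeter_direct_factors (W : groupType) (S : set W) (m : S -> S -> nat)
    (G1 G2 : set W) : coxeter_system m -> irreducible_coxeter m ->
  direct_product G1 G2 -> G1 <> [set 1%g] -> G2 <> [set 1%g] ->
  [/\ G1 = center W \/ G2 = center W, center W <> [set 1%g],
      subgroup_isomorphic (center W) (coxeter_group_of (A_ 1))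
    & exists T, exceptional_type T /\ group_isomorphic W (coxeter_group_of T)].
Proof.
move=> [hm [f [[g fK gK] _]]] hirr G12 G11 G21.
have [z [zN ctr [chi [chiM chiz]] [x [x1 xz]]]] := direct_product_neg_one
  Rdefinitions.R hm hirr (direct_product_preimage fK gK G12)
  (fun e => G11 (preimage_eq1 gK e)) (fun e => G21 (preimage_eq1 gK e)).
have [s _] := coxeter_inhabited hm x1.
have CE : center W = [set 1%g; f z].
  apply: (preimage_inj (f := f) gK); rewrite (center_preimage fK gK).
  rewrite (center_neg_one hm hirr s zN); apply/seteqP; split=> y /=.
    by case=> ->; rewrite ?multiplicative1; [left|right].
  by case=> [|/(can_inj fK)]; [rewrite -(multiplicative1 f) => /(can_inj fK)|]; [left|right].
have fz1 : f z <> 1%g.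
  by rewrite -(multiplicative1 f) => /(can_inj fK); apply: neg_one_neq1 s zN.
split.
- by case: ctr => E; [left|right]; apply: (preimage_inj gK);
    rewrite E (center_preimage fK gK).
- move=> C1; apply: fz1; have : center W (f z) by rewrite CE; right.
  by rewrite C1.
- rewrite CE; apply: pair_subgroup_isomorphic => //.
  by rewrite -gmulfM (neg_one_sq hm zN) multiplicative1.
- have [T [hT iso]] := centered_exceptional hm hirr zN chiM chiz x1 xz.
  exists T; split=> //; apply: group_isomorphic_trans iso.
  by apply: group_isomorphic_sym; exists f; exists g.
Qed.

Lemma type_B_product k : (1 <= k)%N ->
  group_isomorphic (coxeter_group_of (B_ (2 * k + 1)))
    (coxeter_group_of (A_ 1) * coxeter_group_of (D_ (2 * k + 1)))%type.
Proof.
move=> k1; have n1 : (1 < 2 * k + 1)%N by lia.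
have hB : coxeter_matrix (@type_matrix (B_ (2 * k + 1))) by exact: type_coxeter_matrix.
have hD : coxeter_matrix (@type_matrix (D_ (2 * k + 1))) by exact: type_coxeter_matrix.
apply: (@fold_product Rdefinitions.R _ _ _ _ _ _ hB hD (fold_data_BD n1) _
  (coxeter_elt_B_neg_one n1)).
move=> chi chiM chi_gen; have odd1 : odd (2 * k + 1) by rewrite addn1 /= oddM.
rewrite charX // odd1 /=.
have chi_elt j : (0 < j)%N -> (j <= 2 * k + 1)%N -> chi (coxeter_elt n1 j).
  elim: j => // -[_ _ _|j IHj _ jn].
    by rewrite /= chiM char1 // chi_gen eqxx.
  by rewrite coxeter_eltS chiM IHj ?(ltnW jn) // chi_gen node_eq ?(ltnW n1).
by rewrite chi_elt // ltnW.
Qed.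

Lemma type_I2_product k : (1 <= k)%N ->
  group_isomorphic (coxeter_group_of (I2 (4 * k + 2)))
    (coxeter_group_of (A_ 1) * coxeter_group_of (I2 (2 * k + 1)))%type.
Proof.
move=> k1; have n1 : (1 < 2 * k + 1)%N by lia.
have -> : (4 * k + 2 = 2 * (2 * k + 1))%N by lia.
have hI : coxeter_matrix (@type_matrix (I2 (2 * (2 * k + 1)))).
  by apply: type_coxeter_matrix => -[]; lia.
have hI' : coxeter_matrix (@type_matrix (I2 (2 * k + 1))).
  by apply: type_coxeter_matrix => -[]; lia.
apply: (@fold_product Rdefinitions.R _ _ _ _ _ _ hI hI' (fold_data_I2 n1) _
  (coxeter_elt_I2_neg_one (ltnW n1))).
move=> chi chiM chi_gen; have odd1 : odd (2 * k + 1) by rewrite addn1 /= oddM.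
by rewrite charX // odd1 /= chiM !chi_gen eqxx node_eq.
Qed.

(** Here -1 is a product of 63 or 15 generators, so it is odd and the kernel of the sign complements
    the center. *)
Lemma sporadic_even_factor T : T = E7 \/ T = H3 ->
  direct_product (center (coxeter_group_of T)) (even_elements (coxeter_gens_of T)).
Proof.
move=> TE; have hT : exceptional_type T by case: TE => ->; constructor.
have hm := exceptional_matrix hT; have T0 := ltnW (exceptional_rank hT).
have [chi chiP] := coxeter_parity hm.
rewrite /coxeter_gens_of (even_elementsE hm chiP).
have [z zN chiz] : exists2 z, neg_one Rdefinitions.R (z : coxeter_group (@type_matrix T)) & chi z.
  case: TE chi chiP {hT hm T0} => -> chi chiP.
    exists (gen_prod (@type_matrix E7) [seq node (isT : (0 < rank E7)%N) i | i <- coxeter_word 7 9]).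
      exact: E7_neg_one.
    by rewrite (@sporadic_parity E7 9 isT chi chiP).
  exists (gen_prod (@type_matrix H3) [seq node (isT : (0 < rank H3)%N) i | i <- coxeter_word 3 5]).
    exact: H3_neg_one.
  by rewrite (@sporadic_parity H3 5 isT chi chiP).
exact: (center_char_product hm (exceptional_irreducible hT) (node T0 0) zN (proj1 chiP) chiz).
Qed.

Lemma indecomposable_iff (W : groupType) (S : set W) (m : S -> S -> nat) :
  coxeter_system m -> irreducible_coxeter m ->
  directly_indecomposable W <->
  forall T, exceptional_type T -> ~ group_isomorphic W (coxeter_group_of T).
Proof.
move=> hWS hirr; split=> [ind T hT iso|noT [A [B [A1 B1 AB]]]].
  have [C1 CT [B CB]] := exceptional_center_factor hT iso.
  (* A trivial complement would make the center the whole group. *)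
  apply: ind; exists (center W), B; split=> // B1; apply: CT; apply/seteqP; split=> // x _.
  case: CB => _ _ _ _ /(_ x)[c [b [Cc Bb ->]]].
  by move: Bb; rewrite B1 /= => ->; rewrite mulg1.
have [_ _ _ [T [hT iso]]] := coxeter_direct_factors hWS hirr AB A1 B1.
exact: noT hT iso.
Qed.

Unset Implicit Arguments.
Local Close Scope ring_scope.
Local Open Scope group_scope.

Theorem theorem3p3 (W : groupType) (S : set W) (m : S -> S -> nat)
    (hWS : coxeter_system m) (hirr : irreducible_coxeter m) :
  (forall G1 G2 : set W, direct_product G1 G2 ->
     G1 <> [set 1] -> G2 <> [set 1] ->
     [/\ G1 = center W \/ G2 = center W,
         center W <> [set 1],
         subgroup_isomorphic (center W) (coxeter_group_of (A_ 1))
       & exists T, exceptional_type T /\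
           group_isomorphic W (coxeter_group_of T)]) /\
  (forall T, exceptional_type T -> group_isomorphic W (coxeter_group_of T) ->
     proper_direct_factor (center W)) /\
  (forall k, (1 <= k)%N ->
     group_isomorphic (coxeter_group_of (B_ (2 * k + 1)))
       (coxeter_group_of (A_ 1) * coxeter_group_of (D_ (2 * k + 1)))%type) /\
  (forall k, (1 <= k)%N ->
     group_isomorphic (coxeter_group_of (I2 (4 * k + 2)))
       (coxeter_group_of (A_ 1) * coxeter_group_of (I2 (2 * k + 1)))%type) /\
  (forall T, T = E7 \/ T = H3 ->
     direct_product (center (coxeter_group_of T))
       (even_elements (coxeter_gens_of T))) /\
  (directly_indecomposable W <->
     forall T, exceptional_type T ->
       ~ group_isomorphic W (coxeter_group_of T)).
Proof.
split; first by move=> G1 G2; apply: coxeter_direct_factors hWS hirr.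
split; first by move=> T; apply: exceptional_center_factor.
split; first exact: type_B_product.
split; first exact: type_I2_product.
split; first exact: sporadic_even_factor.
exact: indecomposable_iff hWS hirr.
Qed.
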